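(* The divisor $\mathcal H/\Gamma\subset\mathcal D/\Gamma$ has $3$ irreducible components $\mathcal H_1,\mathcal H_2,\mathcal H_3$, and $\mathcal H/\Gamma^*\subset\mathcal D/\Gamma^*$ has $4$ irreducible components $\mathcal H_1^*,\mathcal H_2^*,\mathcal H_{3a}^*,\mathcal H_{3b}^*$, such that the natural map $\mathcal D/\Gamma^*\to\mathcal D/\Gamma$ induces maps \begin{itemize} \item $\mathcal H_i^*\to\mathcal H_i$, $i=1,2$, of degree $5$; \item $\mathcal H_{3a}^*\to\mathcal H_3$ and $\mathcal H_{3b}^*\to\mathcal H_3$ of degree $4$ and $1$ respectively. \end{itemize}
   Context: Let $T=U\oplus U\oplus E_8\oplus A_1^5$ ($U$ the hyperbolic plane, root lattices negative definite), $r_1,\dots,r_5$ an orthogonal basis of the summand $A_1^5$ with $r_i^2=-2$, $A_T=T^*/T\cong\mathbb F_2^5$, $\xi_i=r_i/2\in A_T$. Let $\Gamma=O(T)$, $\Gamma^*=\{\gamma\in O(T):\gamma(\xi_1)=\xi_1\}$. Let $\mathcal D=\{\omega\in\mathbb P(T\otimes\mathbb C):(\omega,\omega)=0,(\omega,\bar\omega)>0\}$, $\Delta=\{r\in T:r^2=-2\}$, $\mathcal H_r=\{\omega\in\mathcal D:(r,\omega)=0\}$ and $\mathcal H=\bigcup_{r\in\Delta}\mathcal H_r$. Let $\Delta_1=\{r\in\Delta:r/2\notin T^*\}$, $\Delta_2=\{r\in\Delta: r/2\equiv\sum_{i=1}^5\xi_i\}$, $\Delta_3=\{r\in\Delta:r/2\equiv\xi_i\text{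 for some }i\}$, $\Delta_{3a}=\{r\in\Delta: r/2\equiv\xi_i\text{ for some }i\ne1\}$, $\Delta_{3b}=\{r\in\Delta:r/2\equiv\xi_1\}$ (congruences in $A_T$). The component $\mathcal H_i$ is the image in $\mathcal D/\Gamma$ of $\bigcup_{r\in\Delta_i}\mathcal H_r$, and $\mathcal H^*_1,\mathcal H^*_2,\mathcal H^*_{3a},\mathcal H^*_{3b}$ are the images in $\mathcal D/\Gamma^*$ of the unions of $\mathcal H_r$ over $\Delta_1,\Delta_2,\Delta_{3a},\Delta_{3b}$. *)

(* Defs.v *)
From HB Require Import structures.
From mathcomp Require Import all_boot all_order all_algebra.
From mathcomp Require Import complex.
From mathcomp Require Import all_classical all_reals all_analysis.

Set Implicit Arguments.
Unset Strict Implicit.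
Unset Printing Implicit Defensive.

Import Order.TTheory GRing.Theory Num.Theory.
Import numFieldNormedType.Exports.

Local Open Scope classical_set_scope.
Local Open Scope ring_scope.
Local Open Scope quotient_scope.

(** * The lattice T = U + U + E8 + A1^5 *)

Definition gramU : 'M[int]_2 := \matrix_(i, j) (i != j)%:R.

(* E8 as the tree T_{2,3,5}: the path 0 - 1 - ... - 6, with the extra vertex 7
   attached to 2. *)
Definition E8_edge (i j : nat) : bool :=
  ((j == i.+1) && (j < 7)%N) || ((i == 2%N) && (j == 7%N)).

Definition gramE8 : 'M[int]_8 :=
  \matrix_(i, j) (if i == j then - 2%:R else (E8_edge i j || E8_edge j i)%:R).

Definition gramA1_5 : 'M[int]_5 := (- 2%:R)%:M.

Definition gramT : 'M[int]_17 :=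
  block_mx gramU 0 0 (block_mx gramU 0 0 (block_mx gramE8 0 0 gramA1_5))
  : 'M[int]_(2 + (2 + (8 + 5))).

Notation latT := 'rV[int]_17.

(* T -> T (x) K, and likewise for matrices *)
Definition ext {K : nzRingType} {m n} (x : 'M[int]_(m, n)) : 'M[K]_(m, n) :=
  map_mx intr x.

(* The K-bilinear extension of the form of T to T (x) K. *)
Definition form {K : nzRingType} (x y : 'rV[K]_17) : K :=
  (x *m ext gramT *m y^T) 0 0.

Definition dualT : set 'rV[rat]_17 :=
  [set x | forall t : latT, form x (ext t) \is a Num.int].

(* Equality of classes modulo T; for x, y in T^*, this is equality in A_T. *)
Definition congT (x y : 'rV[rat]_17) : Prop := exists t : latT, x - y = ext t.

Definition half (r : latT) : 'rV[rat]_17 := 2%:R^-1 *: ext r.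

(* The indices 0, ..., 4 stand for 1, ..., 5. *)
Definition rA1 (i : 'I_5) : latT :=
  delta_mx 0 (rshift 2 (rshift 2 (rshift 8 i)) : 'I_(2 + (2 + (8 + 5)))).

Definition xi (i : 'I_5) : 'rV[rat]_17 := half (rA1 i).

Definition Delta : set latT := [set r | form r r = - 2%:R].
Definition Delta1 : set latT := [set r | Delta r /\ ~ dualT (half r)].
Definition Delta2 : set latT :=
  [set r | Delta r /\ congT (half r) (\sum_i xi i)].
Definition Delta3 : set latT :=
  [set r | Delta r /\ exists i, congT (half r) (xi i)].
Definition Delta3a : set latT :=
  [set r | Delta r /\ exists i, i != ord0 /\ congT (half r) (xi i)].
Definition Delta3b : set latT := [set r | Delta r /\ congT (half r) (xi ord0)].

(** * The groups, acting on row vectors by right multiplication *)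

Definition OT : set 'M[int]_17 :=
  [set g | g \in unitmx /\ g *m gramT *m g^T = gramT].

Definition OTstar : set 'M[int]_17 :=
  [set g | OT g /\ congT (xi ord0 *m ext g) (xi ord0)].

Record matgroup := MatGroup {
  mg_set : set 'M[int]_17;
  mg_unit : forall g, mg_set g -> g \in unitmx;
  mg_1 : mg_set 1%:M;
  mg_mul : forall g h, mg_set g -> mg_set h -> mg_set (g *m h);
  mg_inv : forall g, mg_set g -> mg_set (invmx g) }.

Section Ext.
Context {K : nzRingType}.

Lemma extM m n p (x : 'M[int]_(m, n)) (y : 'M[int]_(n, p)) :
  ext (x *m y) = ext x *m ext y :> 'M[K]_(m, p).
Proof. exact: map_mxM. Qed.

Lemma ext1 n : ext 1%:M = 1%:M :> 'M[K]_n.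
Proof. exact: map_mx1. Qed.

Lemma extN m n (x : 'M[int]_(m, n)) : ext (- x) = - ext x :> 'M[K]_(m, n).
Proof. exact: map_mxN. Qed.

Lemma extD m n (x y : 'M[int]_(m, n)) :
  ext (x + y) = ext x + ext y :> 'M[K]_(m, n).
Proof. exact: map_mxD. Qed.
End Ext.

Lemma OT_1 : OT 1%:M.
Proof. by split; rewrite ?unitmx1 // mul1mx trmx1 mulmx1. Qed.

Lemma OT_mul g h : OT g -> OT h -> OT (g *m h).
Proof.
move=> [gu gG] [hu hG]; split; first by rewrite unitmx_mul gu hu.
by rewrite trmx_mul -!mulmxA (mulmxA h) (mulmxA (h *m gramT)) hG mulmxA gG.
Qed.

Lemma OT_inv g : OT g -> OT (invmx g).
Proof.
move=> [gu gG]; split; first by rewrite unitmx_inv.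
rewrite -[in LHS]gG -!mulmxA -trmx_mul mulVmx // trmx1 mulmx1.
by rewrite mulmxA mulVmx // mul1mx.
Qed.

Definition Gamma : matgroup :=
  @MatGroup OT (fun g Hg => Hg.1) OT_1 OT_mul OT_inv.

Lemma OTstar_1 : OTstar 1%:M.
Proof.
split; first exact: OT_1.
by exists 0; rewrite ext1 mulmx1 subrr /ext map_mx0.
Qed.

Lemma OTstar_mul g h : OTstar g -> OTstar h -> OTstar (g *m h).
Proof.
move=> [gO [t gt]] [hO [s hs]]; split; first exact: OT_mul.
exists (t *m h + s); rewrite extM mulmxA extD extM -gt -hs mulmxBl.
by rewrite addrA subrK.
Qed.

Lemma OTstar_inv g : OTstar g -> OTstar (invmx g).
Proof.
move=> [gO [t gt]]; split; first exact: OT_inv.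
exists (- (t *m invmx g)); rewrite extN extM -gt mulmxBl -mulmxA -extM.
by rewrite mulmxV ?gO.1 // ext1 mulmx1 opprB.
Qed.

Definition Gammastar : matgroup :=
  @MatGroup OTstar (fun g Hg => Hg.1.1) OTstar_1 OTstar_mul OTstar_inv.

(** * The period domain *)

(* R[i], declared at an abstract structure type so that its norm topology and
   the normed module structure of 'rV[CC R]_17 are inferred. *)
Definition CC (R : realType) : numClosedFieldType := complex R.

Section Domain.
Variable R : realType.

Notation VC := 'rV[CC R]_17.

Definition nzVC : Type := set_type [set w : VC | w != 0].
HB.instance Definition _ := Topological.on nzVC.
HB.instance Definition _ := Choice.on nzVC.

Definition proj_rel (v w : nzVC) : bool :=
  `[< exists2 c : CC R, c != 0 & \val w = c *: \val v >].

Lemma proj_rel_equiv : equiv_class_of proj_rel.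
Proof.
split=> [v|v w|w v u].
- by apply/asboolP; exists 1; rewrite ?oner_neq0 ?scale1r.
- apply/asboolP/asboolP => -[c c0 E]; exists c^-1; rewrite ?invr_eq0 //.
    by rewrite E scalerA mulVf ?scale1r.
  by rewrite E scalerA mulVf ?scale1r.
- move=> /asboolP[c c0 E] /asboolP[d d0 F]; apply/asboolP.
  by exists (d * c); rewrite ?mulf_neq0 // F E scalerA.
Qed.

Canonical proj_equiv := EquivRelPack proj_rel_equiv.

Definition PT : Type := quotient_topology {eq_quot proj_equiv}.
HB.instance Definition _ := Topological.on PT.
HB.instance Definition _ := Choice.on PT.
HB.instance Definition _ := Quotient.on PT.

(* a choice of homogeneous coordinates *)
Definition hc (p : PT) : VC := \val (repr p : nzVC).

Definition Dset : set PT :=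
  [set p | form (hc p) (hc p) = 0 /\ 0 < form (hc p) (map_mx Num.conj (hc p))].

Definition D : Type := set_type Dset.
HB.instance Definition _ := Topological.on D.
HB.instance Definition _ := Choice.on D.

(* w is a vector of homogeneous coordinates of x *)
Definition coords (w : VC) (x : D) : Prop :=
  exists2 c : CC R, c != 0 & w = c *: hc (\val x).

Definition hyp (r : latT) : set D := [set x | form (ext r) (hc (\val x)) = 0].

(* y = x g for some g in G *)
Definition orbit_rel (G : matgroup) (x y : D) : bool :=
  `[< exists2 g, mg_set G g & coords (hc (\val x) *m ext g) y >].

Lemma ext_unit (g : 'M[int]_17) :
  g \in unitmx -> (ext g : 'M[CC R]_17) *m ext (invmx g) = 1%:M.
Proof. by move=> gu; rewrite -extM mulmxV // ext1. Qed.

Lemma hc_inj (x y : D) c : c != 0 -> hc (\val y) = c *: hc (\val x) -> x = y.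
Proof.
move=> c0 E; apply: val_inj; rewrite -[LHS]reprK -[RHS]reprK.
by apply/eqmodP/asboolP; exists c.
Qed.

Lemma orbit_rel_equiv G : equiv_class_of (orbit_rel G).
Proof.
have sy x y : orbit_rel G x y -> orbit_rel G y x.
  move=> /asboolP[g Gg [c c0 E]]; apply/asboolP.
  exists (invmx g); first exact: mg_inv.
  exists c^-1; first by rewrite invr_eq0.
  have -> : hc (\val y) = c^-1 *: (hc (\val x) *m ext g).
    by rewrite E scalerA mulVf // scale1r.
  by rewrite -scalemxAl -mulmxA ext_unit ?mulmx1 // (mg_unit Gg).
split=> [x|x y|y x z].
- apply/asboolP; exists 1%:M; first exact: mg_1.
  by exists 1; rewrite ?oner_neq0 // ext1 mulmx1 scale1r.
- by apply/idP/idP; exact: sy.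
- move=> /asboolP[g Gg [c c0 E]] /asboolP[h Gh [d d0 F]]; apply/asboolP.
  exists (g *m h); first exact: mg_mul.
  exists (c * d); first by rewrite mulf_neq0.
  by rewrite extM mulmxA E -scalemxAl F scalerA.
Qed.

Canonical orbit_equiv G := EquivRelPack (orbit_rel_equiv G).

(* D / G with the quotient topology *)
Definition DQ (G : matgroup) : Type :=
  quotient_topology {eq_quot orbit_equiv G}.
HB.instance Definition _ G := Topological.on (DQ G).
HB.instance Definition _ G := Choice.on (DQ G).
HB.instance Definition _ G := Quotient.on (DQ G).

Definition orb (G : matgroup) (x : D) : DQ G := \pi_(DQ G) x.

Lemma orbP G (x y : D) : orb G x = orb G y <-> orbit_rel G x y.
Proof. by split=> /eqmodP. Qed.

Definition natmap (x : DQ Gammastar) : DQ Gamma := orb Gamma (repr x).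

Lemma natmapE (x : D) : natmap (orb Gammastar x) = orb Gamma x.
Proof.
have /orbP/asboolP[g Gg xg] := reprK (orb Gammastar x).
by apply/orbP/asboolP; exists g => //; exact: Gg.1.
Qed.

(* The image in D / G of the union of the H_r, for r in S. *)
Definition Hdiv (G : matgroup) (S : set latT) : set (DQ G) :=
  orb G @` (\bigcup_(r in S) hyp r).

(** * Complex analytic geometry on D / G *)

(* f is holomorphic on the open set U of the complex manifold D: around each
   point of U, f is induced by a holomorphic function F of the homogeneous
   coordinates. D is a locally closed submanifold of P(T (x) C), so this is
   holomorphy in local charts. *)
Definition holomorphic_on (U : set D) (f : D -> CC R) : Prop :=
  forall x, U x -> exists (W : set VC) (F : VC -> CC R),
    [/\ open W, W (hc (\val x)), forall w, W w -> differentiable F w &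
        forall y w, U y -> W w -> coords w y -> f y = F w].

(* The structure sheaf of D / G: G-invariant holomorphic functions. *)
Definition holomorphic_quot G (U : set (DQ G)) (f : DQ G -> CC R) : Prop :=
  holomorphic_on (orb G @^-1` U) (f \o orb G).

Definition analytic_set G (Z : set (DQ G)) : Prop :=
  forall p : DQ G, exists (U : set (DQ G)) (n : nat) (f : 'I_n -> DQ G -> CC R),
    [/\ open U, U p, forall i, holomorphic_quot U (f i) &
        forall q, U q -> (Z q <-> forall i, f i q = 0)].

Definition irreducible_analytic G (Z : set (DQ G)) : Prop :=
  [/\ analytic_set Z, Z !=set0 &
      forall A B, analytic_set A -> analytic_set B -> Z = A `|` B ->
        Z = A \/ Z = B].

Definition irreducible_component G (Y Z : set (DQ G)) : Prop :=
  [/\ irreducible_analytic Z, Z `<=` Y &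
      forall Z', irreducible_analytic Z' -> Z `<=` Z' -> Z' `<=` Y -> Z' = Z].

(* f maps A to B with degree d: the fibres of A -> B over the complement of a
   proper analytic subset of B have d points. Used for B irreducible, where
   such a complement is dense. *)
Definition induces_map_of_degree G G' (f : DQ G -> DQ G')
    (A : set (DQ G)) (B : set (DQ G')) (d : nat) : Prop :=
  f @` A `<=` B /\
  exists N : set (DQ G'), [/\ analytic_set N, N `<=` B, N <> B &
    forall y, B y -> ~ N y -> (A `&` f @^-1` [set y] #= `I_d)%card].

End Domain.

Arguments Hdiv R G S : clear implicits.
Arguments natmap R : clear implicits.

(* Main.v *)
(* Roots of norm -2 are separated by their class modulo 2, and the Eichler
   transvections attached to the two hyperbolic planes bring every root to a
   normal form depending only on its class; so Gamma and Gamma^* are transitive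
   on each of the sets Delta_i. If r is orthogonal to the first hyperbolic plane,
   then H_r is, in the tube domain attached to this plane, a union of two convex
   sets exchanged by -1 on the plane, and the one-variable identity theorem along
   segments makes its image irreducible. A very general point of H_r lies on no
   H_s with s <> r, -r, and its stabiliser acts by a sign on the orthogonal of r,
   hence trivially on the discriminant group. Analyticity descends to the
   quotient by multiplying local equations over the finite stabiliser; the
   action is properly discontinuous because the positive definite majorants of
   the form attached to the points of D vary continuously.
   For the degrees, Gamma permutes the xi_i, and transpositions p_k represent
   Gamma^* \ Gamma. Away from the points x having a stabiliser that moves some
   xi_i, the fibre over x consists of the distinct classes of those x p_k that
   lie on the divisor. If r, s in Delta_3 of different classes both were
   orthogonal to such an x, then (r, s) = 0 and the reflection in r - s would
   stabilise x and exchange the two classes. *)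

From HB Require Import structures.
Require Import Defs.
From mathcomp Require Import all_boot all_order all_algebra.
From mathcomp Require Import complex.
From mathcomp Require Import all_classical all_reals all_analysis.
From mathcomp Require Import ring lra zify.
Import Defs.

Set Implicit Arguments.
Unset Strict Implicit.
Unset Printing Implicit Defensive.

Import Order.TTheory GRing.Theory Num.Theory.
Import numFieldNormedType.Exports.

Local Open Scope classical_set_scope.
Local Open Scope ring_scope.
Local Open Scope quotient_scope.

(** * One complex variable *)

(** Holomorphic means complex differentiable on an open set, with no regularity of the derivative,
    so the one-variable theory has to start from Goursat. The maximum principle is proved by second
    derivatives; it is therefore applied not to the given function but to a primitive of it divided
    by powers of the variable, and this replaces power series in the identity theorem. All geometry
    is carried out on the cone of homogeneous coordinates in $T\otimes\mathbb C$: analytic sets of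
    the quotients become sets cut out, near each point of the cone, by differentiable functions that
    are compared with the set on the cone only. A bare product over the stabiliser is not enough
    when there are several local equations; all elementary symmetric functions are used. A very
    general point is found on one explicit polynomial curve in $\mathcal H_r$: a linear condition
    that is not satisfied on the whole orthogonal of r excludes finitely many real parameters. The
    discriminant group is replaced by integral data: its classes are halves of vectors having even
    pairings, compared modulo 2T, and its bilinear form becomes the form of T modulo 4. *)

Section ComplexBasics.
Variable R : realType.
Notation C := (CC R).
Implicit Types (x y : R) (z w : C).

Definition cRe z : R := complex.Re z.
Definition cIm z : R := complex.Im z.
Definition rc x : C := real_complex R x.
Definition ii : C := Complex 0 1.
Definition cxy x y : C := rc x + ii * rc y.
(** The norm of [CC R] takes values in [CC R]; its real part lives in the ordered field [R], where
    estimates reduce to linear arithmetic. *)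
Definition nrm z : R := cRe `|z|.

Lemma cRe_is_additive : additive cRe. Proof. by case=> a b [c d]. Qed.
Lemma cIm_is_additive : additive cIm. Proof. by case=> a b [c d]. Qed.
HB.instance Definition _ := GRing.isAdditive.Build C R cRe cRe_is_additive.
HB.instance Definition _ := GRing.isAdditive.Build C R cIm cIm_is_additive.
HB.instance Definition _ := GRing.RMorphism.copy rc (real_complex R).

Lemma cReM z w : cRe (z * w) = cRe z * cRe w - cIm z * cIm w.
Proof. by case: z => a b; case: w => c d. Qed.
Lemma cImM z w : cIm (z * w) = cRe z * cIm w + cIm z * cRe w.
Proof. by case: z => a b; case: w => c d. Qed.
Lemma cRe_rc x : cRe (rc x) = x. Proof. by []. Qed.
Lemma cIm_rc x : cIm (rc x) = 0. Proof. by []. Qed.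
Lemma cRe_ii : cRe ii = 0. Proof. by []. Qed.
Lemma cIm_ii : cIm ii = 1. Proof. by []. Qed.
Lemma iiM : ii * ii = -1. Proof. exact: (sqr_i R). Qed.
Lemma cReN z : cRe (- z) = - cRe z. Proof. exact: raddfN. Qed.
Lemma cImN z : cIm (- z) = - cIm z. Proof. exact: raddfN. Qed.
Lemma cReD z w : cRe (z + w) = cRe z + cRe w. Proof. exact: raddfD. Qed.
Lemma cImD z w : cIm (z + w) = cIm z + cIm w. Proof. exact: raddfD. Qed.
Lemma cRe0 : cRe 0 = 0. Proof. by []. Qed.
Lemma cIm0 : cIm 0 = 0. Proof. by []. Qed.
Lemma cRe1 : cRe 1 = 1. Proof. by []. Qed.
Lemma cIm1 : cIm 1 = 0. Proof. by []. Qed.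

Definition cE := (cReM, cImM, cReD, cImD, cReN, cImN, cRe_rc, cIm_rc,
  cRe_ii, cIm_ii, cRe0, cIm0, cRe1, cIm1).

Lemma cP z w : cRe z = cRe w -> cIm z = cIm w -> z = w.
Proof. by case: z => a b; case: w => c d /= -> ->. Qed.

Lemma cxyE z : z = cxy (cRe z) (cIm z).
Proof. by apply: cP; rewrite /cxy !cE; ring. Qed.

Lemma cRe_cxy x y : cRe (cxy x y) = x. Proof. by rewrite /cxy !cE; ring. Qed.
Lemma cIm_cxy x y : cIm (cxy x y) = y. Proof. by rewrite /cxy !cE; ring. Qed.

Lemma normE z : `|z| = rc (nrm z). Proof. by rewrite /nrm normc_def. Qed.
Lemma nrm_sqrt z : nrm z = Num.sqrt (cRe z ^+ 2 + cIm z ^+ 2).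
Proof. by rewrite /nrm normc_def. Qed.
Lemma nrm_sq z : nrm z ^+ 2 = cRe z ^+ 2 + cIm z ^+ 2.
Proof. by rewrite nrm_sqrt sqr_sqrtr // addr_ge0 // sqr_ge0. Qed.
Lemma nrm_ge0 z : 0 <= nrm z.
Proof. by rewrite nrm_sqrt sqrtr_ge0. Qed.
Hint Resolve nrm_ge0 : core.
Lemma nrmM z w : nrm (z * w) = nrm z * nrm w.
Proof. by rewrite {1}/nrm normrM !normE -rmorphM. Qed.
Lemma nrm_triangle z w : nrm (z + w) <= nrm z + nrm w.
Proof. by have := ler_normD z w; rewrite !normE -rmorphD lecR. Qed.
Lemma nrmN z : nrm (- z) = nrm z. Proof. by rewrite /nrm normrN. Qed.
Lemma nrmB z w : nrm (z - w) = nrm (w - z). Proof. by rewrite /nrm distrC. Qed.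
Lemma nrm0 : nrm 0 = 0. Proof. by rewrite /nrm normr0. Qed.
Lemma nrm1 : nrm 1 = 1. Proof. by rewrite /nrm normr1. Qed.
Lemma nrm_ii : nrm ii = 1.
Proof. by rewrite nrm_sqrt !cE expr0n add0r expr1n sqrtr1. Qed.
Lemma nrmX z n : nrm (z ^+ n) = nrm z ^+ n.
Proof. by elim: n => [|n IH]; rewrite ?expr0 ?nrm1 // !exprS nrmM IH. Qed.
Lemma nrmV z : nrm z^-1 = (nrm z)^-1.
Proof. by rewrite {1}/nrm normfV normE -fmorphV. Qed.
Lemma nrm_rc x : nrm (rc x) = `|x|.
Proof. by rewrite nrm_sqrt !cE expr0n addr0 sqrtr_sqr. Qed.
Lemma nrm_eq0 z : (nrm z == 0) = (z == 0).
Proof.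
apply/eqP/eqP => [z0|->]; last exact: nrm0.
by apply/eqP; rewrite -normr_eq0 normE z0.
Qed.
Lemma nrm_gt0 z : (0 < nrm z) = (z != 0).
Proof. by rewrite lt_neqAle nrm_ge0 andbT eq_sym nrm_eq0. Qed.
Lemma Re_le_nrm z : `|cRe z| <= nrm z.
Proof. by rewrite -(sqrtr_sqr (cRe z)) nrm_sqrt ler_wsqrtr // lerDl sqr_ge0. Qed.
Lemma Im_le_nrm z : `|cIm z| <= nrm z.
Proof. by rewrite -(sqrtr_sqr (cIm z)) nrm_sqrt ler_wsqrtr // lerDr sqr_ge0. Qed.
Lemma nrm_le_ReIm z : nrm z <= `|cRe z| + `|cIm z|.
Proof.
rewrite {1}(cxyE z) /cxy (le_trans (nrm_triangle _ _)) //.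
by rewrite nrmM nrm_ii mul1r !nrm_rc.
Qed.

Lemma norm_lt_rc z x : (`|z| < rc x) = (nrm z < x).
Proof. by rewrite normE ltcR. Qed.
Lemma rc_gt0 (e : C) : 0 < e -> exists2 d : R, 0 < d & e = rc d.
Proof.
move=> e0; exists (nrm e); first by rewrite nrm_gt0 gt_eqF.
by rewrite -normE gtr0_norm.
Qed.

Lemma near_nrmP (z : C) (P : C -> Prop) :
  (\forall w \near z, P w) <-> exists2 d : R, 0 < d & forall w, nrm (w - z) < d -> P w.
Proof.
split.
  move=> /nbhs_ballP[e /= e0 H]; have [d d0 E] := rc_gt0 e0.
  exists d => // w wd; apply: H; rewrite -ball_normE /= E norm_lt_rc.
  by rewrite nrmB.
move=> [d d0 H]; apply/nbhs_ballP; exists (rc d) => /=; first by rewrite ltcR.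
by move=> w; rewrite -ball_normE /= norm_lt_rc nrmB => /H.
Qed.

Lemma continuous_nrmP (f : C -> C) z :
  {for z, continuous f} <->
  forall e, 0 < e -> exists2 d, 0 < d & forall w, nrm (w - z) < d -> nrm (f w - f z) < e.
Proof.
split=> [cf e e0|H].
  have e0' : (0 : C) < rc e by rewrite ltcR.
  have := @cvgr_distC_lt C C C (nbhs z) (nbhs_filter z) f (f z) cf (rc e) e0'.
  by move=> /near_nrmP[d d0 H]; exists d => // w /H; rewrite norm_lt_rc.
apply/(@cvgrPdistC_lt C C C (nbhs z) (nbhs_filter z)) => e e0; have [d d0 ->] := rc_gt0 e0.
have [r r0 Hr] := H _ d0; apply/near_nrmP; exists r => // w /Hr.
by rewrite norm_lt_rc.
Qed.

(** The difference quotient is multiplied out, so z itself need not be excluded, and both tolerances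
    are real numbers. *)
Definition cder (f : C -> C) z (l : C) := forall e, 0 < e ->
  exists2 d, 0 < d & forall w, nrm (w - z) < d ->
    nrm (f w - f z - l * (w - z)) <= e * nrm (w - z).

Lemma derivable_cder (f : C -> C) z : derivable f z 1 -> cder f z (derive1 f z).
Proof.
move=> /derivable_nbhsP/eqaddoP H e e0.
have /H : 0 < rc e by rewrite ltcR.
move=> /near_nrmP[d d0 Hd]; exists d => // w wd.
have := Hd (w - z); rewrite subr0 => /(_ wd) /=.
rewrite !normE /= !fctE /= -rmorphM lecR /shift /=.
rewrite -derive1E.
by rewrite /GRing.scale /= mulr1 subrK mulrC opprD addrA.
Qed.

Lemma cder_continuous f z l : cder f z l -> {for z, continuous f}.
Proof.
move=> H; apply/continuous_nrmP => e e0.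
have [d d0 Hd] := H 1 ltr01.
have l1 : 0 < 1 + nrm l + 1 by rewrite -addrA ltr_wpDr // addr_ge0.
exists (Num.min d (e / (1 + nrm l + 1))).
  by rewrite lt_min d0 /= divr_gt0.
move=> w; rewrite lt_min => /andP[/Hd wd]; rewrite ltr_pdivlMr // => we.
apply: le_lt_trans we.
have -> : f w - f z = (f w - f z - l * (w - z)) + l * (w - z) by rewrite subrK.
apply: le_trans (nrm_triangle _ _) _.
rewrite nrmM; have := nrm_ge0 (w - z); nra.
Qed.

End ComplexBasics.
Global Hint Resolve nrm_ge0 : core.
Arguments cRe : simpl never.
Arguments cIm : simpl never.
Arguments rc : simpl never.
Arguments ii : simpl never.
Arguments cxy : simpl never.
Arguments nrm : simpl never.

(** * Complex-valued functions of a real variable *)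

Section RealPath.
Variable R : realType.
Notation C := (CC R).

(** The two parts are differentiated separately, so that the mean value theorem and the fundamental
    theorem of calculus apply to each of them. *)
Definition rder (g : R -> C) (x : R) (l : C) :=
  is_derive x 1 (fun s => cRe (g s)) (cRe l) /\
  is_derive x 1 (fun s => cIm (g s)) (cIm l).

Lemma rderB g h x l m : rder g x l -> rder h x m ->
  rder (fun s => g s - h s) x (l - m).
Proof.
move=> [g1 g2] [h1 h2]; split; rewrite raddfB.
  have -> : (fun s => cRe (g s - h s)) = (fun s => cRe (g s)) - (fun s => cRe (h s)).
    by apply/funext => s; rewrite raddfB.
  exact: is_deriveB.
have -> : (fun s => cIm (g s - h s)) = (fun s => cIm (g s)) - (fun s => cIm (h s)).
  by apply/funext => s; rewrite raddfB.
exact: is_deriveB.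
Qed.

Lemma rderN g x l : rder g x l -> rder (fun s => - g s) x (- l).
Proof.
move=> [g1 g2]; split; rewrite raddfN.
  have -> : (fun s => cRe (- g s)) = - (fun s => cRe (g s)).
    by apply/funext => s; rewrite raddfN.
  exact: is_deriveN.
have -> : (fun s => cIm (- g s)) = - (fun s => cIm (g s)).
  by apply/funext => s; rewrite raddfN.
exact: is_deriveN.
Qed.

Lemma rderD g h x l m : rder g x l -> rder h x m ->
  rder (fun s => g s + h s) x (l + m).
Proof.
move=> gl /rderN hm; have := rderB gl hm.
by rewrite opprK; under eq_fun do rewrite opprK.
Qed.

Lemma rder_scale (k : C) (p : R -> R) (x l : R) : is_derive x 1 p l ->
  rder (fun s => k * rc (p s)) x (k * rc l).
Proof.
move=> H; split; rewrite !cE mulr0 ?subr0 ?add0r.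
  have -> : (fun s => cRe (k * rc (p s))) = (cRe k \*: p).
    by apply/funext => s; rewrite !cE mulr0 subr0.
  exact: is_deriveZ.
have -> : (fun s => cIm (k * rc (p s))) = (cIm k \*: p).
  by apply/funext => s; rewrite !cE mulr0 add0r.
exact: is_deriveZ.
Qed.

Lemma real_MVT_bound (p p' : R -> R) (a b M : R) : a <= b ->
  (forall x, a <= x <= b -> is_derive x 1 p (p' x) /\ `|p' x| <= M) ->
  `|p b - p a| <= M * (b - a).
Proof.
move=> ab H.
have [||c cab ->] := @MVT_segment R p p' a b ab.
- move=> x; rewrite in_itv /= => /andP[ax xb].
  by have [] := H x; rewrite ?(ltW ax) ?(ltW xb).
- apply: derivable_within_continuous => x; rewrite in_itv /= => /H[D _].
  exact: ex_derive.
by rewrite normrM (ger0_norm (_ : 0 <= b - a)) ?subr_ge0 // ler_wpM2r ?subr_ge0 //;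
   apply: (H c _).2; rewrite in_itv in cab.
Qed.

(** The mean value inequality for the real and the imaginary part; adding the two costs the factor
    2. The end points come in either order because primitives are compared on both sides of a
    point. *)
Lemma rder_bound (g g' : R -> C) (a b M : R) :
  (forall x, Num.min a b <= x <= Num.max a b ->
     rder g x (g' x) /\ nrm (g' x) <= M) ->
  nrm (g b - g a) <= 2 * M * `|b - a|.
Proof.
wlog ab : a b / a <= b => [Hw H|].
  have [/Hw|/ltW/Hw] := leP a b; first exact.
  by rewrite nrmB (distrC b); apply; rewrite minC maxC.
rewrite (min_idPl ab) (max_idPr ab) => H.
apply: le_trans (nrm_le_ReIm _) _; rewrite !raddfB /=.
have -> : 2 * M * `|b - a| = M * (b - a) + M * (b - a).
  by rewrite ger0_norm ?subr_ge0 //; ring.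
apply: lerD.
  apply: (@real_MVT_bound (fun x => cRe (g x)) (fun x => cRe (g' x)) a b M ab).
  move=> x /H[[D _] B]; by split=> //; exact: le_trans (Re_le_nrm _) B.
apply: (@real_MVT_bound (fun x => cIm (g x)) (fun x => cIm (g' x)) a b M ab).
move=> x /H[[_ D] B]; by split=> //; exact: le_trans (Im_le_nrm _) B.
Qed.

Lemma primitive_exists (g : R -> R) (a b : R) : a < b ->
  {in `[a, b], continuous g} ->
  exists P : R -> R, forall x : R, x \in `]a, b[ -> is_derive x 1 P (g x).
Proof.
move=> ab cg.
have gi : lebesgue_measure.-integrable [set` `[a, b]] (EFin \o g).
  apply: continuous_compact_integrable; first exact: segment_compact.
  apply: continuous_in_subspaceT => x; rewrite inE /= => xab.
  exact: cg.
exists (fun x => \int[lebesgue_measure]_(t in `[a, x]) g t) => x.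
rewrite in_itv /= => /andP[ax xb].
have cx : {for x, continuous g} by apply: cg; rewrite in_itv /= !ltW.
have [|D E] := continuous_FTC1 xb gi _ cx; first by rewrite ?bnd_simp ?ltW.
by apply: DeriveDef; [exact: D|rewrite -derive1E E].
Qed.

(** The chain rule along a real line of direction u. Both parts are handled at once, as instances of
    a real-linear functional bounded by the modulus. *)
Lemma cder_comp_line (f : C -> C) (z l : C) (u : C) (g : R -> C) (x : R) :
  cder f z l -> g x = z -> (forall s, g s = z + u * rc (s - x)) ->
  rder (fun s => f (g s)) x (l * u).
Proof.
move=> H gx gE.
have key (L : {additive C -> R}) : (forall w, `|L w| <= nrm w) ->
    (forall (t : R) w, L (w * rc t) = L w * t) ->
    is_derive x 1 (fun s => L (f (g s))) (L (l * u)).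
  move=> Lb Lr.
  have cv : (fun h : R => h^-1 *: (L (f (g (h *: 1 + x))) - L (f (g x)))) @ 0^'
      --> L (l * u).
    apply/cvgrPdistC_lt => e e0.
    have u0 : 0 < nrm u + 1 by rewrite ltr_wpDl ?nrm_ge0 ?ltr01.
    have [d d0 Hd] := H (e / 2 / (nrm u + 1)) (divr_gt0 (divr_gt0 e0 (ltr0Sn _ 1)) u0).
    near=> h.
    have h0 : h != 0 by near: h; exact: nbhs_dnbhs_neq.
    have hd : `|h| < d / (nrm u + 1).
      by near: h; apply: dnbhs0_lt; rewrite divr_gt0.
    rewrite gx gE /GRing.scale /= mulr1 addrK.
    have := Hd (z + u * rc h); rewrite [z + _]addrC addrK nrmM nrm_rc [_ + z]addrC.
    have ineq : nrm u * `|h| < d.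
      rewrite ltr_pdivlMr // in hd; apply: le_lt_trans hd.
      by rewrite mulrC ler_wpM2l // lerDl.
    move=> /(_ ineq) {}Hd.
    have h1 : 0 < `|h| by rewrite normr_gt0.
    rewrite -(ltr_pM2r h1) -normrM mulrBl mulrAC mulVf // mul1r -raddfB -Lr -raddfB.
    apply: le_lt_trans (Lb _) _; rewrite -mulrA; apply: le_lt_trans Hd _.
    rewrite mulrA ltr_pM2r // mulrAC ltr_pdivrMr // -!mulrA ltr_pM2l //.
    have := nrm_ge0 u; nra.
  apply: DeriveDef; first by apply/cvg_ex; exists (L (l * u)).
  exact: cvg_lim.
split.
  apply: (key (@cRe R)) => [w|t w]; [exact: Re_le_nrm|by rewrite /= !cE; ring].
apply: (key (@cIm R)) => [w|t w]; [exact: Im_le_nrm|by rewrite /= !cE; ring].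
Unshelve. all: by end_near.
Qed.

End RealPath.

(** * Goursat's theorem for rectangles *)

Section Goursat.
Variable R : realType.
Notation C := (CC R).

Lemma nested_intervals (a w : nat -> R) : (forall n, a n <= a n.+1) ->
  (forall n, a n.+1 + w n.+1 <= a n + w n) -> (forall n, 0 <= w n) ->
  exists x, forall n, a n <= x <= a n + w n.
Proof.
move=> ha hb hw.
have am m n : (m <= n)%N -> a m <= a n.
  by move=> /subnK <-; elim: (n - m)%N => // k IH; rewrite addSn (le_trans IH).
have bm m n : (m <= n)%N -> a n + w n <= a m + w m.
  move=> /subnK <-; elim: (n - m)%N => // k IH; rewrite addSn.
  exact: le_trans (hb _) IH.
have amn m n : a m <= a n + w n.
  case/orP: (leq_total m n) => mn; first by rewrite (le_trans (am _ _ mn)) // lerDl.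
  by rewrite (le_trans _ (bm _ _ mn)) // lerDl.
have hs : has_sup (range a).
  split; first by exists (a 0%N), 0%N.
  by exists (a 0%N + w 0%N) => _ [m _ <-].
exists (sup (range a)) => n; apply/andP; split.
  by apply: (ub_le_sup hs.2); exists n.
by apply: ge_sup hs.1 _ => _ [m _ <-].
Qed.

Variables (f df : C -> C) (rho : R).
Hypothesis rho0 : 0 < rho.
Hypothesis Hf : forall z, `|cRe z| <= rho -> `|cIm z| <= rho -> cder f z (df z).

Lemma rder_horizontal x y : `|x| <= rho -> `|y| <= rho ->
  rder (fun s => f (cxy s y)) x (df (cxy x y)).
Proof.
move=> hx hy; rewrite -[df _]mulr1.
apply: (@cder_comp_line R f (cxy x y)) => [| |s].
- by apply: Hf; rewrite ?cRe_cxy ?cIm_cxy.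
- by [].
- by rewrite /cxy mul1r raddfB /=; ring.
Qed.

Lemma rder_vertical x y : `|x| <= rho -> `|y| <= rho ->
  rder (fun s => f (cxy x s)) y (df (cxy x y) * ii R).
Proof.
move=> hx hy; apply: (@cder_comp_line R f (cxy x y)) => [| |s].
- by apply: Hf; rewrite ?cRe_cxy ?cIm_cxy.
- by [].
- by rewrite /cxy raddfB /=; ring.
Qed.

Lemma rder_continuous (g : R -> C) x l : rder g x l ->
  {for x, continuous (fun s => cRe (g s))} /\ {for x, continuous (fun s => cIm (g s))}.
Proof.
by move=> [[D1 _] [D2 _]]; split; apply: differentiable_continuous; apply/derivable1_diffP.
Qed.

Lemma complex_primitive (g : R -> C) :
  (forall x, `|x| <= rho -> exists l, rder g x l) ->
  exists P : R -> C, forall x, `|x| < rho -> rder P x (g x).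
Proof.
move=> H.
have rr : - rho < rho by rewrite gtrN.
have [|P1 HP1] := @primitive_exists R (fun s => cRe (g s)) _ _ rr.
  by move=> x; rewrite in_itv /= -ler_norml => /H[l /rder_continuous[]].
have [|P2 HP2] := @primitive_exists R (fun s => cIm (g s)) _ _ rr.
  by move=> x; rewrite in_itv /= -ler_norml => /H[l /rder_continuous[]].
exists (fun s => cxy (P1 s) (P2 s)) => x hx; split.
  under eq_fun do rewrite cRe_cxy.
  by apply: HP1; rewrite in_itv /= -ltr_norml.
under eq_fun do rewrite cIm_cxy.
by apply: HP2; rewrite in_itv /= -ltr_norml.
Qed.

Lemma primitivesA : exists A : R -> R -> C, forall y x, `|y| <= rho -> `|x| < rho ->
  rder (A y) x (f (cxy x y)).
Proof.
have H y : exists P : R -> C, `|y| <= rho -> forall x, `|x| < rho -> rder P x (f (cxy x y)).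
  have [hy|] := boolP (`|y| <= rho); last by exists (fun _ => 0).
  have [x hx|P HP] := @complex_primitive (fun x => f (cxy x y)).
    by exists (df (cxy x y)); exact: rder_horizontal.
  by exists P.
by have [A HA] := choice H; exists A => y x hy hx; exact: HA.
Qed.

Lemma primitivesB : exists B : R -> R -> C, forall x y, `|x| <= rho -> `|y| < rho ->
  rder (B x) y (f (cxy x y)).
Proof.
have H x : exists P : R -> C, `|x| <= rho -> forall y, `|y| < rho -> rder P y (f (cxy x y)).
  have [hx|] := boolP (`|x| <= rho); last by exists (fun _ => 0).
  have [y hy|P HP] := @complex_primitive (fun y => f (cxy x y)).
    by exists (df (cxy x y) * ii R); exact: rder_vertical.
  by exists P.
by have [B HB] := choice H; exists B => x y hx hy; exact: HB.
Qed.

Variables A B : R -> R -> C.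
Hypothesis HA : forall y x, `|y| <= rho -> `|x| < rho -> rder (A y) x (f (cxy x y)).
Hypothesis HB : forall x y, `|x| <= rho -> `|y| < rho -> rder (B x) y (f (cxy x y)).

(** The integral of f over the boundary of the rectangle with sides [a, b] and [c, d],
    counterclockwise. The integrals over the sides are increments of the primitives [A y] on
    horizontal and [B x] on vertical lines, so additivity under subdivision is a ring identity. *)
Definition contour (a b c d : R) : C :=
  (A c b - A c a) - (A d b - A d a) + ii R * ((B b d - B b c) - (B a d - B a c)).

(* the primitive of w |-> f0 + f1 * (w - z0) along a line of direction u *)
Let affine_primitive (f0 f1 k : C) (x0 : R) (u : C) (s : R) : C :=
  (f0 + f1 * k) * rc s + f1 * u * rc ((s - x0) ^+ 2 / 2).

Lemma rder_affine f0 f1 k x0 u s :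
  rder (affine_primitive f0 f1 k x0 u) s (f0 + f1 * (k + u * rc (s - x0))).
Proof.
have -> : f0 + f1 * (k + u * rc (s - x0)) =
  (f0 + f1 * k) * rc 1 + f1 * u * rc (s - x0).
  by rewrite rmorph1; ring.
apply: rderD; first by apply: rder_scale; exact: is_derive_id.
apply: rder_scale.
have -> : (fun s : R => (s - x0) ^+ 2 / 2) = (2^-1 : R) \*: ((id - cst x0) ^+ 2 : R -> R).
  by apply/funext => t /=; rewrite /GRing.scale /= fctE mulrC.
apply: is_derive_eq.
by rewrite /GRing.scale /= !fctE /= subr0 /GRing.scale /=; field.
Qed.

(** An affine function has contour 0, so only the remainder of the first order expansion at z0
    counts. It is at most e S on the rectangle, S being half the perimeter; the sides have total
    length 2 S and [rder_bound] contributes a factor 2, whence the constant 4. *)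
Lemma contour_affine a b c d (z0 : C) (e delta : R) (f1 : C) :
  `|a| < rho -> `|b| < rho -> `|c| < rho -> `|d| < rho ->
  a <= cRe z0 <= b -> c <= cIm z0 <= d ->
  (b - a) + (d - c) < delta -> 0 <= e ->
  (forall w, nrm (w - z0) < delta -> nrm (f w - f z0 - f1 * (w - z0)) <= e * nrm (w - z0)) ->
  nrm (contour a b c d) <= 4 * e * ((b - a) + (d - c)) ^+ 2.
Proof.
move=> ha hb hc hd; set x0 := cRe z0; set y0 := cIm z0.
move=> /andP[ax xb] /andP[cy yd] hdel e0 Hw.
set S := (b - a) + (d - c).
have ab : a <= b by exact: le_trans xb.
have cd : c <= d by exact: le_trans yd.
have z0E : z0 = cxy x0 y0 by rewrite -cxyE.
have near_ x y : a <= x <= b -> c <= y <= d ->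
   nrm (f (cxy x y) - (f z0 + f1 * (cxy x y - z0))) <= e * S.
  move=> /andP[h1 h2] /andP[h3 h4].
  have wS : nrm (cxy x y - z0) <= S.
    apply: le_trans (nrm_le_ReIm _) _; rewrite !raddfB /= cRe_cxy cIm_cxy.
    by apply: lerD; rewrite ler_norml -/x0 -/y0; apply/andP; split; lra.
  rewrite opprD addrA; apply: le_trans (Hw _ _) _; first exact: le_lt_trans hdel.
  by rewrite ler_wpM2l.
have bnd x : a <= x <= b -> `|x| < rho.
  by move: ha hb; rewrite !ltr_norml => /andP[? ?] /andP[? ?] /andP[? ?]; apply/andP; split; lra.
have bndy x : c <= x <= d -> `|x| < rho.
  by move: hc hd; rewrite !ltr_norml => /andP[? ?] /andP[? ?] /andP[? ?]; apply/andP; split; lra.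
pose PA y := affine_primitive (f z0) f1 (ii R * rc (y - y0)) x0 1.
pose PB x := affine_primitive (f z0) f1 (rc (x - x0)) y0 (ii R).
have EA y : c <= y <= d ->
    nrm ((A y b - PA y b) - (A y a - PA y a)) <= 2 * (e * S) * (b - a).
  move=> hy; rewrite -[X in _ * X]ger0_norm ?subr_ge0 //.
  apply: (@rder_bound R (fun s => A y s - PA y s)
     (fun s => f (cxy s y) - (f z0 + f1 * (ii R * rc (y - y0) + 1 * rc (s - x0))))).
  rewrite (min_idPl ab) (max_idPr ab) => s hs; split.
    by apply: rderB (rder_affine _ _ _ _ _ _); apply: HA; [exact/ltW/bndy|exact: bnd].
  suff -> : ii R * rc (y - y0) + 1 * rc (s - x0) = cxy s y - z0 by exact: near_.
  by rewrite z0E /cxy !raddfB /=; ring.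
have EB x : a <= x <= b ->
    nrm ((B x d - PB x d) - (B x c - PB x c)) <= 2 * (e * S) * (d - c).
  move=> hx; rewrite -[X in _ * X]ger0_norm ?subr_ge0 //.
  apply: (@rder_bound R (fun s => B x s - PB x s)
     (fun s => f (cxy x s) - (f z0 + f1 * (rc (x - x0) + ii R * rc (s - y0))))).
  rewrite (min_idPl cd) (max_idPr cd) => s hs; split.
    by apply: rderB (rder_affine _ _ _ _ _ _); apply: HB; [exact/ltW/bnd|exact: bndy].
  suff -> : rc (x - x0) + ii R * rc (s - y0) = cxy x s - z0 by exact: near_.
  by rewrite z0E /cxy !raddfB /=; ring.
have E : contour a b c d =
    ((A c b - PA c b) - (A c a - PA c a)) - ((A d b - PA d b) - (A d a - PA d a))
    + ii R * (((B b d - PB b d) - (B b c - PB b c)) - ((B a d - PB a d) - (B a c - PB a c))).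
  rewrite /contour /PA /PB /affine_primitive.
  (* The affine part cancels: what remains is height times width, computed in two ways. *)
  suff : f1 * ii R * (rc (y0 - c) + rc (d - y0)) * (rc b - rc a) =
    f1 * ii R * (rc (x0 - a) + rc (b - x0)) * (rc d - rc c).
    by rewrite !raddfB /=; move=> ?; ring.
  by rewrite !raddfB /=; ring.
rewrite E.
have H1 := EA c; have H2 := EA d; have H3 := EB a; have H4 := EB b.
rewrite !lexx ?ab ?cd /= in H1 H2 H3 H4.
move: (H1 isT) (H2 isT) (H3 isT) (H4 isT) => {}H1 {}H2 {}H3 {}H4.
apply: le_trans (nrm_triangle _ _) _; rewrite nrmM nrm_ii mul1r.
apply: le_trans (lerD (nrm_triangle _ _) (nrm_triangle _ _)) _; rewrite !nrmN.
apply: le_trans (lerD (lerD H1 H2) (lerD H4 H3)) _.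
by rewrite /S le_eqVlt; apply/orP; left; apply/eqP; ring.
Qed.

Lemma contour_split a b c d x y :
  contour a b c d = contour a x c y + contour x b c y + (contour a x y d + contour x b y d).
Proof. by rewrite /contour; ring. Qed.

(** By the triangle inequality one of the four pieces carries at least a quarter of the contour; p
    selects the right half and q the upper half. *)
Lemma contour_quarter a b c d x y : exists p q : bool,
  nrm (contour a b c d) <= 4 * nrm (contour (if p then x else a) (if p then b else x)
     (if q then y else c) (if q then d else y)).
Proof.
apply: contrapT => H.
have {}H p q : 4 * nrm (contour (if p then x else a) (if p then b else x)
     (if q then y else c) (if q then d else y)) < nrm (contour a b c d).
  by rewrite ltNge; apply/negP => h; apply: H; exists p, q.
have := H true true; have := H true false; have := H false true; have := H false false.
rewrite /= => h1 h2 h3 h4.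
have := contour_split a b c d x y => /(congr1 (@nrm R)) E.
have : nrm (contour a b c d) <= nrm (contour a x c y) + nrm (contour x b c y)
  + (nrm (contour a x y d) + nrm (contour x b y d)).
  rewrite E; apply: le_trans (nrm_triangle _ _) _.
  by apply: lerD; exact: nrm_triangle.
by lra.
Qed.

(** Repeated bisection: after n steps the contour has lost at most the factor 4^n, while the square
    of the half perimeter has lost exactly 4^n. The estimate of [contour_affine] at the common point
    of the rectangles thus bounds the original contour by a fixed multiple of an arbitrary e. *)
Lemma goursat_ordered a b c d : a <= b -> c <= d ->
  `|a| < rho -> `|b| < rho -> `|c| < rho -> `|d| < rho -> contour a b c d = 0.
Proof.
move=> ab cd ha hb hc hd.
pose w (n : nat) : R := (b - a) / 2 ^+ n; pose h (n : nat) : R := (d - c) / 2 ^+ n.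
have wS n : w n.+1 + w n.+1 = w n by rewrite /w exprS; field.
have hS n : h n.+1 + h n.+1 = h n by rewrite /h exprS; field.
have w0 n : 0 <= w n by rewrite divr_ge0 ?subr_ge0 ?exprn_ge0.
have h0 n : 0 <= h n by rewrite divr_ge0 ?subr_ge0 ?exprn_ge0.
pose P (n : nat) (p : R * R) := contour p.1 (p.1 + w n) p.2 (p.2 + h n).
(* The stage is paired with the lower left corner so that one choice function drives the recursion;
   the side lengths depend on the stage alone. *)
have step (np : nat * (R * R)) : exists p : R * R,
   [/\ np.2.1 <= p.1, p.1 + w np.1.+1 <= np.2.1 + w np.1,
       np.2.2 <= p.2, p.2 + h np.1.+1 <= np.2.2 + h np.1
     & nrm (P np.1 np.2) <= 4 * nrm (P np.1.+1 p)].
  case: np => n [u v] /=.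
  have [p [q H]] := contour_quarter u (u + w n) v (v + h n) (u + w n.+1) (v + h n.+1).
  exists ((if p then u + w n.+1 else u), (if q then v + h n.+1 else v)).
  have := w0 n.+1; have := h0 n.+1; have := wS n; have := hS n => e1 e2 g1 g2.
  split=> /=.
  - by case: (p); lra.
  - by case: (p); lra.
  - by case: (q); lra.
  - by case: (q); lra.
  rewrite /P /=; apply: le_trans H _.
  by case: (p); case: (q); rewrite -?addrA ?e1 ?e2.
have [g Hg] := choice step.
pose s := fix s n := if n is m.+1 then g (m, s m) else (a, c).
have sS n : s n.+1 = g (n, s n) by [].
have [x0 Hx] : exists x, forall n, (s n).1 <= x <= (s n).1 + w n.
  by apply: nested_intervals => // n; rewrite sS; have [] := Hg (n, s n).
have [y0 Hy] : exists x, forall n, (s n).2 <= x <= (s n).2 + h n.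
  by apply: nested_intervals => // n; rewrite sS; have [] := Hg (n, s n).
have big n : nrm (contour a b c d) <= 4 ^+ n * nrm (P n (s n)).
  elim: n => [|n IH].
    by rewrite expr0 mul1r /P /w /h /= expr0 !divr1 ![_ + (_ - _)]addrC !subrK.
  apply: le_trans IH _; rewrite exprSr -mulrA ler_wpM2l ?exprn_ge0 // sS.
  by have [] := Hg (n, s n).
have sa n : a <= (s n).1 /\ (s n).1 + w n <= b.
  elim: n => [|n [IH1 IH2]]; first by rewrite /= /w expr0 divr1; split; lra.
  rewrite sS; have [/= u1 u2 _ _ _] := Hg (n, s n).
  by split; [exact: le_trans u1|exact: le_trans IH2].
have sc n : c <= (s n).2 /\ (s n).2 + h n <= d.
  elim: n => [|n [IH1 IH2]]; first by rewrite /= /h expr0 divr1; split; lra.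
  rewrite sS; have [/= _ _ u1 u2 _] := Hg (n, s n).
  by split; [exact: le_trans u1|exact: le_trans IH2].
pose z0 := cxy x0 y0.
have x0r : `|x0| <= rho.
  have := Hx 0%N; rewrite /= /w expr0 divr1; move: ha hb.
  rewrite !ltr_norml ler_norml => /andP[? ?] /andP[? ?] /andP[? ?]; apply/andP; split; lra.
have y0r : `|y0| <= rho.
  have := Hy 0%N; rewrite /= /h expr0 divr1; move: hc hd.
  rewrite !ltr_norml ler_norml => /andP[? ?] /andP[? ?] /andP[? ?]; apply/andP; split; lra.
have Hz : cder f z0 (df z0) by apply: Hf; rewrite ?cRe_cxy ?cIm_cxy.
pose S := (b - a) + (d - c).
have S0 : 0 <= S by rewrite addr_ge0 // subr_ge0.
suff small e : 0 < e -> nrm (contour a b c d) <= 4 * e * S ^+ 2.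
  apply/eqP; rewrite -nrm_eq0 eq_le nrm_ge0 andbT; apply/ler_addgt0Pr => e e0.
  have k0 : 0 < 4 * S ^+ 2 + 1 by rewrite ltr_wpDl // mulr_ge0 // sqr_ge0.
  apply: le_trans (small (e / (4 * S ^+ 2 + 1)) _) _; first by rewrite divr_gt0.
  rewrite add0r mulrAC (mulrC _ (e / _)) -mulrA ger_pMr // mulrC ler_pdivrMr //.
  by rewrite mul1r lerDl.
move=> e0; have [dl dl0 Hd] := Hz e e0.
have [n Hn] : exists n, S / 2 ^+ n < dl.
  have q0 : 0 <= S / dl by rewrite divr_ge0 // ltW.
  exists (Num.bound (S / dl)); have := archi_boundP q0; set n := Num.bound _.
  move=> hn; rewrite ltr_pdivrMr ?exprn_gt0 // mulrC -ltr_pdivrMr //.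
  by apply: lt_trans hn _; rewrite -natrX ltr_nat ltn_expl.
have := big n; have [a1 a2] := sa n; have [c1 c2] := sc n.
move: (Hx n) (Hy n) => hx hy bn; apply: le_trans bn _.
have := @contour_affine (s n).1 ((s n).1 + w n) (s n).2 ((s n).2 + h n) z0 e dl (df z0).
rewrite cRe_cxy cIm_cxy.
have wh : (s n).1 + w n - (s n).1 + ((s n).2 + h n - (s n).2) = S / 2 ^+ n.
  by rewrite /w /h /S; ring.
rewrite wh => /(_ _ _ _ _ hx hy Hn (ltW e0) Hd) H.
have {}H : nrm (P n (s n)) <= 4 * e * (S / 2 ^+ n) ^+ 2.
  have := w0 n; have := h0 n; move: ha hb hc hd; rewrite !ltr_norml.
  move=> /andP[? ?] /andP[? ?] /andP[? ?] /andP[? ?] ? ?.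
  by apply: H; rewrite ltr_norml; apply/andP; split; lra.
have p0 : (0 : R) <= 4 ^+ n by rewrite exprn_ge0.
apply: le_trans (ler_wpM2l p0 H) _.
have -> : 4 ^+ n = 2 ^+ n * 2 ^+ n :> R by rewrite -exprMn -natrM.
rewrite le_eqVlt; apply/orP; left; apply/eqP; field.
by rewrite expf_neq0.
Qed.

End Goursat.

(** * Maxima on a square and the second derivative test *)

Section Continuity.
Variable R : realType.
Notation C := (CC R).

Lemma cRe_continuous : continuous (@cRe R : C -> R).
Proof.
move=> z; apply/(@cvgrPdistC_lt R R C (nbhs z) (nbhs_filter z)) => e e0; apply/near_nrmP; exists e => // w we.
by rewrite -raddfB; apply: le_lt_trans (Re_le_nrm _) we.
Qed.

Lemma nrm_continuous : continuous (@nrm R : C -> R).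
Proof.
move=> z; apply/(@cvgrPdistC_lt R R C (nbhs z) (nbhs_filter z)) => e e0; apply/near_nrmP; exists e => // w we.
apply: le_lt_trans we; rewrite ler_norml; apply/andP; split.
  by have := nrm_triangle (z - w) w; rewrite subrK nrmB; lra.
by have := nrm_triangle (w - z) z; rewrite subrK; lra.
Qed.

Lemma cxy_continuous : continuous (fun p : R * R => cxy p.1 p.2 : C).
Proof.
move=> p; apply/(@cvgrPdistC_lt C C (R * R)%type (nbhs p) (nbhs_filter p)) => e /rc_gt0[d d0 ->].
have d2 : 0 < d / 2 by rewrite divr_gt0.
near=> q; rewrite norm_lt_rc; apply: le_lt_trans (nrm_le_ReIm _) _.
rewrite !raddfB /= !cRe_cxy !cIm_cxy.
have h1 : `|q.1 - p.1| < d / 2.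
  near: q; have /cvgrPdistC_lt/(_ _ d2) : q.1 @[q --> p] --> p.1 by exact: cvg_fst.
  exact.
have h2 : `|q.2 - p.2| < d / 2.
  near: q; have /cvgrPdistC_lt/(_ _ d2) : q.2 @[q --> p] --> p.2 by exact: cvg_snd.
  exact.
by rewrite [ltRHS](splitr d) ltrD.
Unshelve. all: by end_near.
Qed.

Lemma cder_continuous2 (f : C -> C) (p : R * R) (l : C) : cder f (cxy p.1 p.2) l ->
  {for p, continuous (fun q : R * R => f (cxy q.1 q.2))}.
Proof.
move=> /cder_continuous H.
apply: (@continuous_comp _ _ _ (fun q : R * R => cxy q.1 q.2) f); last exact: H.
exact: cxy_continuous.
Qed.

Lemma square_compact (r : R) : compact (`[-r, r] `*` `[-r, r] : set (R * R)).
Proof. by apply: compact_setX; exact: segment_compact. Qed.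

Lemma square_EVT (u : R * R -> R) (r : R) : 0 <= r ->
  (forall p, `|p.1| <= r -> `|p.2| <= r -> {for p, continuous u}) ->
  exists p, [/\ `|p.1| <= r, `|p.2| <= r &
    forall q, `|q.1| <= r -> `|q.2| <= r -> u q <= u p].
Proof.
move=> r0 H.
have [||p + Hp] := @compact_EVT_max _ R u _ _ (@square_compact r).
- by exists (0, 0); split; rewrite /= in_itv /= oppr_cp0 r0.
- apply: continuous_in_subspaceT => p; rewrite inE => -[/=].
  by rewrite !in_itv /= -!ler_norml => ? ?; exact: H.
rewrite inE => -[/=]; rewrite !in_itv /= -!ler_norml => p1 p2.
exists p; split=> // q q1 q2; apply: Hp; rewrite inE; split => /=;
  by rewrite in_itv /= -ler_norml.
Qed.

(** At the maximum u' vanishes; if l were positive, u' would be positive just to the right of x, and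
    the mean value theorem would make u exceed its maximum there. *)
Lemma second_derivative_max (u u' : R -> R) (x l d : R) : 0 < d ->
  (forall s, `|s - x| < d -> is_derive s 1 u (u' s)) -> is_derive x 1 u' l ->
  (forall s, `|s - x| < d -> u s <= u x) -> l <= 0.
Proof.
move=> d0 Du Du' Hm.
have ini t : t \in `]x - d, x + d[ -> `|t - x| < d.
  by rewrite in_itv /= ltr_norml => /andP[? ?]; apply/andP; split; lra.
have D0 : is_derive x 1 u 0.
  apply: (@derive1_at_max _ _ (x - d) (x + d)).
  - lra.
  - by move=> t /ini/Du D; exact: ex_derive.
  - by rewrite in_itv /=; apply/andP; split; lra.
  - by move=> t /ini; exact: Hm.
have u'x : u' x = 0.
  have Dx : is_derive x 1 u (u' x) by apply: Du; rewrite subrr normr0.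
  by rewrite -(@derive_val _ _ _ _ _ _ _ Dx) (@derive_val _ _ _ _ _ _ _ D0).
rewrite leNgt; apply/negP => l0.
have [c c0 Hc] : exists2 c, 0 < c & forall s, 0 < s < c -> 0 < u' (x + s).
  have [dv vl] := Du'.
  have /cvgrPdistC_lt/(_ _ l0) :
      (fun h : R => h^-1 *: (u' (h *: 1 + x) - u' x)) @ 0^' --> l by rewrite -vl; exact: dv.
  move=> [c /= c0 Hc]; exists c => // s /andP[s0 sc].
  have := Hc s; rewrite /ball_ /= sub0r normrN gtr0_norm // => /(_ sc).
  rewrite gt_eqF // => /(_ isT); rewrite u'x subr0 /GRing.scale /= mulr1 (addrC s).
  rewrite ltr_norml => /andP[+ _]; rewrite ltrBrDl subrr.
  by rewrite pmulr_rgt0 // invr_gt0.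
pose s := Num.min c d / 2.
have s0 : 0 < s by rewrite divr_gt0 // lt_min c0.
have sc : s < c /\ s < d.
  have h1 : Num.min c d <= c by rewrite ge_min lexx.
  have h2 : Num.min c d <= d by rewrite ge_min lexx orbT.
  by rewrite /s; split; lra.
have [|||z] := @MVT R u u' x (x + s).
- by rewrite ltrDl.
- move=> t; rewrite in_itv /= => /andP[? ?]; apply: Du.
  by rewrite ltr_norml; apply/andP; split; lra.
- apply: derivable_within_continuous => t; rewrite in_itv /= => /andP[? ?].
  have D : is_derive t 1 u (u' t) by apply: Du; rewrite ltr_norml; apply/andP; split; lra.
  exact: ex_derive.
rewrite in_itv /= => /andP[xz zs] E.
have : u (x + s) <= u x by apply: Hm; rewrite addrAC subrr add0r gtr0_norm //; lra.
have := Hc (z - x); rewrite subrKC => H.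
have {}H : 0 < u' z by apply: H; apply/andP; split; lra.
have : 0 < u' z * (x + s - x) by rewrite mulr_gt0 //; lra.
by rewrite -E; lra.
Qed.

End Continuity.

(** * The maximum principle for a function with two complex derivatives *)

Section MaxPrinciple.
Variable R : realType.
Notation C := (CC R).
Variables (G G1 G2 : C -> C) (rho r : R).
Hypothesis r0 : 0 < r.
Hypothesis rrho : r < rho.
Hypothesis HG : forall z, `|cRe z| < rho -> `|cIm z| < rho -> cder G z (G1 z).
Hypothesis HG1 : forall z, `|cRe z| < rho -> `|cIm z| < rho -> cder G1 z (G2 z).

Lemma ball_lt (x d s : R) : `|x| < d -> `|s - x| < d - `|x| -> `|s| < d.
Proof.
move=> xd sx; rewrite -(subrK x s); apply: le_lt_trans (ler_normD _ _) _; lra.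
Qed.

(** Adding e times the square of the modulus to the harmonic function [cRe (k * G z)] makes its
    Laplacian 4 e, hence positive, which forbids an interior maximum: differentiating twice in the
    direction i turns [G2] into its opposite, so the two second derivative tests contradict each
    other. The term 2 r^2 bounds the square of the modulus on the square. *)
Lemma real_part_max (k : C) (M : R) :
  (forall z, `|cRe z| <= r -> `|cIm z| <= r -> `|cRe z| = r \/ `|cIm z| = r ->
     cRe (k * G z) <= M) ->
  forall z, `|cRe z| <= r -> `|cIm z| <= r -> cRe (k * G z) <= M.
Proof.
move=> HM z zr zi.
suff small e : 0 < e -> cRe (k * G z) <= M + e * (2 * r ^+ 2).
  apply/ler_addgt0Pr => e e0.
  have r2 : 0 < 2 * r ^+ 2 by rewrite mulr_gt0 // exprn_gt0.
  by have := small (e / (2 * r ^+ 2)); rewrite divfK ?gt_eqF // divr_gt0 // => /(_ isT).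
move=> e0.
pose u (p : R * R) := cRe (k * G (cxy p.1 p.2)) + e * (p.1 ^+ 2 + p.2 ^+ 2).
have [||p [p1 p2 Hp]] := @square_EVT R u r; first exact: ltW.
  move=> p p1 p2; apply: continuousD.
    apply: (@continuous_comp _ _ _ (fun q : R * R => k * G (cxy q.1 q.2)) (@cRe R)).
      apply: (@continuousM C _ (fun=> k)); first exact: cvg_cst.
      apply: cder_continuous2; apply: HG; rewrite ?cRe_cxy ?cIm_cxy; exact: le_lt_trans rrho.
    exact: cRe_continuous.
  apply: (@continuousM R _ (fun=> e)); first exact: cvg_cst.
  apply: (@continuousD _ R _ (fun p : R * R => p.1 ^+ 2) (fun p : R * R => p.2 ^+ 2)).
    by rewrite /GRing.exp /=; apply: (@continuousM R _ fst fst); exact: cvg_fst.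
  by rewrite /GRing.exp /=; apply: (@continuousM R _ snd snd); exact: cvg_snd.
have sq (x : R) : `|x| <= r -> x ^+ 2 <= r ^+ 2.
  by move=> h; rewrite -(real_normK (num_real x)) lerXn2r // ?nnegrE // ltW.
have /(le_trans _) : u p <= M + e * (2 * r ^+ 2).
  have [/eqP e1|n1] := boolP (`|p.1| == r).
    apply: lerD; first by apply: HM; rewrite ?cRe_cxy ?cIm_cxy //; left.
    by rewrite ler_wpM2l ?(ltW e0) //; have := sq _ p1; have := sq _ p2; lra.
  have [/eqP e2|n2] := boolP (`|p.2| == r).
    apply: lerD; first by apply: HM; rewrite ?cRe_cxy ?cIm_cxy //; right.
    by rewrite ler_wpM2l ?(ltW e0) //; have := sq _ p1; have := sq _ p2; lra.
  have {n1 p1} p1 : `|p.1| < r by rewrite lt_neqAle n1.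
  have {n2 p2} p2 : `|p.2| < r by rewrite lt_neqAle n2.
  exfalso; pose z0 := cxy p.1 p.2.
  have p1' : `|p.1| < rho by exact: lt_trans rrho.
  have p2' : `|p.2| < rho by exact: lt_trans rrho.
  have Dq (x y : R) : is_derive x 1 (fun s => e * (s ^+ 2 + y ^+ 2)) (2 * e * x).
    have -> : (fun s : R => e * (s ^+ 2 + y ^+ 2)) = (e \*: (id ^+ 2 + cst (y ^+ 2)) : R -> R).
      by apply/funext.
    by apply: is_derive_eq; rewrite /GRing.scale /=; ring.
  have Dl (x : R) : is_derive x 1 (fun s : R => 2 * e * s) (2 * e).
    have -> : (fun s : R => 2 * e * s) = ((2 * e) \*: id : R -> R) by apply/funext.
    by apply: is_derive_eq; rewrite /GRing.scale /=; ring.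
  have scaleRe (g : R -> C) (x : R) (l : C) : rder g x l ->
      is_derive x 1 (fun s => cRe (k * g s)) (cRe (k * l)).
    move=> [D1 D2]; rewrite cReM.
    have -> : (fun s => cRe (k * g s)) =
      (cRe k \*: (fun s => cRe (g s)) - cIm k \*: (fun s => cIm (g s)) : R -> R).
      by apply/funext => s; rewrite cReM.
    exact: is_deriveB.
  have h1 : cRe (k * G2 z0) + 2 * e <= 0.
    apply: (@second_derivative_max R (fun s => u (s, p.2))
       (fun s => cRe (k * G1 (cxy s p.2)) + 2 * e * s) p.1 _ (r - `|p.1|)).
    - by rewrite subr_gt0.
    - move=> s hs; have {}hs := ball_lt p1 hs.
      have D : rder (fun t => G (cxy t p.2)) s (G1 (cxy s p.2) * 1).
        apply: (@cder_comp_line R G (cxy s p.2)) => [| |t] //.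
          by apply: HG; rewrite ?cRe_cxy ?cIm_cxy // (lt_trans hs).
        by rewrite /cxy mul1r raddfB /=; ring.
      by move: D; rewrite mulr1 => /scaleRe D; exact: is_deriveD D (Dq s p.2).
    - have D : rder (fun t => G1 (cxy t p.2)) p.1 (G2 z0 * 1).
        apply: (@cder_comp_line R G1 z0) => [| |t] //.
          by apply: HG1; rewrite ?cRe_cxy ?cIm_cxy.
        by rewrite /z0 /cxy mul1r raddfB /=; ring.
      by move: D; rewrite mulr1 => /scaleRe D; exact: is_deriveD D (Dl p.1).
    - move=> s hs; have {}hs := ball_lt p1 hs.
      rewrite (_ : (p.1, p.2) = p); last by case: (p).
      by apply: Hp => //; exact: ltW.
  have h2 : cRe (k * (G2 z0 * ii R * ii R)) + 2 * e <= 0.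
    apply: (@second_derivative_max R (fun s => u (p.1, s))
       (fun s => cRe (k * (G1 (cxy p.1 s) * ii R)) + 2 * e * s) p.2 _ (r - `|p.2|)).
    - by rewrite subr_gt0.
    - move=> s hs; have {}hs := ball_lt p2 hs.
      have D : rder (fun t => G (cxy p.1 t)) s (G1 (cxy p.1 s) * ii R).
        apply: (@cder_comp_line R G (cxy p.1 s)) => [| |t] //.
          by apply: HG; rewrite ?cRe_cxy ?cIm_cxy // (lt_trans hs).
        by rewrite /cxy raddfB /=; ring.
      move: D => /scaleRe D.
      under eq_fun do rewrite /u /= [p.1 ^+ 2 + _]addrC.
      exact: is_deriveD D (Dq s p.1).
    - have D : rder (fun t => G1 (cxy p.1 t) * ii R) p.2 (G2 z0 * ii R * ii R).
        have [D1 D2] : rder (fun s => G1 (cxy p.1 s)) p.2 (G2 z0 * ii R).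
          apply: (@cder_comp_line R G1 z0) => [| |t] //.
            by apply: HG1; rewrite ?cRe_cxy ?cIm_cxy.
          by rewrite /z0 /cxy raddfB /=; ring.
        split.
          under eq_fun do rewrite cReM cRe_ii cIm_ii mulr0 mulr1 sub0r.
          rewrite cReM cRe_ii cIm_ii mulr0 mulr1 sub0r; exact: is_deriveN D2.
        under eq_fun do rewrite cImM cRe_ii cIm_ii mulr0 mulr1 addr0.
        by rewrite cImM cRe_ii cIm_ii mulr0 mulr1 addr0.
      by move: D => /scaleRe D; exact: is_deriveD D (Dl p.2).
    - move=> s hs; have {}hs := ball_lt p2 hs.
      rewrite (_ : (p.1, p.2) = p); last by case: (p).
      by apply: Hp => //; exact: ltW.
  move: h2; rewrite -mulrA iiM mulrN1 mulrN cReN; lra.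
apply; rewrite (cxyE z); apply: le_trans (Hp (cRe z, cIm z) zr zi).
by rewrite lerDl mulr_ge0 ?(ltW e0) // addr_ge0 // sqr_ge0.
Qed.

(** The factor k of modulus 1 rotates the value at z onto the positive real axis, where the bound on
    real parts is a bound on the modulus. *)
Lemma max_modulus (M : R) :
  (forall z, `|cRe z| <= r -> `|cIm z| <= r -> `|cRe z| = r \/ `|cIm z| = r ->
     nrm (G z) <= M) ->
  forall z, `|cRe z| <= r -> `|cIm z| <= r -> nrm (G z) <= M.
Proof.
move=> HM z zr zi.
have [g0|g0] := eqVneq (G z) 0.
  (* No rotation is defined here; a boundary point shows that M is nonnegative. *)
  rewrite g0 nrm0; pose w : C := cxy r 0.
  have : nrm (G w) <= M.
    apply: HM; rewrite ?cRe_cxy ?cIm_cxy ?normr0 ?(ltW r0) // ?gtr0_norm //.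
    by left.
  by apply: le_trans; exact: nrm_ge0.
pose k := rc (nrm (G z)) / G z.
have nk : nrm k = 1 by rewrite /k nrmM nrmV nrm_rc (ger0_norm (nrm_ge0 _)) mulfV ?nrm_eq0.
have -> : nrm (G z) = cRe (k * G z) by rewrite divfK.
apply: real_part_max => // w w1 w2 w3; apply: le_trans (HM w w1 w2 w3).
by rewrite (le_trans (ler_norm _)) // (le_trans (Re_le_nrm _)) // nrmM nk mul1r.
Qed.

End MaxPrinciple.

(** * Primitives on a square and the identity theorem *)

Section Identity.
Variable R : realType.
Notation C := (CC R).

Lemma cder_is_derive (f : C -> C) (z l : C) : cder f z l -> is_derive z 1 f l.
Proof.
move=> H.
have cv : (fun h : C => h^-1 *: (f (h *: 1 + z) - f z)) @ 0^' --> l.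
  apply/(@cvgrPdistC_lt C C C (0^')) => _ /rc_gt0[e e0 ->].
  have [d d0 Hd] := H (e / 2) (divr_gt0 e0 (ltr0Sn _ 1)).
  have : \forall h \near (0:C), nrm (h - 0) < d by apply/near_nrmP; exists d.
  rewrite !near_withinE; apply: filterS => h; rewrite subr0 => hd h0.
  rewrite norm_lt_rc /GRing.scale /= mulr1.
  have := Hd (h + z); rewrite addrK => /(_ hd) {}Hd.
  have h1 : 0 < nrm h by rewrite nrm_gt0.
  rewrite -(ltr_pM2r h1) -nrmM mulrBl mulrAC mulVf // mul1r.
  apply: le_lt_trans Hd _; rewrite ltr_pM2r //; lra.
apply: DeriveDef; first by apply/cvg_ex; exists l.
exact: cvg_lim.
Qed.

Lemma is_derive_cder (f : C -> C) (z l : C) : is_derive z 1 f l -> cder f z l.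
Proof.
move=> D; have := derivable_cder (@ex_derive _ _ _ _ _ _ _ D).
by rewrite derive1E derive_val.
Qed.

Lemma cder_near (f g : C -> C) (z l : C) (d : R) : 0 < d ->
  (forall w, nrm (w - z) < d -> f w = g w) -> cder f z l -> cder g z l.
Proof.
move=> d0 fg H e e0; have [c c0 Hc] := H e e0.
exists (Num.min c d); first by rewrite lt_min c0.
move=> w; rewrite lt_min => /andP[wc wd]; rewrite -!fg ?subrr ?nrm0 //.
exact: Hc.
Qed.

Lemma cder_unique (f : C -> C) (z l m : C) : cder f z l -> cder f z m -> l = m.
Proof.
move=> /cder_is_derive D1 /cder_is_derive D2.
by rewrite -(@derive_val _ _ _ _ _ _ _ D1) (@derive_val _ _ _ _ _ _ _ D2).
Qed.

Lemma cder0 z : cder (fun _ : C => 0 : C) z 0.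
Proof.
by move=> e e0; exists 1; rewrite ?ltr01 // => w _; rewrite mul0r !subr0 nrm0 mulr_ge0 ?nrm_ge0 // ltW.
Qed.

Lemma geometric_le0 (a M q : R) : 0 <= q < 1 -> (forall n, a <= M * q ^+ n) -> a <= 0.
Proof.
move=> /andP[q0 q1] H; rewrite leNgt; apply/negP => a0.
have q1' : `|q| < 1 by rewrite ger0_norm.
have /cvgrPdistC_lt/(_ _ a0)[N _ /(_ N (leqnn N))] := @cvg_geometric R M q q1'.
by rewrite subr0 /geometric /= ltNge (le_trans (H N)) // ler_norm.
Qed.

(** The primitive integrates f from 0 along the real axis and then vertically. Vanishing contours
    allow its increment from z to w to be computed along a path that starts at z and stays near it,
    on which f is almost constant. The tolerance e / 4 absorbs the two legs of the path and the
    factor 2 of [rder_bound]. *)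
Lemma primitive_square (f df : C -> C) (rho : R) : 0 < rho ->
  (forall z, `|cRe z| <= rho -> `|cIm z| <= rho -> cder f z (df z)) ->
  exists2 F : C -> C, F 0 = 0 &
    forall z, `|cRe z| < rho -> `|cIm z| < rho -> cder F z (f z).
Proof.
move=> rho0 Hf.
have [A HA] := primitivesA rho0 Hf; have [B HB] := primitivesB rho0 Hf.
have K0 a b c d : `|a| < rho -> `|b| < rho -> `|c| < rho -> `|d| < rho ->
    contour A B a b c d = 0.
  wlog ab : a b / a <= b => [Hw|].
    have [|/ltW ba] := leP a b; first exact: Hw.
    move=> ? ? ? ?; have -> : contour A B a b c d = - contour A B b a c d.
      by rewrite /contour; ring.
    by rewrite Hw // oppr0.
  wlog cd : c d / c <= d => [Hw|].
    have [|/ltW dc] := leP c d; first exact: Hw.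
    move=> ? ? ? ?; have -> : contour A B a b c d = - contour A B a b d c.
      by rewrite /contour; ring.
    by rewrite Hw // oppr0.
  exact: goursat_ordered Hf _ _ HA HB _ _ _ _ ab cd.
exists (fun z => (A 0 (cRe z) - A 0 0) + ii R * (B (cRe z) (cIm z) - B (cRe z) 0)).
  by rewrite cRe0 cIm0 !subrr mulr0 addr0.
move=> z zr zi e e0; set x := cRe z; set y := cIm z.
have /continuous_nrmP/(_ (e / 4)) : {for z, continuous f}.
  by apply: (@cder_continuous R f z (df z)); apply: Hf; exact: ltW.
case; first by rewrite divr_gt0.
move=> d d0 Hd.
exists (Num.min (d / 2) (Num.min (rho - `|x|) (rho - `|y|))).
  by rewrite !lt_min divr_gt0 //= !subr_gt0 zr.
move=> w; rewrite !lt_min => /and3P[wd wx wy].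
set x1 := cRe w; set y1 := cIm w.
have hx : `|x1 - x| <= nrm (w - z) by rewrite /x1 /x -raddfB Re_le_nrm.
have hy : `|y1 - y| <= nrm (w - z) by rewrite /y1 /y -raddfB Im_le_nrm.
have x1r : `|x1| < rho by apply: ball_lt zr _; exact: le_lt_trans wx.
have y1r : `|y1| < rho by apply: ball_lt zi _; exact: le_lt_trans wy.
have rr0 : `|0 : R| < rho by rewrite normr0.
(* This rectangle trades the increment on the real axis for the one at height y. *)
have := K0 x x1 0 y zr x1r rr0 zi; rewrite /contour => K.
have -> : A 0 x1 - A 0 0 + ii R * (B x1 y1 - B x1 0) - (A 0 x - A 0 0 + ii R * (B x y - B x 0)) -
   f z * (w - z) = ((A y x1 - f z * rc x1) - (A y x - f z * rc x))
   + ii R * ((B x1 y1 - f z * rc y1) - (B x1 y - f z * rc y)) +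
   (A 0 x1 - A 0 x - (A y x1 - A y x) + ii R * (B x1 y - B x1 0 - (B x y - B x 0))).
  have -> : w - z = cxy x1 y1 - cxy x y by rewrite -!cxyE.
  by rewrite /cxy; ring.
rewrite K addr0.
have btw (a b t : R) : Num.min a b <= t <= Num.max a b -> `|t - a| <= `|b - a|.
  have [ab|/ltW ab] := leP a b.
    move=> /andP[? ?]; rewrite !ger0_norm ?subr_ge0 //; lra.
  move=> /andP[? ?]; rewrite !ler0_norm ?subr_le0 //; lra.
have dist a b : `|a - x| <= `|x1 - x| -> `|b - y| <= `|y1 - y| -> nrm (f (cxy a b) - f z) <= e / 4.
  move=> ha hb; apply/ltW/Hd; apply: le_lt_trans (nrm_le_ReIm _) _.
  rewrite !raddfB /= cRe_cxy cIm_cxy -/x -/y; apply: le_lt_trans (lerD ha hb) _.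
  by rewrite [ltRHS](splitr d) ltrD //; exact: le_lt_trans wd.
apply: le_trans (nrm_triangle _ _) _; rewrite nrmM nrm_ii mul1r.
have -> : e * nrm (w - z) = 2 * (e / 4) * nrm (w - z) + 2 * (e / 4) * nrm (w - z) by field.
apply: lerD.
  apply: (@le_trans _ _ (2 * (e / 4) * `|x1 - x|)); last first.
    by rewrite ler_wpM2l // mulr_ge0 // divr_ge0 // ltW.
  apply: (@rder_bound R (fun s => A y s - f z * rc s) (fun s => f (cxy s y) - f z)).
  move=> s /btw hs; split; last by apply: dist => //; rewrite subrr normr0.
  apply: rderB.
    apply: HA; first exact: ltW.
    by apply: (ball_lt zr); apply: le_lt_trans hs _; exact: le_lt_trans wx.
  by rewrite -[X in rder _ _ X]mulr1 -(rmorph1 (@rc R)); apply: rder_scale; exact: is_derive_id.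
apply: (@le_trans _ _ (2 * (e / 4) * `|y1 - y|)); last first.
  by rewrite ler_wpM2l // mulr_ge0 // divr_ge0 // ltW.
apply: (@rder_bound R (fun s => B x1 s - f z * rc s) (fun s => f (cxy x1 s) - f z)).
move=> s /btw hs; split; last exact: dist.
apply: rderB.
  apply: HB; first exact: ltW.
  by apply: (ball_lt zi); apply: le_lt_trans hs _; exact: le_lt_trans wy.
by rewrite -[X in rder _ _ X]mulr1 -(rmorph1 (@rc R)); apply: rder_scale; exact: is_derive_id.
Qed.

Lemma constant_disc (F : C -> C) (d : R) : (forall z, nrm z < d -> cder F z 0) ->
  forall z, nrm z < d -> F z = F 0.
Proof.
move=> H z zd; apply/eqP; rewrite -subr_eq0 -nrm_eq0 eq_le nrm_ge0 andbT.
have h : nrm (F (z * rc 1) - F (z * rc 0)) <= 2 * 0 * `|1 - 0|.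
  apply: (@rder_bound R (fun s => F (z * rc s)) (fun s => 0)) => s.
  rewrite (min_idPl ler01) (max_idPr ler01) => /andP[s0 s1]; rewrite nrm0; split=> //.
  rewrite -(mul0r z); apply: (@cder_comp_line R F (z * rc s)) => [| |t] //.
    apply: H; rewrite nrmM nrm_rc ger0_norm //; apply: le_lt_trans zd.
    by rewrite ler_piMr ?nrm_ge0.
  by rewrite raddfB /=; ring.
by move: h; rewrite rmorph1 rmorph0 mulr1 !mulr0 mul0r.
Qed.

(** The primitive F of f vanishes near 0, so F(u) / u^n is holomorphic for every n and, unlike f at
    this point, has a second derivative. The maximum principle gives |F(w)| <= M (|w| / r)^n for all
    n; hence F = 0 on the disc of radius r, and f is its derivative. *)
Theorem identity_disc (f : C -> C) (rho d : R) : 0 < d ->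
  (forall z, `|cRe z| < rho -> `|cIm z| < rho -> derivable f z 1) ->
  (forall z, nrm z < d -> f z = 0) ->
  forall z, nrm z < rho -> f z = 0.
Proof.
move=> d0 Hf Hz z zrho.
(* The radii satisfy [nrm z < r < s < rho]: the maximum principle is used on the square of r, the
   primitive lives on the square of s. *)
pose r := (nrm z + rho) / 2; pose s := (r + rho) / 2.
have zr : nrm z < r by rewrite /r; lra.
have rs : r < s by rewrite /s /r; lra.
have srho : s < rho by rewrite /s /r; lra.
have r0 : 0 < r by exact: le_lt_trans (nrm_ge0 z) zr.
have s0 : 0 < s by exact: lt_trans rs.
pose df : C -> C := derive1 f.
have Hdf w : `|cRe w| <= s -> `|cIm w| <= s -> cder f w (df w).
  by move=> h1 h2; apply: derivable_cder; apply: Hf; exact: le_lt_trans srho.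
have [F F0 HF] := primitive_square s0 Hdf.
pose c := Num.min d s.
have c0 : 0 < c by rewrite lt_min d0.
have wsq w : nrm w < s -> `|cRe w| < s /\ `|cIm w| < s.
  by move=> h; split; [exact: le_lt_trans (Re_le_nrm _) h|exact: le_lt_trans (Im_le_nrm _) h].
have Fz w : nrm w < c -> F w = 0.
  move=> wc; rewrite -F0; apply: (@constant_disc F c) => // u; rewrite lt_min => /andP[ud us].
  by rewrite -(Hz _ ud); have [h1 h2] := wsq _ us; exact: HF.
have near0 w : nrm w < c -> forall u, nrm (u - w) < c - nrm w -> nrm u < c.
  by move=> wc u uw; have := nrm_triangle (u - w) w; rewrite subrK; lra.
suff FW : forall w, nrm w < r -> F w = 0.
  have zs : nrm z < s by exact: lt_trans rs.
  have [h1 h2] := wsq _ zs.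
  apply: (cder_unique (HF z h1 h2)).
  apply: (@cder_near (fun=> 0) _ _ _ (r - nrm z)); [by rewrite subr_gt0| |exact: cder0].
  by move=> w wz; rewrite FW //; have := nrm_triangle (w - z) z; rewrite subrK; lra.
have sq_le w (t : R) : `|cRe w| <= t -> `|cIm w| <= t -> t < s -> `|cRe w| < s /\ `|cIm w| < s.
  by move=> ? ? ts; split; exact: le_lt_trans ts.
have [M M0 HM] : exists2 M, 0 <= M & forall w, `|cRe w| <= r -> `|cIm w| <= r -> nrm (F w) <= M.
  have [||p [p1 p2 Hp]] := @square_EVT R (fun p => nrm (F (cxy p.1 p.2))) r; first exact: ltW.
    move=> p p1 p2; apply: (@continuous_comp _ _ _ (fun q : R * R => F (cxy q.1 q.2)) (@nrm R)).
      by apply: cder_continuous2; apply: HF; rewrite ?cRe_cxy ?cIm_cxy; exact: le_lt_trans rs.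
    exact: nrm_continuous.
  exists (nrm (F (cxy p.1 p.2))) => // w w1 w2.
  by have := Hp (cRe w, cIm w) w1 w2; rewrite /= -cxyE.
move=> w wr; have [->//|w0] := eqVneq w 0.
have nw : 0 < nrm w by rewrite nrm_gt0.
apply/eqP; rewrite -nrm_eq0 eq_le nrm_ge0 andbT.
apply: (@geometric_le0 _ M (nrm w / r)).
  by rewrite divr_ge0 ?ltW //= ltr_pdivrMr // mul1r.
move=> n.
(* At u = 0 the convention 0^-1 = 0 is harmless: F vanishes on a whole disc around 0, and G and G1
   vanish with it. *)
pose G u := F u * (u^-1) ^+ n.
pose G1 u := f u * (u^-1) ^+ n - F u * (n%:R * (u^-1) ^+ n.+1).
pose G2 : C -> C := derive1 G1.
have DV (u : C) : u != 0 -> is_derive u 1 (fun v : C => v^-1) (- (u^-1) ^+ 2).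
  move=> u0; apply: DeriveDef; first exact: (@derivableV _ _ id u 1 u0 (@derivable_id _ _ u 1)).
  by rewrite (@deriveV _ _ id u 1 u0 (@derivable_id _ _ u 1)) derive_id exprVn /GRing.scale /= mulr1.
have DX m (u : C) : u != 0 -> is_derive u 1 (fun v : C => (v^-1) ^+ m) (- (m%:R * (u^-1) ^+ m.+1)).
  move=> u0; elim: m => [|m IH].
    rewrite mul0r oppr0; under eq_fun do rewrite expr0; exact: is_derive_cst.
  under eq_fun do rewrite exprS.
  have D := @is_deriveM C C (fun v => v^-1) (fun v => (v^-1) ^+ m) u 1 _ _ (DV u u0) IH.
  apply: (is_derive_eq D); rewrite /GRing.scale /= !exprS -natr1; ring.
have HG u : `|cRe u| < s -> `|cIm u| < s -> cder G u (G1 u).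
  move=> u1 u2; have [uc|uc] := ltP (nrm u) c.
    have -> : G1 u = 0 by rewrite /G1 Hz ?Fz ?mul0r ?subr0 //; move: uc; rewrite lt_min => /andP[].
    apply: (@cder_near (fun=> 0) _ _ _ (c - nrm u)); [by rewrite subr_gt0| |exact: cder0].
    by move=> v /(near0 _ uc) vc; rewrite /G Fz // mul0r.
  have u0 : u != 0 by rewrite -nrm_gt0; exact: lt_le_trans uc.
  apply: is_derive_cder; have D1 := cder_is_derive (HF u u1 u2).
  have := @is_deriveM C C F (fun v => (v^-1) ^+ n) u 1 _ _ D1 (DX n u u0) => D.
  by apply: (is_derive_eq D); rewrite /G1 /GRing.scale /=; ring.
have HG1 u : `|cRe u| < s -> `|cIm u| < s -> cder G1 u (G2 u).
  move=> u1 u2; apply: derivable_cder; have [uc|uc] := ltP (nrm u) c.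
    apply: (@ex_derive _ _ _ _ _ _ 0); apply: cder_is_derive.
    apply: (@cder_near (fun=> 0) _ _ _ (c - nrm u)); [by rewrite subr_gt0| |exact: cder0].
    move=> v /(near0 _ uc) vc; rewrite /G1 Fz // Hz ?mul0r ?subr0 //.
    by move: vc; rewrite lt_min => /andP[].
  have u0 : u != 0 by rewrite -nrm_gt0; exact: lt_le_trans uc.
  have D1 := cder_is_derive (HF u u1 u2).
  have D2 := cder_is_derive (Hdf u (ltW u1) (ltW u2)).
  have E1 := @is_deriveM C C f (fun v => (v^-1) ^+ n) u 1 _ _ D2 (DX n u u0).
  have E2 := @is_deriveZ C C C (fun v => (v^-1) ^+ n.+1) n%:R u 1 _ (DX n.+1 u u0).
  have E3 := @is_deriveM C C F _ u 1 _ _ D1 E2.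
  exact: (@ex_derive _ _ _ _ _ _ _ (is_deriveB E1 E3)).
have nwX : 0 < nrm w ^+ n by rewrite exprn_gt0.
have [w1 w2] : `|cRe w| <= r /\ `|cIm w| <= r.
  by split; apply: ltW; [exact: le_lt_trans (Re_le_nrm _) wr|exact: le_lt_trans (Im_le_nrm _) wr].
have : nrm (G w) <= M * (r^-1) ^+ n.
  apply: (max_modulus r0 rs HG HG1) => // u u1 u2 ur.
  rewrite /G nrmM nrmX nrmV; apply: ler_pM; rewrite ?nrm_ge0 ?exprn_ge0 ?invr_ge0 ?nrm_ge0 ?HM //.
  have ru : r <= nrm u.
    by case: ur => <-; [exact: Re_le_nrm|exact: Im_le_nrm].
  have u0 : 0 < nrm u by exact: lt_le_trans ru.
  by apply: lerXn2r; rewrite ?nnegrE ?invr_ge0 ?nrm_ge0 ?(ltW r0) // lef_pV2.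
have -> : nrm (G w) = nrm (F w) * (nrm w ^+ n)^-1 by rewrite /G nrmM nrmX nrmV exprVn.
rewrite ler_pdivrMr //; have -> // : M * r^-1 ^+ n * nrm w ^+ n = M * (nrm w / r) ^+ n.
by rewrite exprMn; ring.
Qed.

End Identity.

(** * The lattice and its majorants *)

Section Form.

(** The block matrix as a function of natural numbers, so that sums over concrete indices compute: 0
    to 3 are the two hyperbolic planes, 4 to 11 the E8 part, 12 to 16 the A1 summands. *)
Definition gram_entry (i j : nat) : int :=
  if (i < 4)%N || (j < 4)%N then
    ((i < 4)%N && (j < 4)%N && (i./2 == j./2) && (i != j))%:R
  else if (i < 12)%N && (j < 12)%N then
    (if i == j then - 2%:R else (E8_edge (i - 4) (j - 4) || E8_edge (j - 4) (i - 4))%:R)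
  else if i == j then - 2%:R else 0.

Lemma gramT_entry (i j : 'I_17) : gramT i j = gram_entry i j.
Proof.
rewrite /gramT; move: i j; rewrite -[17%N]/(2 + (2 + (8 + 5)))%N => i j.
case: (split_ordP i) => i1 ->; case: (split_ordP j) => j1 ->.
- rewrite block_mxEul !mxE /gram_entry /=.
  by case: i1 => -[|[|[]]] //= p; case: j1 => -[|[|[]]] //= q.
- rewrite block_mxEur !mxE /gram_entry /=.
  case: i1 => -[|[|[]]] //= p; by rewrite -[(2 + j1)%N]/(j1.+2) /=; case: (j1 : nat) => [|[|k]] //=.
- rewrite block_mxEdl !mxE /gram_entry /=.
  by case: j1 => -[|[|[]]] //= p; rewrite -[(2 + i1)%N]/(i1.+2) /=; case: (i1 : nat) => [|[|k]] //=.
rewrite block_mxEdr.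
case: (split_ordP i1) => i2 ->; case: (split_ordP j1) => j2 ->.
- rewrite block_mxEul !mxE /gram_entry /=.
  by case: i2 => -[|[|[]]] //= p; case: j2 => -[|[|[]]] //= q.
- rewrite block_mxEur !mxE /gram_entry /=.
  by case: i2 => -[|[|[]]] //= p.
- rewrite block_mxEdl !mxE /gram_entry /=.
  by case: j2 => -[|[|[]]] //= p.
rewrite block_mxEdr.
case: (split_ordP i2) => i3 ->; case: (split_ordP j2) => j3 ->.
- rewrite block_mxEul !mxE /gram_entry /=.
  by case: i3 => -[|[|[|[|[|[|[|[|]]]]]]]] //= p; case: j3 => -[|[|[|[|[|[|[|[|]]]]]]]] //= q.
- rewrite block_mxEur !mxE /gram_entry /=.
  by case: i3 => -[|[|[|[|[|[|[|[|]]]]]]]] //= p.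
- rewrite block_mxEdl !mxE /gram_entry /=.
  by case: j3 => -[|[|[|[|[|[|[|[|]]]]]]]] //= p; rewrite andbF //=.
rewrite block_mxEdr !mxE /gram_entry /=.
by case: i3 => -[|[|[|[|[|]]]]] //= p; case: j3 => -[|[|[|[|[|]]]]] //= q.
Qed.

(** Natural indices keep concrete coordinates readable; [inord] sends an index beyond 16 to 0, which
    is why the bound [k < 17] accompanies the statements. *)
Definition co {K : nzRingType} (k : nat) (x : 'rV[K]_17) : K := x 0 (inord k).

Lemma formE (K : comNzRingType) (x y : 'rV[K]_17) : form x y =
  co 0 x * co 1 y + co 1 x * co 0 y + co 2 x * co 3 y + co 3 x * co 2 y
  - (2 * (co 4 x * co 4 y + co 5 x * co 5 y + co 6 x * co 6 y + co 7 x * co 7 y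
        + co 8 x * co 8 y + co 9 x * co 9 y + co 10 x * co 10 y + co 11 x * co 11 y)
     - (co 4 x * co 5 y + co 5 x * co 4 y) - (co 5 x * co 6 y + co 6 x * co 5 y)
     - (co 6 x * co 7 y + co 7 x * co 6 y) - (co 7 x * co 8 y + co 8 x * co 7 y)
     - (co 8 x * co 9 y + co 9 x * co 8 y) - (co 9 x * co 10 y + co 10 x * co 9 y)
     - (co 6 x * co 11 y + co 11 x * co 6 y))
  - 2 * (co 12 x * co 12 y + co 13 x * co 13 y + co 14 x * co 14 y
         + co 15 x * co 15 y + co 16 x * co 16 y).
Proof.
have ordE (F : 'I_17 -> K) : \sum_i F i = \sum_(0 <= i < 17) F (inord i).
  by rewrite big_mkord; apply: eq_bigr => i _; rewrite inord_val.
rewrite /form -mulmxA mxE ordE.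
have E i : (i < 17)%N -> (ext gramT *m y^T) (inord i) 0 =
    \sum_(0 <= j < 17) (gram_entry i j)%:~R * co j y.
  move=> i17; rewrite mxE ordE; apply: eq_big_nat => j /andP[_ j17].
  by rewrite [ext gramT _ _]mxE [y^T _ _]mxE gramT_entry !inordK.
rewrite (eq_big_nat _ _ (F2 := fun i => co i x * \sum_(0 <= j < 17) (gram_entry i j)%:~R * co j y)); last first.
  by move=> i /andP[_ i17]; rewrite E.
rewrite unlock /= /gram_entry /=.
ring.
Qed.

Lemma formDl (K : nzRingType) (x y z : 'rV[K]_17) : form (x + y) z = form x z + form y z.
Proof. by rewrite /form !mulmxDl mxE. Qed.
Lemma formDr (K : nzRingType) (x y z : 'rV[K]_17) : form z (x + y) = form z x + form z y.
Proof. by rewrite /form raddfD /= mulmxDr mxE. Qed.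
Lemma formNl (K : nzRingType) (x z : 'rV[K]_17) : form (- x) z = - form x z.
Proof. by rewrite /form !mulNmx mxE. Qed.
Lemma formNr (K : nzRingType) (x z : 'rV[K]_17) : form z (- x) = - form z x.
Proof. by rewrite /form raddfN /= mulmxN mxE. Qed.
Lemma formBl (K : nzRingType) (x y z : 'rV[K]_17) : form (x - y) z = form x z - form y z.
Proof. by rewrite formDl formNl. Qed.
Lemma formBr (K : nzRingType) (x y z : 'rV[K]_17) : form z (x - y) = form z x - form z y.
Proof. by rewrite formDr formNr. Qed.
Lemma formZl (K : nzRingType) a (x z : 'rV[K]_17) : form (a *: x) z = a * form x z.
Proof. by rewrite /form -!scalemxAl mxE. Qed.
Lemma formZr (K : comNzRingType) a (x z : 'rV[K]_17) : form z (a *: x) = a * form z x.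
Proof. by rewrite /form linearZ /= -scalemxAr mxE. Qed.
Lemma formC (K : comNzRingType) (x y : 'rV[K]_17) : form x y = form y x.
Proof. by rewrite !formE; ring. Qed.
Lemma form0l (K : nzRingType) (z : 'rV[K]_17) : form 0 z = 0.
Proof. by rewrite /form !mul0mx mxE. Qed.
Lemma form0r (K : nzRingType) (z : 'rV[K]_17) : form z 0 = 0.
Proof. by rewrite /form trmx0 mulmx0 mxE. Qed.

Definition formlinE := (formDl, formDr, formBl, formBr, formNl, formNr, formZl, formZr,
  form0l, form0r).

Lemma form_suml (K : nzRingType) (I : Type) (s : seq I) (F : I -> 'rV[K]_17) z :
  form (\sum_(i <- s) F i) z = \sum_(i <- s) form (F i) z.
Proof. by elim/big_rec2: _ => [|i u v _ <-]; rewrite ?form0l ?formDl. Qed.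

Lemma coD (K : nzRingType) k (x y : 'rV[K]_17) : co k (x + y) = co k x + co k y.
Proof. by rewrite /co mxE. Qed.
Lemma coN (K : nzRingType) k (x : 'rV[K]_17) : co k (- x) = - co k x.
Proof. by rewrite /co mxE. Qed.
Lemma coZ (K : nzRingType) k a (x : 'rV[K]_17) : co k (a *: x) = a * co k x.
Proof. by rewrite /co mxE. Qed.
Lemma co_0 (K : nzRingType) k : co k (0 : 'rV[K]_17) = 0.
Proof. by rewrite /co mxE. Qed.
Lemma co_ext (K : nzRingType) k (x : latT) : co k (ext x : 'rV[K]_17) = (co k x)%:~R.
Proof. by rewrite /co mxE. Qed.

Lemma co_inj (K : nzRingType) (x y : 'rV[K]_17) :
  (forall k, (k < 17)%N -> co k x = co k y) -> x = y.
Proof.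
move=> H; apply/rowP => i; have := H i (ltn_ord i).
by rewrite /co inord_val.
Qed.

Lemma form_ext (K : comNzRingType) (x y : latT) :
  form (ext x : 'rV[K]_17) (ext y) = (form x y)%:~R.
Proof. by rewrite !formE !co_ext; ring. Qed.

Lemma form_even (x : latT) : exists k : int, form x x = 2 * k.
Proof.
rewrite formE; set u := co 0 x * co 1 x + co 2 x * co 3 x.
eexists; rewrite [LHS](_ : _ = 2 * (u
  - ((co 4 x * co 4 x + co 5 x * co 5 x + co 6 x * co 6 x + co 7 x * co 7 x
        + co 8 x * co 8 x + co 9 x * co 9 x + co 10 x * co 10 x + co 11 x * co 11 x)
     - co 4 x * co 5 x - co 5 x * co 6 x
     - co 6 x * co 7 x - co 7 x * co 8 x
     - co 8 x * co 9 x - co 9 x * co 10 x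
     - co 6 x * co 11 x)
  - (co 12 x * co 12 x + co 13 x * co 13 x + co 14 x * co 14 x
         + co 15 x * co 15 x + co 16 x * co 16 x))) //.
by rewrite /u; ring.
Qed.

Definition vec (s : seq int) : latT := \row_i nth 0 s i.
Lemma co_vec s k : (k < 17)%N -> co k (vec s) = nth 0 s k.
Proof. by move=> k17; rewrite /co mxE inordK. Qed.

Definition bv (k : nat) : latT := vec (rcons (nseq k 0) 1).
Lemma co_bv j k : (j < 17)%N -> co j (bv k) = (j == k)%:R.
Proof.
move=> j17; rewrite co_vec // nth_rcons size_nseq nth_nseq.
by case: ltngtP.
Qed.

(* a basis dual to bv, up to the factors -2 of form_dv; the entries of the E8
   part are minus the inverse Cartan matrix *)
Definition dv (k : nat) : latT := nth 0 [:: bv 1; bv 0; bv 3; bv 2;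
  - vec [:: 0; 0; 0; 0; 4; 7; 10; 8; 6; 4; 2; 5];
  - vec [:: 0; 0; 0; 0; 7; 14; 20; 16; 12; 8; 4; 10];
  - vec [:: 0; 0; 0; 0; 10; 20; 30; 24; 18; 12; 6; 15];
  - vec [:: 0; 0; 0; 0; 8; 16; 24; 20; 15; 10; 5; 12];
  - vec [:: 0; 0; 0; 0; 6; 12; 18; 15; 12; 8; 4; 9];
  - vec [:: 0; 0; 0; 0; 4; 8; 12; 10; 8; 6; 3; 6];
  - vec [:: 0; 0; 0; 0; 2; 4; 6; 5; 4; 3; 2; 3];
  - vec [:: 0; 0; 0; 0; 5; 10; 15; 12; 9; 6; 3; 8];
  bv 12; bv 13; bv 14; bv 15; bv 16] k.

Lemma form_dv (K : comNzRingType) (x : 'rV[K]_17) k : (k < 17)%N ->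
  form x (ext (dv k)) = (if (k < 12)%N then 1 else - 2) * co k x.
Proof.
rewrite formE !co_ext.
do 17 (case: k => [|k]; first by rewrite /dv /= ?coN ?co_bv ?co_vec //= => _; ring).
by [].
Qed.

Lemma form_nondeg (K : numDomainType) (x : 'rV[K]_17) :
  (forall t : latT, form x (ext t) = 0) -> x = 0.
Proof.
move=> H; apply: co_inj => k k17; rewrite co_0.
have := H (dv k); rewrite form_dv //; case: ifP => _; first by rewrite mul1r.
by move/eqP; rewrite mulf_eq0 oppr_eq0 pnatr_eq0 /= => /eqP.
Qed.

End Form.

(** * The orthogonal complement of a positive plane *)

Section Signature.
Variable R : realFieldType.
Implicit Types x y a b : 'rV[R]_17.

Lemma negative_part x : form x x <= 2 * (co 0 x * co 1 x) + 2 * (co 2 x * co 3 x).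
Proof.
rewrite formE.
(* Squares are completed along the three arms of the diagram, from their ends towards the branch
   vertex a2; its remaining coefficient is 2 - 2/3 - 1/2 - 4/5 = 1/30. *)
have E8pos (a0 a1 a2 a3 a4 a5 a6 a7 : R) :
  0 <= 2 * (a0 * a0 + a1 * a1 + a2 * a2 + a3 * a3 + a4 * a4 + a5 * a5 + a6 * a6 + a7 * a7)
     - (a0 * a1 + a1 * a0) - (a1 * a2 + a2 * a1) - (a2 * a3 + a3 * a2) - (a3 * a4 + a4 * a3)
     - (a4 * a5 + a5 * a4) - (a5 * a6 + a6 * a5) - (a2 * a7 + a7 * a2).
  have -> : 2 * (a0 * a0 + a1 * a1 + a2 * a2 + a3 * a3 + a4 * a4 + a5 * a5 + a6 * a6 + a7 * a7)
     - (a0 * a1 + a1 * a0) - (a1 * a2 + a2 * a1) - (a2 * a3 + a3 * a2) - (a3 * a4 + a4 * a3)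
     - (a4 * a5 + a5 * a4) - (a5 * a6 + a6 * a5) - (a2 * a7 + a7 * a2) =
    2 * (a0 - a1 / 2) ^+ 2 + 3 / 2 * (a1 - 2 / 3 * a2) ^+ 2 + 2 * (a7 - a2 / 2) ^+ 2
    + 2 * (a6 - a5 / 2) ^+ 2 + 3 / 2 * (a5 - 2 / 3 * a4) ^+ 2 + 4 / 3 * (a4 - 3 / 4 * a3) ^+ 2
    + 5 / 4 * (a3 - 4 / 5 * a2) ^+ 2 + 1 / 30 * a2 ^+ 2 by field.
  by rewrite !addr_ge0 // mulr_ge0 ?sqr_ge0 ?divr_ge0.
have := E8pos (co 4 x) (co 5 x) (co 6 x) (co 7 x) (co 8 x) (co 9 x) (co 10 x) (co 11 x).
have A1pos : 0 <= co 12 x * co 12 x + co 13 x * co 13 x + co 14 x * co 14 x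
         + co 15 x * co 15 x + co 16 x * co 16 x.
  by rewrite !addr_ge0 // -expr2 sqr_ge0.
by lra.
Qed.

Lemma negative_subspace x : co 0 x + co 1 x = 0 -> co 2 x + co 3 x = 0 -> form x x <= 0.
Proof.
move=> h1 h2; apply: le_trans (negative_part x) _.
have -> : co 1 x = - co 0 x by lra.
have -> : co 3 x = - co 2 x by lra.
have := sqr_ge0 (co 0 x); have := sqr_ge0 (co 2 x); rewrite !expr2; lra.
Qed.

(* A positive plane meets the 15-dimensional subspace of negative_subspace
   trivially; adding a vector of its orthogonal gives a nonzero intersection. *)
Lemma orthogonal_positive_plane a b x m : 0 < m -> form a a = m -> form b b = m ->
  form a b = 0 -> form x a = 0 -> form x b = 0 -> form x x <= 0.
Proof.
move=> m0 aa bb ab xa xb.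
pose h1 (v : 'rV[R]_17) := co 0 v + co 1 v; pose h2 (v : 'rV[R]_17) := co 2 v + co 3 v.
have key (p q r : R) : p * h1 a + q * h1 b + r * h1 x = 0 ->
   p * h2 a + q * h2 b + r * h2 x = 0 -> m * (p ^+ 2 + q ^+ 2) + r ^+ 2 * form x x <= 0.
  move=> e1 e2; have := @negative_subspace (p *: a + q *: b + r *: x).
  rewrite !coD !coZ !formlinE aa bb ab xa xb (formC b a) ab (formC a x) xa (formC b x) xb.
  rewrite /h1 /h2 in e1 e2.
  have -> : p * co 0 a + q * co 0 b + r * co 0 x + (p * co 1 a + q * co 1 b + r * co 1 x) = 0 by lra.
  have -> : p * co 2 a + q * co 2 b + r * co 2 x + (p * co 3 a + q * co 3 b + r * co 3 x) = 0 by lra.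
  by move=> /(_ erefl erefl); lra.
(* The pair (h1, h2) sends a, b and x to a plane, and Cramer's rule gives a relation between the
   images whose coefficient at x is g. If g = 0, already a and b are dependent there, which their
   positivity excludes. *)
pose g := h1 a * h2 b - h1 b * h2 a.
have [g0|gn] := eqVneq g 0; last first.
  have /(_ _ _) := key (h1 b * h2 x - h1 x * h2 b) (h1 x * h2 a - h1 a * h2 x) g.
  have z1 : (h1 b * h2 x - h1 x * h2 b) * h1 a + (h1 x * h2 a - h1 a * h2 x) * h1 b + g * h1 x = 0.
    by rewrite /g; ring.
  have z2 : (h1 b * h2 x - h1 x * h2 b) * h2 a + (h1 x * h2 a - h1 a * h2 x) * h2 b + g * h2 x = 0.
    by rewrite /g; ring.
  move=> /(_ z1 z2) H.
  have g2 : 0 < g ^+ 2 by rewrite exprn_even_gt0.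
  rewrite -(pmulr_rle0 _ g2).
  have : 0 <= m * ((h1 b * h2 x - h1 x * h2 b) ^+ 2 + (h1 x * h2 a - h1 a * h2 x) ^+ 2).
    by rewrite mulr_ge0 ?(ltW m0) // addr_ge0 // sqr_ge0.
  by lra.
have contra p q : p * h1 a + q * h1 b = 0 -> p * h2 a + q * h2 b = 0 -> p = 0 /\ q = 0.
  move=> e1 e2; have := key p q 0; rewrite !mul0r !addr0 expr0n mul0r addr0 => /(_ e1 e2).
  rewrite pmulr_rle0 // => H; have p2 := sqr_ge0 p; have q2 := sqr_ge0 q.
  by split; apply/eqP; rewrite -sqrf_eq0; apply/eqP; lra.
exfalso.
have [e1 e2] : h1 b = 0 /\ - h1 a = 0.
  by apply: contra; [ring|move: g0; rewrite /g; lra].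
have [e3 e4] : h2 b = 0 /\ - h2 a = 0.
  by apply: contra; [move: g0; rewrite /g; lra|ring].
have [] : (1 : R) = 0 /\ (0 : R) = 0 by apply: contra; lra.
by move/eqP; rewrite oner_eq0.
Qed.

End Signature.

(** * Real and imaginary parts of a period, and its majorant *)

Section RealImaginary.
Variable R : realType.
Notation C := (CC R).
Notation VC := 'rV[CC R]_17.
Notation VR := 'rV[R]_17.
Implicit Types (w v : VC) (x y : VR).

Definition vRe w : VR := map_mx (@cRe R) w.
Definition vIm w : VR := map_mx (@cIm R) w.
Definition vrc x : VC := map_mx (@rc R) x.

Lemma co_vrc k x : co k (vrc x) = rc (co k x). Proof. by rewrite /co mxE. Qed.
Lemma vReImE w : w = vrc (vRe w) + ii R *: vrc (vIm w).
Proof. by apply/rowP => i; rewrite !mxE; exact: cxyE. Qed.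
Lemma vIm_vrc x y : vIm (vrc x + ii R *: vrc y) = y.
Proof. by apply/rowP => i; rewrite !mxE; exact: cIm_cxy. Qed.
Lemma conjE w : map_mx Num.conj w = vrc (vRe w) - ii R *: vrc (vIm w).
Proof.
apply/rowP => i; rewrite !mxE; case: (w _ _) => a b.
by apply: cP; rewrite !cE /=; [rewrite /cRe /cIm /=; ring|rewrite /cRe /cIm /=; ring].
Qed.
Lemma vrc_ext (t : latT) : vrc (ext t) = ext t.
Proof. by apply/rowP => i; rewrite !mxE rmorph_int. Qed.

Lemma form_vrc x y : form (vrc x) (vrc y) = rc (form x y).
Proof. by rewrite !formE !co_vrc; ring. Qed.

Lemma form_ReIm w x : form w (vrc x) = cxy (form (vRe w) x) (form (vIm w) x).
Proof. by rewrite {1}(vReImE w) !formlinE !form_vrc. Qed.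

(** The affine cone over the period domain, so that one can work with vectors rather than with the
    chosen coordinates [hc]. *)
Definition Dc w : Prop := form w w = 0 /\ 0 < form w (map_mx Num.conj w).

Lemma form_selfE w : form w w =
  cxy (form (vRe w) (vRe w) - form (vIm w) (vIm w)) (2 * form (vRe w) (vIm w)).
Proof.
rewrite {1 2}(vReImE w) !formlinE !form_vrc (formC (vIm w)).
set aa := form (vRe w) (vRe w); set bb := form (vIm w) (vIm w); set ab := form _ _.
transitivity (rc aa + (ii R * ii R) * rc bb + 2 * ii R * rc ab); first by ring.
by rewrite iiM /cxy raddfB rmorphM /= rmorph_nat; ring.
Qed.

Lemma form_conjE w : form w (map_mx Num.conj w) =
  rc (form (vRe w) (vRe w) + form (vIm w) (vIm w)).
Proof.
rewrite conjE {1}(vReImE w) !formlinE !form_vrc (formC (vIm w)).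
set aa := form (vRe w) (vRe w); set bb := form (vIm w) (vIm w); set ab := form _ _.
transitivity (rc aa - (ii R * ii R) * rc bb); first by ring.
by rewrite iiM raddfD /=; ring.
Qed.

Lemma DcP w : Dc w <-> [/\ form (vIm w) (vIm w) = form (vRe w) (vRe w),
  form (vRe w) (vIm w) = 0 & 0 < form (vRe w) (vRe w)].
Proof.
rewrite /Dc form_selfE form_conjE; split.
  move=> [E]; rewrite ltcR.
  have := congr1 (@cRe R) E; have := congr1 (@cIm R) E.
  by rewrite cRe_cxy cIm_cxy cRe0 cIm0 => h1 h2 h3; split; lra.
move=> [h1 h2 h3]; split; last by rewrite ltcR; lra.
by rewrite h1 h2 subrr mulr0 /cxy !rmorph0 mulr0 addr0.
Qed.

Lemma Dc_neq0 w : Dc w -> w != 0.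
Proof. by move=> [_]; apply: contraTneq => ->; rewrite form0l ltxx. Qed.

Lemma DcZ c w : c != 0 -> Dc w -> Dc (c *: w).
Proof.
move=> c0 [h1 h2]; split; first by rewrite !formlinE h1 !mulr0.
rewrite map_mxZ /= !formlinE mulrA mulr_gt0 // -normCK exprn_gt0 //.
by rewrite normr_gt0.
Qed.

Lemma isometry_form (K : comNzRingType) (g : 'M[int]_17) (x y : 'rV[K]_17) : OT g ->
  form (x *m ext g) (y *m ext g) = form x y.
Proof.
move=> [_ gG]; rewrite /form trmx_mul !mulmxA.
have -> : x *m ext g *m ext gramT *m (ext g)^T = x *m ext gramT.
  rewrite -!mulmxA; congr (_ *m _); rewrite -[in RHS]gG !extM !mulmxA.
  by congr (_ *m _); rewrite /ext map_trmx.
by [].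
Qed.

Lemma conj_mul_ext w (g : 'M[int]_17) :
  map_mx Num.conj (w *m ext g) = map_mx Num.conj w *m (ext g : 'M[C]_17).
Proof.
rewrite map_mxM; congr (_ *m _); apply/matrixP => i j; rewrite !mxE.
by rewrite rmorph_int.
Qed.

Lemma Dc_mul w g : OT g -> Dc w -> Dc (w *m ext g).
Proof. by move=> Og [h1 h2]; rewrite /Dc conj_mul_ext !isometry_form. Qed.

(** For w in the cone this is the majorant of the form: it equals the form on the plane spanned by
    the real and imaginary parts of w, and minus the form on the orthogonal of that plane. *)
Definition maj w x : R :=
  2 * (form (vRe w) x ^+ 2 + form (vIm w) x ^+ 2) / form (vRe w) (vRe w) - form x x.

(** The projection x' of x to the orthogonal of the plane has nonpositive norm. Definiteness comes
    only later, in [maj_eq0], from the bound on coordinates. *)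
Lemma maj_ge0 w x : Dc w -> 0 <= maj w x.
Proof.
move=> /DcP[bb ab aa]; set a := vRe w in bb ab aa *; set b := vIm w in bb ab *.
pose m := form a a; have m0 : m != 0 by rewrite gt_eqF.
have [x' x'E] : exists x', x' = x - (form a x / m) *: a - (form b x / m) *: b by eexists.
have E1 : form x' a = 0.
  by rewrite x'E !formlinE (formC b a) ab mulr0 subr0 divfK // (formC x) subrr.
have E2 : form x' b = 0.
  by rewrite x'E !formlinE ab mulr0 subr0 bb divfK // (formC x) subrr.
have := @orthogonal_positive_plane R a b x' m aa erefl bb ab E1 E2.
have -> : form x' x' = form x x - (form a x ^+ 2 + form b x ^+ 2) / m.
  rewrite {2}x'E !formlinE E1 E2 !mulr0 !subr0 x'E !formlinE.
  by field.
rewrite /maj -/a -/b -/m => h.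
have : 0 <= (form a x ^+ 2 + form b x ^+ 2) / m.
  by rewrite divr_ge0 ?(ltW aa) // addr_ge0 // sqr_ge0.
by rewrite -mulrA; lra.
Qed.

Let bmaj w x y : R :=
  2 * (form (vRe w) x * form (vRe w) y + form (vIm w) x * form (vIm w) y)
    / form (vRe w) (vRe w) - form x y.

Lemma maj_scale w x y (s t : R) :
  maj w (s *: x + t *: y) = s ^+ 2 * maj w x + 2 * (s * t) * bmaj w x y + t ^+ 2 * maj w y.
Proof. by rewrite /maj /bmaj !formlinE (formC y x); ring. Qed.

(** Cauchy-Schwarz for a form that is only known to be semidefinite: if y has majorant 0 and the
    pairing did not vanish, a suitable multiple of y added to x would have a negative value. *)
Lemma bmaj_CS w x y : Dc w -> bmaj w x y ^+ 2 <= maj w x * maj w y.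
Proof.
move=> Hw; have x0 := maj_ge0 x Hw; have y0 := maj_ge0 y Hw.
have [e|ne] := eqVneq (maj w y) 0.
  suff -> : bmaj w x y = 0 by rewrite e mulr0 expr0n.
  apply/eqP; apply: contraT => b0; exfalso.
  have := maj_ge0 (1 *: x + (- (maj w x + 1) / (2 * bmaj w x y)) *: y) Hw.
  rewrite maj_scale e mulr0 addr0 expr1n !mul1r.
  have -> : 2 * (- (maj w x + 1) / (2 * bmaj w x y)) * bmaj w x y = - (maj w x + 1).
    by field; rewrite b0.
  lra.
have yp : 0 < maj w y by rewrite lt_neqAle eq_sym ne.
have := maj_ge0 (maj w y *: x + (- bmaj w x y) *: y) Hw; rewrite maj_scale.
have -> : maj w y ^+ 2 * maj w x + 2 * (maj w y * - bmaj w x y) * bmaj w x y +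
   (- bmaj w x y) ^+ 2 * maj w y = maj w y * (maj w x * maj w y - bmaj w x y ^+ 2) by ring.
by rewrite pmulr_rge0 // subr_ge0.
Qed.

(* The majorant is self-dual for the form: y and its image under the
   involution 1 on the plane, -1 on its orthogonal, have the same majorant. *)
Lemma maj_CS w x y : Dc w -> form x y ^+ 2 <= maj w x * maj w y.
Proof.
move=> Hw; have /DcP[bb ab aa] := Hw.
set a := vRe w in bb ab aa; set b := vIm w in bb ab.
have m0 : form a a != 0 by rewrite gt_eqF.
have [y' y'E] : exists y', y' = (2 * form a y / form a a) *: a + (2 * form b y / form a a) *: b - y by eexists.
have E1 : form a y' = form a y by rewrite y'E !formlinE ab mulr0 addr0; field.
have E2 : form b y' = form b y by rewrite y'E !formlinE (formC b a) ab mulr0 add0r bb; field.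
have E3 : bmaj w x y' = form x y.
  rewrite /bmaj -/a -/b E1 E2 y'E !formlinE (formC x a) (formC x b).
  by field.
have E4 : maj w y' = maj w y.
  rewrite /maj -/a -/b E1 E2; have -> : form y' y' = form y y.
    rewrite {2}y'E !formlinE (formC y' a) (formC y' b) E1 E2 y'E !formlinE.
    by field.
  by [].
by rewrite -E3 -E4; exact: bmaj_CS.
Qed.

(** A complex factor rotates and rescales the basis of the plane, and the majorant depends on the
    plane alone. *)
Lemma majZ w c x : c != 0 -> Dc w -> maj (c *: w) x = maj w x.
Proof.
move=> c0 Hw; have /DcP[bb ab aa] := Hw.
have /DcP[_ _ aa'] := DcZ c0 Hw.
have sq (p q : R) (v u : VR) : form (p *: v + q *: u) (p *: v + q *: u) =
   p ^+ 2 * form v v + 2 * (p * q) * form v u + q ^+ 2 * form u u.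
  by rewrite !formlinE (formC u v); ring.
have ReZ : vRe (c *: w) = cRe c *: vRe w + (- cIm c) *: vIm w.
  by apply/rowP => i; rewrite !mxE cReM; ring.
have ImZ : vIm (c *: w) = cIm c *: vRe w + cRe c *: vIm w.
  by apply/rowP => i; rewrite !mxE cImM; ring.
have E : form (vRe (c *: w)) (vRe (c *: w)) =
   (cRe c ^+ 2 + cIm c ^+ 2) * form (vRe w) (vRe w).
  by rewrite ReZ sq bb ab; ring.
rewrite /maj E; rewrite E in aa'; rewrite ReZ ImZ !formlinE; congr (_ - _).
have n0 : cRe c ^+ 2 + cIm c ^+ 2 != 0.
  by rewrite -nrm_sq expf_neq0 // nrm_eq0.
by field; rewrite n0 gt_eqF.
Qed.

Lemma vRe_mul w (g : 'M[int]_17) : vRe (w *m ext g) = vRe w *m ext g.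
Proof.
apply/rowP => i; rewrite !mxE raddf_sum; apply: eq_bigr => j _.
by rewrite /= !mxE -(rmorph_int (@rc R)) cReM cRe_rc cIm_rc mulr0 subr0.
Qed.
Lemma vIm_mul w (g : 'M[int]_17) : vIm (w *m ext g) = vIm w *m ext g.
Proof.
apply/rowP => i; rewrite !mxE raddf_sum; apply: eq_bigr => j _.
by rewrite /= !mxE -(rmorph_int (@rc R)) cImM cRe_rc cIm_rc mulr0 add0r.
Qed.

Lemma maj_mul w g x : OT g -> maj (w *m ext g) (x *m ext g) = maj w x.
Proof. by move=> Og; rewrite /maj vRe_mul vIm_mul !isometry_form. Qed.

(** Coordinates are pairings with the vectors [dv k], up to the factor -2. The second factor of the
    bound depends on w only, so the bound can be made uniform near a point. *)
Lemma maj_co w x k : Dc w -> (k < 17)%N -> co k x ^+ 2 <= maj w x * maj w (ext (dv k)).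
Proof.
move=> Hw k17; apply: le_trans (maj_CS x (ext (dv k)) Hw).
rewrite form_dv //; case: ifP => _; first by rewrite mul1r.
by rewrite exprMn sqrrN -[leLHS]mul1r ler_wpM2r ?sqr_ge0 // -natrX ler1n.
Qed.

Lemma maj_eq0 w x : Dc w -> maj w x = 0 -> x = 0.
Proof.
move=> Hw e; apply: co_inj => k k17; rewrite co_0; apply/eqP.
by rewrite -sqrf_eq0 eq_le sqr_ge0 andbT; have := maj_co x Hw k17; rewrite e mul0r.
Qed.

(** In particular all roots orthogonal to w have majorant 2, whatever w is; this is the source of
    local finiteness. *)
Lemma maj_orth w (t : latT) : form w (ext t) = 0 -> maj w (ext t) = - (form t t)%:~R.
Proof.
rewrite -vrc_ext form_ReIm => E.
have := congr1 (@cRe R) E; have := congr1 (@cIm R) E.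
rewrite cRe_cxy cIm_cxy cRe0 cIm0 => h1 h2.
by rewrite /maj h1 h2 expr0n addr0 mulr0 mul0r sub0r form_ext.
Qed.

End RealImaginary.

Lemma form_sum (K : nzRingType) (x y : 'rV[K]_17) :
  form x y = \sum_i x 0 i * (\sum_j (gramT i j)%:~R * y 0 j).
Proof.
rewrite /form -mulmxA mxE; apply: eq_bigr => i _; rewrite mxE; congr (_ * _).
by apply: eq_bigr => j _; rewrite !mxE.
Qed.

Lemma near_finite (T : Type) (I : choiceType) (F : set_system T) (E : set I)
  (P : I -> T -> Prop) : Filter F -> finite_set E ->
  (forall i, E i -> \forall t \near F, P i t) ->
  \forall t \near F, forall i, E i -> P i t.
Proof.
move=> FF /finite_seqP[s ->] {E} H.
have {}H : forall i, i \in s -> \forall t \near F, P i t by move=> i si; apply: H.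
suff : \forall t \near F, forall i, i \in s -> P i t by apply: filterS => t.
elim: s H => [_|i s IH H]; first exact: nearW.
have h1 := H i (mem_head _ _).
have h2 : \forall t \near F, forall j, j \in s -> P j t.
  by apply: IH => j js; apply: H; rewrite inE js orbT.
apply: filterS2 h1 h2 => t p1 p2 j; rewrite inE => /orP[/eqP ->//|]; exact: p2.
Qed.

Lemma bounded_int_matrix_finite m n (K : nat) :
  finite_set [set A : 'M[int]_(m, n) | forall i j, `|A i j| <= K%:Z].
Proof.
pose f (B : 'M['I_(K.*2.+1)]_(m, n)) : 'M[int]_(m, n) :=
  map_mx (fun i : 'I_(K.*2.+1) => (i : nat)%:Z - K%:Z) B.
apply: (@sub_finite_set _ _ (f @` setT)); last exact/finite_image/finite_finset.
move=> A /= HA; exists (map_mx (fun z : int => inord (absz (z + K%:Z))) A) => //.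
apply/matrixP => i j; rewrite !mxE.
have := HA i j; rewrite ler_norml => /andP[h1 h2].
have h : (absz (A i j + K%:Z))%:Z = A i j + K%:Z.
  by rewrite gez0_abs // -lerBlDr sub0r.
rewrite inordK; first by rewrite h addrK.
rewrite ltnS -lez_nat h -addnn PoszD lerD2r //.
Qed.

(** * Local finiteness of roots and proper discontinuity *)

Section LocalFiniteness.
Variable R : realType.
Notation C := (CC R).
Notation VC := 'rV[CC R]_17.
Notation VR := 'rV[R]_17.

Lemma differentiable_fsum n (f : 'I_n -> VC -> C) (w : VC) :
  (forall i, differentiable (f i) w) -> differentiable (fun v => \sum_i f i v) w.
Proof.
move=> H; have -> : (fun v => \sum_i f i v) = \sum_i f i by apply/funext => v; rewrite fct_sumE.
exact: differentiable_sum.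
Qed.

Lemma form_differentiable (v w : VC) : differentiable (fun u : VC => form u v) w.
Proof.
under eq_fun do rewrite form_sum.
apply: differentiable_fsum => i; apply: differentiableM; first exact: differentiable_coord.
exact: differentiable_cst.
Qed.

Lemma mulmx_differentiable (A : 'M[C]_17) (w : VC) : differentiable (fun u : VC => u *m A) w.
Proof.
have -> : (fun u : VC => u *m A) = \sum_i (fun u : VC => u 0 i *: row i A).
  by apply/funext => u; rewrite fct_sumE mulmx_sum_row.
apply: differentiable_sum => i; apply: differentiableZl; exact: differentiable_coord.
Qed.

Lemma cRe_coord_continuous i : continuous (fun w : VC => cRe (w 0 i)).
Proof.
move=> w; apply: (@continuous_comp _ _ _ (fun w : VC => w 0 i) (@cRe R)).
  exact: coord_continuous.
exact: cRe_continuous.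
Qed.

Lemma continuous_rsum n (f : 'I_n -> VC -> R) :
  (forall i, continuous (f i)) -> continuous (fun w => \sum_i f i w).
Proof.
move=> H; apply: (@continuous_big R _ +%R 0 xpredT _ VC) => [|i _]; last exact: H.
by move=> p; apply: (@continuousD _ R _ fst snd); [exact: cvg_fst|exact: cvg_snd].
Qed.

Lemma vRe_form_continuous : continuous (fun w : VC => form (vRe w) (vRe w)).
Proof.
under eq_fun do rewrite form_sum.
have cRc i : continuous (fun w : VC => vRe w 0 i).
  by under eq_fun do rewrite mxE; exact: cRe_coord_continuous.
apply: continuous_rsum => i w; apply: (@continuousM R VC (fun w => vRe w 0 i)); first exact: cRc.
move: w; apply: continuous_rsum => j w.
by apply: (@continuousM R VC (fun _ => (gramT i j)%:~R)); [exact: cst_continuous|exact: cRc].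
Qed.

Lemma form_real_continuous x : continuous (fun w : VC => form (vRe w) x) /\
  continuous (fun w : VC => form (vIm w) x).
Proof.
have cf w : {for w, continuous (fun w : VC => form w (vrc x))}.
  exact: differentiable_continuous (form_differentiable _ _).
split.
  have -> : (fun w : VC => form (vRe w) x) = (@cRe R) \o (fun w : VC => form w (vrc x)).
    by apply/funext => w /=; rewrite form_ReIm cRe_cxy.
  by move=> w; apply: continuous_comp; [exact: cf|exact: cRe_continuous].
have -> : (fun w : VC => form (vIm w) x) = (@cRe R) \o (fun w : VC => - ii R * form w (vrc x)).
  by apply/funext => w /=; rewrite form_ReIm /cxy !cE; ring.
move=> w; apply: continuous_comp; last exact: cRe_continuous.
by apply: (@continuousM C VC (fun _ => - ii R)); [exact: cst_continuous|exact: cf].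
Qed.

Lemma maj_continuous (x : VR) (w0 : VC) : Dc w0 -> {for w0, continuous (fun w => maj w x)}.
Proof.
move=> /DcP[_ _ aa]; have [cRx cIx] := form_real_continuous x.
apply: (@continuousB _ R VC _ (fun _ => form x x)); last exact: cst_continuous.
apply: (@continuousM R VC (fun w => 2 * (form (vRe w) x ^+ 2 + form (vIm w) x ^+ 2))).
  apply: (@continuousM R VC (fun _ => 2)); first exact: cst_continuous.
  apply: (@continuousD _ R VC (fun w => form (vRe w) x ^+ 2) (fun w => form (vIm w) x ^+ 2)).
    by rewrite /GRing.exp /=; apply: (@continuousM R VC (fun w => form (vRe w) x) (fun w => form (vRe w) x)); exact: cRx.
  by rewrite /GRing.exp /=; apply: (@continuousM R VC (fun w => form (vIm w) x) (fun w => form (vIm w) x)); exact: cIx.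
by apply: continuousV; [rewrite gt_eqF|exact: vRe_form_continuous].
Qed.

Lemma maj_near (x : VR) (w0 : VC) : Dc w0 -> \forall w \near w0, maj w x < maj w0 x + 1.
Proof.
move=> Hw; have := @maj_continuous x w0 Hw.
move=> /(@cvgrPdistC_lt R R VC (nbhs w0) (nbhs_filter w0))/(_ 1 ltr01).
by apply: filterS => w /ltr_normlW; rewrite ltrBlDl addrC.
Qed.

Lemma co_bound_near (w0 : VC) : Dc w0 -> exists2 B : R, 0 < B &
  \forall w \near w0, Dc w -> forall (x : VR) k, (k < 17)%N -> co k x ^+ 2 <= maj w x * B.
Proof.
move=> Hw0; pose b (k : 'I_17) := maj w0 (ext (dv k)) + 1.
have b0 k : 0 < b k by rewrite ltr_wpDl ?ltr01 ?maj_ge0.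
exists (\sum_k b k).
  by rewrite big_ord_recl ltr_wpDr // sumr_ge0 // => k _; exact: ltW.
have H (k : 'I_17) : [set: 'I_17] k -> \forall w \near w0, maj w (ext (dv k)) < b k.
  by move=> _; exact: maj_near.
have := near_finite (nbhs_filter w0) finite_finset H.
apply: filterS => w Hw Dw x k k17; apply: le_trans (maj_co x Dw k17) _.
rewrite ler_wpM2l ?maj_ge0 //.
have /ltW/le_trans := Hw (Ordinal k17) I; apply.
by rewrite (bigD1 (Ordinal k17)) //= lerDl sumr_ge0 // => i _; exact: ltW.
Qed.

Lemma bounded_sq_finite m (B : R) :
  finite_set [set A : 'M[int]_(m, 17) | forall i j, ((A i j)%:~R : R) ^+ 2 <= B].
Proof.
pose K := Num.bound (Num.max B 0).
apply: sub_finite_set (@bounded_int_matrix_finite m 17 K) => A HA i j /=.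
have h : ((A i j)%:~R : R) ^+ 2 < K%:R.
  apply: le_lt_trans (HA i j) _; apply: le_lt_trans (archi_boundP _).
    by rewrite le_max lexx.
  by rewrite le_max lexx orbT.
have {}h : `|A i j| ^+ 2 < K%:Z.
  rewrite -(ltr_int R) rmorphXn /= intr_norm real_normK ?num_real //.
have [-> //|n0] := eqVneq (A i j) 0.
apply/ltW/(le_lt_trans _ h); rewrite expr2 ler_peMr //.
by rewrite -gtz0_ge1 normr_gt0.
Qed.

Lemma roots_near_finite (w0 : VC) (n : int) : Dc w0 -> exists2 E : set latT, finite_set E &
  \forall w \near w0, Dc w -> forall r : latT, form r r = n -> form (ext r) w = 0 -> E r.
Proof.
move=> Hw0; have [B B0 HB] := co_bound_near Hw0.
exists [set A : latT | forall i j, ((A i j)%:~R : R) ^+ 2 <= (- n)%:~R * B].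
  exact: bounded_sq_finite.
near=> w => Dw r rn rw i j; rewrite ord1.
have -> : r 0 j = co j r by rewrite /co inord_val.
have := (near HB w _) Dw (ext r) j (ltn_ord j); rewrite co_ext.
rewrite (@maj_orth _ w r); last by rewrite formC.
by rewrite rn rmorphN; apply.
Unshelve. all: by end_near.
Qed.

Lemma proportional_minors (u v : VC) : v != 0 ->
  (forall i j, u 0 i * v 0 j = u 0 j * v 0 i) -> exists c, u = c *: v.
Proof.
move=> v0 H; have /existsP[j vj] : [exists j, v 0 j != 0].
  rewrite -negb_forall; apply: contraNN v0 => /forallP h.
  by apply/eqP/rowP => j; rewrite mxE; apply/eqP; exact: h.
exists (u 0 j / v 0 j); apply/rowP => i; rewrite mxE.
by rewrite mulrAC -(H i j) mulfK.
Qed.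

Lemma ext_inj_mul (w : VC) g : g \in unitmx -> w != 0 -> w *m ext g != 0.
Proof.
move=> gu; apply: contraNneq => E.
by rewrite -(mulmx1 w) -(ext_unit R gu) mulmxA E mul0mx.
Qed.

(** If g carries w to a multiple of w', the majorant of row i of g at w' is that of [bv i] at w. For
    w and w' near w0 this bounds the entries of g, leaving finitely many candidates, and each
    candidate that does not stabilise the line of w0 is excluded on a smaller neighbourhood. *)
Lemma properly_discontinuous (w0 : VC) : Dc w0 -> exists W : set VC,
  [/\ open W, W w0 & forall w w' c g, W w -> W w' -> Dc w -> Dc w' -> OT g ->
     c != 0 -> w *m ext g = c *: w' -> exists2 d, d != 0 & w0 *m ext g = d *: w0].
Proof.
move=> Hw0; have [B B0 HB] := co_bound_near Hw0.
pose b (k : 'I_17) := maj w0 (ext (bv k)) + 1.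
pose M := \sum_k b k.
have b0 k : 0 < b k by rewrite ltr_wpDl ?ltr01 ?maj_ge0.
have Hb (k : 'I_17) : [set: 'I_17] k -> \forall w \near w0, maj w (ext (bv k)) < b k.
  by move=> _; exact: maj_near.
have {}Hb := near_finite (nbhs_filter w0) finite_finset Hb.
pose E := [set A : 'M[int]_17 | forall i j, ((A i j)%:~R : R) ^+ 2 <= M * B].
have Efin : finite_set E by exact: bounded_sq_finite.
pose S := [set g | OT g /\ exists2 d, d != 0 & w0 *m ext g = d *: w0].
have Hg (g : 'M[int]_17) : (E `&` OT `\` S) g ->
    \forall p \near (w0, w0), ~ exists c, p.1 *m ext g = c *: p.2.
  move=> [[_ Og] nS].
  have [i [j ij]] : exists i j, (w0 *m ext g) 0 i * w0 0 j - (w0 *m ext g) 0 j * w0 0 i != 0.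
    apply: contrapT => h; apply: nS; split=> //.
    have [|d Ed] := @proportional_minors (w0 *m ext g) w0 (Dc_neq0 Hw0).
      move=> i j; apply/eqP; rewrite -subr_eq0; apply: contraT => hij.
      by exfalso; apply: h; exists i, j.
    exists d => //; apply: contraNneq (ext_inj_mul Og.1 (Dc_neq0 Hw0)) => d0.
    by rewrite Ed d0 scale0r.
  (* A minor of the pair formed by the image of the first vector and the second one. It is nonzero
     at (w0, w0), hence nearby, where g cannot carry the one line to the other. *)
  pose mu (p : VC * VC) := (p.1 *m ext g) 0 i * p.2 0 j - (p.1 *m ext g) 0 j * p.2 0 i.
  have cg k : continuous (fun p : VC * VC => (p.1 *m ext g) 0 k).
    move=> p; apply: (@continuous_comp _ _ _ fst (fun w : VC => (w *m ext g) 0 k)); first exact: cvg_fst.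
    apply: (@continuous_comp _ _ _ (fun w : VC => w *m ext g) (fun w : VC => w 0 k)).
      exact: differentiable_continuous (mulmx_differentiable _ _).
    exact: coord_continuous.
  have c2 k : continuous (fun p : VC * VC => p.2 0 k).
    move=> p; apply: (@continuous_comp _ _ _ snd (fun w : VC => w 0 k)); first exact: cvg_snd.
    exact: coord_continuous.
  have cmu : {for (w0, w0), continuous mu}.
    by apply: continuousB; apply: continuousM; try exact: cg; exact: c2.
  have : \forall p \near (w0, w0), mu p != 0.
    apply: (@cvgr_neq0 C C _ (nbhs (w0, w0)) _ mu _ cmu ij).
  apply: filterS => p /eqP mup [c Ec]; apply: mup.
  by rewrite /mu Ec !mxE; ring.
have fin : finite_set (E `&` OT `\` S) by apply: sub_finite_set Efin => g [[]].
have := near_finite (nbhs_filter (w0, w0)) fin Hg.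
move=> [[/= U V] [/= nU nV] HUV].
have : nbhs w0 (U `&` V `&` [set w | Dc w -> forall (x : VR) k, (k < 17)%N -> co k x ^+ 2 <= maj w x * B]
   `&` [set w | forall k : 'I_17, [set: 'I_17] k -> maj w (ext (bv k)) < b k]).
  by repeat apply: filterI.
rewrite nbhsE => -[W [oW W0] HW]; exists W; split=> // w w' c g Ww Ww' Dw Dw' Og c0 Eg.
apply: contrapT => nS.
have [[[Uw _] _] bw] := HW _ Ww; have [[[_ Vw'] Bw'] _] := HW _ Ww'.
have Eg' : E g.
  move=> i j.
  have -> : ((g i j)%:~R : R) = co j (ext (bv i) *m ext g : VR).
    rewrite -extM co_ext /co inord_val; congr (_%:~R).
    rewrite mxE (bigD1 i) //= big1 ?addr0.
      by rewrite (_ : bv i 0 i = 1) ?mul1r //; have := @co_bv i i (ltn_ord i); rewrite /co inord_val eqxx.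
    move=> k ki; have := @co_bv k i (ltn_ord k); rewrite /co inord_val => ->.
    by rewrite (negbTE (_ : nat_of_ord k != i)) ?mul0r.
  apply: le_trans (Bw' Dw' _ j (ltn_ord j)) _.
  rewrite -(majZ _ c0 Dw') -Eg maj_mul // ler_pM2r //.
  have /ltW/le_trans := bw i I; apply.
  by rewrite /M (bigD1 i) //= lerDl sumr_ge0 // => k _; exact: ltW.
have := HUV (w, w') (conj Uw Vw') g; apply.
  by split=> // -[_ h]; exact: nS.
by exists c.
Qed.

End LocalFiniteness.

(** * Local geometry of the quotients *)

Section PeriodDomain.
Variable R : realType.
Notation C := (CC R).
Notation VC := 'rV[CC R]_17.
Implicit Types (w v : VC) (x y : D R).

Definition hx x : VC := hc (\val x).

Lemma Dc_hx x : Dc (hx x).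
Proof. by case: x => p Hp; have := set_mem Hp. Qed.

Lemma coords_hx x : coords (hx x) x.
Proof. by exists 1; rewrite ?oner_neq0 ?scale1r. Qed.

Lemma coordsZ c w x : c != 0 -> coords w x -> coords (c *: w) x.
Proof. by move=> c0 [d d0 ->]; exists (c * d); rewrite ?mulf_neq0 // scalerA. Qed.

Lemma coords_Dc w x : coords w x -> Dc w.
Proof. by move=> [c c0 ->]; apply: DcZ => //; exact: Dc_hx. Qed.

Lemma coords_inj w x y : coords w x -> coords w y -> x = y.
Proof.
move=> [c c0 E] [d d0 F]; apply: (@hc_inj R x y (d^-1 * c)).
  by rewrite mulf_neq0 ?invr_eq0.
by rewrite -scalerA -E F scalerA mulVf // scale1r.
Qed.

Lemma hc_pi (v : nzVC R) : exists2 c : C, c != 0 & \val v = c *: hc (\pi_(PT R) v).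
Proof.
have /eqmodP/asboolP[c c0 E] := reprK (\pi_(PT R) v).
by exists c.
Qed.

Lemma coords_ex w : Dc w -> exists x, coords w x.
Proof.
move=> Hw; pose v : nzVC R := exist _ w (mem_set (Dc_neq0 Hw)).
have [c c0 E] := hc_pi v.
have vE : \val v = w by [].
have Hp : Dset (\pi_(PT R) v).
  suff : Dc (hc (\pi_(PT R) v)) by [].
  have -> : hc (\pi_(PT R) v) = c^-1 *: w by rewrite -vE E scalerA mulVf // scale1r.
  by apply: DcZ; rewrite ?invr_eq0.
exists (exist _ (\pi_(PT R) v) (mem_set Hp)); exists c => //.
Qed.

(** The topology of D is that of a subspace of a quotient, and [hx] is an arbitrary choice of
    representative; homogeneity of W is what makes the choice irrelevant. *)
Lemma cone_open (W : set VC) : open W -> (forall c w, c != 0 -> W w -> W (c *: w)) ->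
  open [set x : D R | W (hx x)].
Proof.
move=> oW cW.
exists [set p : PT R | W (hc p)]; last by [].
rewrite /open /= /quotient_open /=.
exists W => //; apply/seteqP; split => v /=; have [c c0 E] := hc_pi v.
  move=> Wv; have -> : hc (\pi_(PT R) v) = c^-1 *: \val v by rewrite E scalerA mulVf // scale1r.
  by apply: cW; rewrite ?invr_eq0.
by move=> Wh; rewrite -[set_val v]/(\val v) E; exact: cW.
Qed.

Lemma open_coords (O : set (D R)) w x : open O -> O x -> coords w x ->
  \forall v \near w, forall y, coords v y -> O y.
Proof.
case=> O1 oO1 EO Ox wx.
have := oO1; rewrite /open /= /quotient_open /= => -[W oW EW].
have Wc v y : coords v y -> W v <-> O y.
  move=> vy; have v0 := Dc_neq0 (coords_Dc vy).
  pose u : nzVC R := exist _ v (mem_set v0).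
  have -> : W v = ((set_val @^-1` W) u) by [].
  rewrite EW -EO /=.
  suff -> : \pi_(PT R) u = \val y by [].
  have [c c0 E] := hc_pi u; have [d d0 F] := vy.
  rewrite -[RHS]reprK; apply/eqmodP/asboolP; exists d^-1; first by rewrite invr_eq0.
  by rewrite (_ : \val u = v) // F scalerA mulVf // scale1r.
have : nbhs w W by apply: open_nbhs_nbhs; split=> //; apply/(Wc _ _ wx).
by apply: filterS => v Wv y /Wc <-.
Qed.

End PeriodDomain.

(** * Local equations on the cone over the period domain *)

Section LocallyAnalytic.
Variable R : realType.
Notation C := (CC R).
Notation VC := 'rV[CC R]_17.
Implicit Types (w v : VC) (x y : D R) (Y : set VC).

Lemma nbhsW w (P : VC -> Prop) : (forall v, P v) -> \forall v \near w, P v.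
Proof. by move=> H; apply: (@filterS _ (nbhs w) (nbhs_filter w) setT P) => //; exact: filterT. Qed.

(** The equations are differentiable on an open set of the ambient space, but describe Y only at
    points of the cone. An arbitrary finite index type lets intersections and unions use sums and
    products of index types. *)
Definition ana_at Y w := exists (I : finType) (F : I -> VC -> C),
  \forall v \near w, (forall i, differentiable (F i) v) /\
    (Dc v -> (Y v <-> forall i, F i v = 0)).

Definition locana Y := forall w, Dc w -> ana_at Y w.

Lemma ana_at_near Y Y' w : (\forall v \near w, Dc v -> (Y v <-> Y' v)) ->
  ana_at Y w -> ana_at Y' w.
Proof.
move=> H [I [F HF]]; exists I, F; apply: filterS2 H HF => v e [d h].
by split=> // Dv; rewrite -(e Dv); exact: h.
Qed.

Lemma ana_at_set0 w : ana_at set0 w.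
Proof.
exists unit, (fun _ => cst 1); apply: nbhsW => v; split=> [_|_]; first exact: differentiable_cst.
by split=> // /(_ tt) /eqP; rewrite oner_eq0.
Qed.

Lemma ana_atI Y Y' w : ana_at Y w -> ana_at Y' w -> ana_at (Y `&` Y') w.
Proof.
move=> [I [F HF]] [J [F' HF']].
exists (I + J)%type, (fun k => match k with inl i => F i | inr j => F' j end).
apply: filterS2 HF HF' => v [d h] [d' h']; split=> [[i|j]|Dv] //.
have {}h := h Dv; have {}h' := h' Dv; split.
  by move=> [/h a /h' b] [i|j].
by move=> a; split; [apply/h => i; exact: (a (inl i))|apply/h' => j; exact: (a (inr j))].
Qed.

Lemma ana_atU Y Y' w : ana_at Y w -> ana_at Y' w -> ana_at (Y `|` Y') w.
Proof.
move=> [I [F HF]] [J [F' HF']].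
exists (I * J)%type, (fun k v => F k.1 v * F' k.2 v).
apply: filterS2 HF HF' => v [d h] [d' h']; split=> [[i j]|Dv] /=.
  by apply: differentiableM.
have {}h := h Dv; have {}h' := h' Dv; split.
  by move=> [/h a|/h' a] [i j] /=; rewrite a ?mul0r ?mulr0.
move=> a; apply: contrapT => /not_orP[n n'].
have [i Fi] : exists i, F i v != 0.
  by apply: contrapT => /forallNP b; apply/n/h => i; apply/eqP/negPn/negP/b.
have [j Fj] : exists j, F' j v != 0.
  by apply: contrapT => /forallNP b; apply/n'/h' => j; apply/eqP/negPn/negP/b.
by have /eqP := a (i, j); rewrite mulf_eq0 (negbTE Fi) (negbTE Fj).
Qed.

Lemma ana_at_bigcup (T : choiceType) (E : set T) (Y : T -> set VC) w : finite_set E ->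
  (forall t, E t -> ana_at (Y t) w) -> ana_at (\bigcup_(t in E) Y t) w.
Proof.
move=> /finite_seqP[s ->] {E}; elim: s => [_|t s IH H].
  by apply: ana_at_near (ana_at_set0 w); apply: nbhsW => v _; split=> // -[t].
have h1 : ana_at (Y t) w by apply: H; rewrite /= mem_head.
have h2 : ana_at (\bigcup_(t in [set` s]) Y t) w.
  by apply: IH => u us; apply: H; rewrite /= inE us orbT.
apply: ana_at_near (ana_atU h1 h2); apply: nbhsW => v _; split.
  by move=> [a|[u us a]]; [exists t; rewrite /= ?mem_head|exists u; rewrite //= inE us orbT].
by move=> [u /=]; rewrite inE => /orP[/eqP -> a|us a]; [left|right; exists u].
Qed.

Lemma ana_at_form v w : ana_at [set u | form u v = 0] w.
Proof.
exists unit, (fun _ u => form u v); apply: nbhsW => u; split=> [_|_].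
  exact: form_differentiable.
by split=> // /(_ tt).
Qed.

(** The eigenvalue is eliminated: u is an eigenvector of g exactly when the 2 by 2 minors of u g and
    u vanish. *)
Lemma ana_at_fixed (g : 'M[int]_17) w : OT g ->
  ana_at [set u | exists2 c, c != 0 & u *m ext g = c *: u] w.
Proof.
move=> Og.
exists ('I_17 * 'I_17)%type, (fun k u => (u *m ext g) 0 k.1 * u 0 k.2 - (u *m ext g) 0 k.2 * u 0 k.1).
apply: nbhsW => u; split=> [[i j]|Du] /=.
  have dg k : differentiable (fun u : VC => (u *m ext g) 0 k) u.
    apply: (@differentiable_comp _ _ _ _ (fun u : VC => u *m ext g) (fun v : VC => v 0 k)).
      exact: mulmx_differentiable.
    exact: differentiable_coord.
  by apply: differentiableB; apply: differentiableM; [exact: dg|exact: differentiable_coord|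
    exact: dg|exact: differentiable_coord].
split=> [[c c0 ->] [i j]|H]; first by rewrite !mxE /=; ring.
have [|c Ec] := @proportional_minors R (u *m ext g) u (Dc_neq0 Du).
  by move=> i j; apply/eqP; rewrite -subr_eq0; apply/eqP; exact: (H (i, j)).
exists c => //; apply: contraNneq (ext_inj_mul Og.1 (Dc_neq0 Du)) => c0.
by rewrite Ec c0 scale0r.
Qed.

Variable G : matgroup.
Hypothesis GO : mg_set G `<=` @OT.

Definition lift (Z : set (DQ R G)) : set VC :=
  [set w | exists2 x, coords w x & Z (orb G x)].

Lemma lift_coords Z w x : coords w x -> lift Z w <-> Z (orb G x).
Proof.
by move=> wx; split=> [[y wy]|h]; [rewrite (coords_inj wx wy)|exists x].
Qed.

Lemma orb_coords x y g c : mg_set G g -> c != 0 -> hx x *m ext g = c *: hx y ->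
  orb G x = orb G y.
Proof. by move=> Gg c0 E; apply/orbP/asboolP; exists g => //; exists c. Qed.

Lemma orb_coordsP x y : orb G x = orb G y ->
  exists2 g, mg_set G g & exists2 c, c != 0 & hx x *m ext g = c *: hx y.
Proof. by move=> /orbP/asboolP. Qed.

Lemma orb_surj q : exists x, orb G x = q.
Proof. by exists (repr q); rewrite /orb reprK. Qed.

(** Holomorphy on the quotient provides functions only near the chosen representative [hx x]; they
    are transported to w0 = c [hx x] by composing with multiplication by the inverse of c. *)
Lemma locana_lift Z : analytic_set Z -> locana (lift Z).
Proof.
move=> HZ w0 Dw0; have [x w0x] := coords_ex Dw0.
have [U [n [f [oU Ux hf HU]]]] := HZ (orb G x).
have [c c0 Ec] := w0x.
have nU := @open_coords R (orb G @^-1` U) w0 x oU Ux w0x.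
have loc i : exists F : VC -> C, \forall v \near w0, differentiable F v /\
    forall y, coords v y -> U (orb G y) -> f i (orb G y) = F v.
  have [W [F [oW Wx dF hF]]] := hf i x Ux.
  exists (fun v => F (c^-1 *: v)).
  have cW : \forall v \near w0, W (c^-1 *: v).
    have cs : {for w0, continuous (fun v : VC => c^-1 *: v)} by exact: scaler_continuous.
    apply: cs; apply: open_nbhs_nbhs; split=> //.
    by rewrite Ec scalerA mulVf // scale1r.
  apply: filterS cW => v Wv; split.
    apply: (@differentiable_comp _ _ _ _ (fun v : VC => c^-1 *: v) F); last exact: dF.
    by apply: differentiableZ; exact: ex_diff.
  move=> y vy Uy; have := hF y (c^-1 *: v) Uy Wv; rewrite /=; apply.
  by apply: coordsZ; rewrite ?invr_eq0.
have [F HF] := choice loc.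
exists 'I_n, F.
have {}HF := near_finite (nbhs_filter w0) (@finite_finset _ [set: 'I_n]) (fun i _ => HF i).
apply: filterS2 nU HF => v Uv HF; split=> [i|Dv]; first by have [] := HF i I.
have [y vy] := coords_ex Dv; have Uy := Uv y vy.
rewrite (lift_coords Z vy) (HU _ Uy); split=> H i.
  by have [_ /(_ y vy Uy) <-] := HF i I.
by have [_ /(_ y vy Uy) ->] := HF i I.
Qed.

End LocallyAnalytic.

(** * Symmetric functions of local equations *)

Section Symmetrization.
Variable R : realType.
Notation C := (CC R).
Notation VC := 'rV[CC R]_17.

Lemma coef_prod_differentiable (T : eqType) (s : seq T) (a : T -> VC -> C) w k :
  (forall t, t \in s -> differentiable (a t) w) ->
  differentiable (fun v => (\prod_(t <- s) ('X - (a t v)%:P))`_k) w.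
Proof.
elim: s k => [|t s IH] k H.
  by under eq_fun do rewrite big_nil; exact: differentiable_cst.
have dt : differentiable (a t) w by apply: H; rewrite mem_head.
have {}IH j : differentiable (fun v => (\prod_(t <- s) ('X - (a t v)%:P))`_j) w.
  by apply: IH => u us; apply: H; rewrite inE us orbT.
under eq_fun do rewrite big_cons mulrBl coefB coefXM coefCM.
apply: differentiableB; last by apply: differentiableM.
by case: k => [|k] /=; [exact: differentiable_cst|exact: IH].
Qed.

(** A monic polynomial with no other nonzero coefficient is a power of X, whose only root is 0. The
    constant coefficient alone, the product, vanishes as soon as one value does; for several
    equations the vanishing factors could belong to different group elements, and too large a set
    would be cut out. *)
Lemma coef_prod_eq0 (s : seq C) :
  (forall k, (k < size s)%N -> (\prod_(a <- s) ('X - a%:P))`_k = 0) <->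
  (forall a, a \in s -> a = 0).
Proof.
set P := \prod_(a <- s) _.
have sP : size P = (size s).+1 by rewrite size_prod_XsubC.
split=> [H a sa|H k ks].
  have /eqP : root P a by rewrite root_prod_XsubC.
  rewrite horner_coef sP big_ord_recr /= big1 ?add0r; last by move=> i _; rewrite H ?mul0r.
  have -> : P`_(size s) = 1.
    by have /monicP := @monic_prod_XsubC C C s xpredT id; rewrite lead_coefE sP.
  by rewrite mul1r => /eqP; rewrite expf_eq0 => /andP[_ /eqP].
have -> : P = 'X^(size s).
  rewrite /P (eq_big_seq (fun _ => 'X)); first by rewrite big_const_seq count_predT iter_mulr_1.
  by move=> a /H ->; rewrite subr0.
by rewrite coefXn ltn_eqF.
Qed.

End Symmetrization.

(** * Descent of analytic sets to the quotient *)

Section Descent.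
Variable R : realType.
Notation C := (CC R).
Notation VC := 'rV[CC R]_17.
Implicit Types (w v : VC) (x y : D R) (Y : set VC).
Variable G : matgroup.
Hypothesis GO : mg_set G `<=` @OT.

Definition stab w : set 'M[int]_17 :=
  [set g | mg_set G g /\ exists2 c, c != 0 & w *m ext g = c *: w].

Lemma stab_finite w : Dc w -> finite_set (stab w).
Proof.
move=> Dw; have [B B0 HB] := co_bound_near Dw.
have {}HB := nbhs_singleton HB Dw.
pose M := \sum_(k < 17) maj w (ext (bv k)).
apply: sub_finite_set (@bounded_sq_finite R 17 (M * B)) => g [Gg [c c0 Eg]] i j /=.
have -> : ((g i j)%:~R : R) = co j (ext (bv i) *m ext g : 'rV[R]_17).
  rewrite -extM co_ext /co inord_val; congr (_%:~R).
  rewrite mxE (bigD1 i) //= big1 ?addr0.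
    by rewrite (_ : bv i 0 i = 1) ?mul1r //; have := @co_bv i i (ltn_ord i); rewrite /co inord_val eqxx.
  move=> k ki; have := @co_bv k i (ltn_ord k); rewrite /co inord_val => ->.
  by rewrite (negbTE (_ : nat_of_ord k != i)) ?mul0r.
apply: le_trans (HB _ j (ltn_ord j)) _.
rewrite -(majZ _ c0 Dw) -Eg maj_mul; last exact: GO.
rewrite ler_pM2r // /M (bigD1 i) //= lerDl sumr_ge0 // => k _; exact: maj_ge0.
Qed.

Definition invariant_cone Y :=
  (forall c w, c != 0 -> Dc w -> Y w -> Y (c *: w)) /\
  (forall g w, mg_set G g -> Dc w -> Y w -> Y (w *m ext g)).

Lemma ana_open_nbhd Y w : ana_at Y w -> exists (W : set VC) (I : finType) (F : I -> VC -> C),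
  [/\ open W, W w, forall i v, W v -> differentiable (F i) v &
   forall v, W v -> Dc v -> (Y v <-> forall i, F i v = 0)].
Proof.
move=> [I [F HF]].
have : nbhs w [set v | (forall i, differentiable (F i) v) /\
    (Dc v -> (Y v <-> forall i, F i v = 0))] by exact: HF.
rewrite nbhsE => -[W [oW Ww] HW]; exists W, I, F; split=> //.
  by move=> i v /HW[].
by move=> v /HW[].
Qed.

Lemma ext_mulV w g : mg_set G g -> w *m ext g *m ext (invmx g) = w.
Proof. by move=> /mg_unit gu; rewrite -mulmxA ext_unit // mulmx1. Qed.

(* the affine chart of the projective space in which w0 is its own
   representative *)
Definition affine_scale w0 v : C :=
  form v (map_mx Num.conj w0) / form w0 (map_mx Num.conj w0).
Definition normalize w0 v : VC := (affine_scale w0 v)^-1 *: v.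

Lemma affine_scale_self w0 : Dc w0 -> affine_scale w0 w0 = 1.
Proof. by move=> [_ /lt0r_neq0 h0]; rewrite /affine_scale divff. Qed.
Lemma affine_scaleZ w0 c v : affine_scale w0 (c *: v) = c * affine_scale w0 v.
Proof. by rewrite /affine_scale formZl mulrA. Qed.
Lemma normalizeZ w0 c v : c != 0 -> normalize w0 (c *: v) = normalize w0 v.
Proof.
move=> c0; rewrite /normalize affine_scaleZ scalerA invfM mulrAC mulVf //.
by rewrite mul1r.
Qed.
Lemma affine_scale_differentiable w0 v : differentiable (affine_scale w0) v.
Proof.
by apply: differentiableM; [exact: form_differentiable|exact: differentiable_cst].
Qed.
Lemma normalize_differentiable w0 v : affine_scale w0 v != 0 ->
  differentiable (normalize w0) v.
Proof.
move=> l0.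
have -> : normalize w0 = \sum_(i < 17)
    (fun u : VC => ((affine_scale w0 u)^-1 * u 0 i) *: delta_mx 0 i).
  apply/funext => u; rewrite fct_sumE /normalize {2}(row_sum_delta u) scaler_sumr.
  by apply: eq_bigr => i _; rewrite scalerA.
apply: differentiable_sum => i; apply: differentiableZl.
apply: differentiableM; last exact: differentiable_coord.
by apply: differentiableV => //; exact: affine_scale_differentiable.
Qed.

(** Normalised in an affine chart at w0, the local equations become homogeneous of degree 0; their
    elementary symmetric functions over the stabiliser of w0 still define Y, because Y is invariant.
    By proper discontinuity they are constant on the part of any orbit of G close to w0, hence
    functions on the quotient. *)
Lemma descent Y : invariant_cone Y -> locana Y ->
  analytic_set (orb G @` [set x : D R | Y (hx x)]).
Proof.
move=> [Yc Yg] HY p; set Z := orb G @` _.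
have ZY y w : coords w y -> Z (orb G y) <-> Y w.
  move=> wy; have [c c0 Ew] := wy; have Dw := coords_Dc wy; split.
    move=> [x Yx /orb_coordsP[g Gg [d d0 E]]].
    have -> : w = (c * d^-1) *: (hx x *m ext g).
      by rewrite E scalerA -mulrA mulVf // mulr1.
    apply: Yc; [by rewrite mulf_neq0 ?invr_eq0|apply: Dc_mul (GO Gg) (Dc_hx x)|].
    exact: Yg Gg (Dc_hx x) Yx.
  move=> Yw; exists y => //=; have -> : hx y = c^-1 *: w.
    by rewrite Ew scalerA mulVf // scale1r.
  by apply: Yc; rewrite ?invr_eq0.
have [x0 x0p] := orb_surj p; pose w0 := hx x0; have Dw0 : Dc w0 := Dc_hx x0.
have [W1 [I [F [oW1 W1w0 dF HF]]]] := ana_open_nbhd (HY w0 Dw0).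
have [W2 [oW2 W2w0 HW2]] := properly_discontinuous Dw0.
have [s0 Es0] := (finite_seqP _).1 (stab_finite Dw0).
pose s := undup s0.
have sP g : g \in s <-> stab w0 g by rewrite mem_undup Es0.
have s1 : 1%:M \in s.
  by apply/sP; split; [exact: mg_1|exists 1; rewrite ?oner_neq0 // ext1 mulmx1 scale1r].
have sM g h : g \in s -> h \in s -> g *m h \in s.
  move=> /sP[Gg [c c0 Ec]] /sP[Gh [d d0 Ed]]; apply/sP; split; first exact: mg_mul.
  exists (c * d); first by rewrite mulf_neq0.
  by rewrite extM mulmxA Ec -scalemxAl Ed scalerA.
have sperm h : h \in s -> perm_eq [seq h *m g | g <- s] s.
  move=> hs; have hu : h \in unitmx by move/sP: hs => [/mg_unit].
  have inj : injective (fun g : 'M[int]_17 => h *m g).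
    by move=> a b /(congr1 (mulmx (invmx h))); rewrite !mulmxA mulVmx // !mul1mx.
  have un : uniq [seq h *m g | g <- s] by rewrite (map_inj_uniq inj) undup_uniq.
  have [|_ Em] := @uniq_min_size _ [seq h *m g | g <- s] s un _ (eq_leq (esym (size_map _ _))).
    by move=> _ /mapP[g gs ->]; exact: sM.
  by apply: uniq_perm; rewrite ?undup_uniq.
pose lam := affine_scale w0; pose nm := normalize w0.
have lam0 : lam w0 = 1 by exact: affine_scale_self.
have lamZ c v : lam (c *: v) = c * lam v by exact: affine_scaleZ.
have nmZ c v : c != 0 -> nm (c *: v) = nm v by exact: normalizeZ.
have dlam v : differentiable lam v by exact: affine_scale_differentiable.
have dnm v : lam v != 0 -> differentiable nm v by exact: normalize_differentiable.
have nmE v : nm v = (lam v)^-1 *: v by [].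
(* The chart is made opaque: from here on only the properties just listed are used. *)
have [lam' lamE] : exists l, l = lam by exists lam.
have [nm' nm'E] : exists l, l = nm by exists nm.
rewrite -lamE -nm'E in lam0 lamZ nmZ dlam dnm nmE; clear lam nm lamE nm'E.
rename lam' into lam; rename nm' into nm.
(* The points all of whose translates by the stabiliser normalise into the good neighbourhoods; V is
   a cone and so describes an open set of D. *)
pose V := [set v | forall g, g \in s ->
  lam (v *m ext g) != 0 /\ (W1 `&` W2) (nm (v *m ext g))].
have V0 : V w0.
  move=> g /sP[Gg [c c0 Ec]]; rewrite Ec lamZ lam0 mulr1 nmZ // nmE lam0 invr1 scale1r.
  by split.
have oV : open V.
  rewrite openE => v Vv; rewrite /interior.
  have fs : finite_set [set` s] by apply/finite_seqP; exists s.
  have := @near_finite VC _ (nbhs v) [set` s] (fun g u =>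
     lam (u *m ext g) != 0 /\ (W1 `&` W2) (nm (u *m ext g))) (nbhs_filter v) fs.
  apply=> g gs; have [l0 Wn] := Vv g gs.
  have cg : {for v, continuous (fun u : VC => u *m ext g)}.
    exact: differentiable_continuous (mulmx_differentiable _ _).
  have c1 : {for v, continuous (fun u : VC => lam (u *m ext g))}.
    have cl : {for (v *m ext g), continuous lam} by exact: differentiable_continuous (dlam _).
    exact: (@continuous_comp VC VC C (fun u : VC => u *m ext g) lam v cg cl).
  have c2 : {for v, continuous (fun u : VC => nm (u *m ext g))}.
    have cn : {for (v *m ext g), continuous nm} by exact: differentiable_continuous (dnm _ l0).
    exact: (@continuous_comp VC VC VC (fun u : VC => u *m ext g) nm v cg cn).
  have n1 := @cvgr_neq0 C C VC (nbhs v) (nbhs_filter v) _ _ c1 l0.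
  have n2 : \forall u \near v, (W1 `&` W2) (nm (u *m ext g)).
    by apply: c2; apply: open_nbhs_nbhs; split=> //; exact: openI.
  exact: filterS2 n1 n2.
have Vc c v : c != 0 -> V v -> V (c *: v).
  move=> c0 Vv g gs; have [l0 Wn] := Vv g gs.
  by rewrite -scalemxAl lamZ nmZ // mulf_neq0.
have V1 v : V v -> lam v != 0 /\ (W1 `&` W2) (nm v).
  by move=> /(_ _ s1); rewrite ext1 mulmx1.
(* The degree runs below [size s], which leaves out the leading coefficient 1. *)
pose E (k : I * 'I_(size s)) v :=
  (\prod_(g <- s) ('X - (F k.1 (nm (v *m ext g)))%:P))`_k.2.
have dE k v : V v -> differentiable (E k) v.
  move=> Vv; apply: coef_prod_differentiable => g gs; have [l0 [w1 w2]] := Vv g gs.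
  apply: (@differentiable_comp _ _ _ _ (fun u : VC => nm (u *m ext g)) (F k.1)); last exact: dF.
  apply: (@differentiable_comp _ _ _ _ (fun u : VC => u *m ext g) nm); last exact: dnm.
  exact: mulmx_differentiable.
have EZ k c v : c != 0 -> E k (c *: v) = E k v.
  by move=> c0; rewrite /E; under eq_bigr do rewrite -scalemxAl nmZ //.
have Es k h v : h \in s -> E k (v *m ext h) = E k v.
  move=> hs; rewrite /E -[in RHS](perm_big _ (sperm h hs)) big_map.
  by under eq_bigr do rewrite -mulmxA -extM.
have E0 v : V v -> Dc v -> (forall k, E k v = 0) <-> Y v.
  move=> Vv Dv.
  have Yn g : g \in s -> Y v <-> forall i, F i (nm (v *m ext g)) = 0.
    move=> gs; have [l0 [w1 w2]] := Vv g gs; have /sP[Gg _] := gs.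
    have Dvg : Dc (v *m ext g) by apply: Dc_mul => //; exact: GO.
    have Dn : Dc (nm (v *m ext g)) by rewrite nmE; apply: DcZ; rewrite ?invr_eq0.
    apply: iff_trans (HF _ w1 Dn).
    split=> [Yv|Yn]; first by rewrite nmE; apply: Yc (Yg g v Gg Dv Yv); rewrite ?invr_eq0.
    rewrite -(ext_mulV v Gg); apply: (Yg (invmx g)) => //; first exact: mg_inv.
    have -> : v *m ext g = lam (v *m ext g) *: nm (v *m ext g).
      by rewrite nmE scalerA divff // scale1r.
    exact: Yc.
  split=> [H|Yv [i k]].
    apply/(Yn _ s1) => i.
    have := (@coef_prod_eq0 R [seq F i (nm (v *m ext g)) | g <- s]).1; apply.
      move=> k; rewrite size_map => ks; rewrite big_map; exact: (H (i, Ordinal ks)).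
    by apply/mapP; exists 1%:M.
  have := (@coef_prod_eq0 R [seq F i (nm (v *m ext g)) | g <- s]).2.
  rewrite size_map big_map => H; apply: (H _ k (ltn_ord k)).
  by move=> _ /mapP[g gs ->]; exact: ((Yn g gs).1 Yv).
pose U := orb G @` [set y | V (hx y)].
have UP y : U (orb G y) <-> exists2 g, mg_set G g & V (hx y *m ext g).
  split=> [[x Vx /esym/orb_coordsP[g Gg [c c0 Ec]]]|[g Gg Vg]].
    by exists g => //; rewrite Ec; exact: Vc.
  have Dg : Dc (hx y *m ext g) by apply: Dc_mul (GO Gg) (Dc_hx y).
  have [x [c c0 Ex]] := coords_ex Dg; exists x => /=.
    have -> : hx x = c^-1 *: (hx y *m ext g) by rewrite Ex scalerA mulVf // scale1r.
    by apply: Vc; rewrite ?invr_eq0.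
  exact/esym/(orb_coords Gg c0 Ex).
have oVg g : open [set v : VC | V (v *m ext g)].
  have /continuousP := fun v : VC => differentiable_continuous (mulmx_differentiable (ext g) v).
  exact.
have oU : open U.
  rewrite /open /= /quotient_open /=.
  have -> : \pi_(DQ R G) @^-1` U = \bigcup_(g in mg_set G) [set y : D R | V (hx y *m ext g)].
    apply/seteqP; split => y /=; first by move/UP.
    by move=> [g Gg Vg]; apply/UP; exists g.
  apply: bigcup_open => g Gg; apply: (@cone_open R [set v : VC | V (v *m ext g)]); first exact: oVg.
  by move=> c v c0 Vv /=; rewrite -scalemxAl; exact: Vc.
pose f k (q : DQ R G) : C := if pselect (exists2 y, orb G y = q & V (hx y)) is left h
   then E k (hx (projT1 (cid2 h))) else 0.
(* Independence of the representative chosen in f: two points of V in one orbit have normalised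
   coordinates in W2, so the element joining them stabilises the line of w0, and E does not change
   under it. *)
have fE k y w : V w -> coords w y -> f k (orb G y) = E k w.
  move=> Vw wy; have [c c0 Ew] := wy.
  have Ey : hx y = c^-1 *: w by rewrite Ew scalerA mulVf // scale1r.
  have Vy : V (hx y) by rewrite Ey; apply: Vc; rewrite ?invr_eq0.
  have -> : E k w = E k (hx y) by rewrite Ew EZ.
  rewrite /f; case: pselect => [h|[]]; last by exists y.
  case: cid2 => z /= zy Vz.
  have /orb_coordsP[g Gg [d d0 Eg]] := zy.
  have [lz [_ W2z]] := V1 _ Vz; have [ly [_ W2y]] := V1 _ Vy.
  have [] := HW2 (nm (hx z)) (nm (hx y)) (d * (lam (hx z))^-1 * lam (hx y)) g W2z W2y.
  - by rewrite nmE; apply: DcZ; [rewrite invr_eq0|exact: Dc_hx].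
  - by rewrite nmE; apply: DcZ; [rewrite invr_eq0|exact: Dc_hx].
  - exact: GO.
  - by rewrite !mulf_neq0 ?invr_eq0.
  - by rewrite !nmE -scalemxAl Eg !scalerA; congr (_ *: _); field; rewrite ly lz.
  move=> d' d'0 Ed'; have gs : g \in s by apply/sP; split=> //; exists d'.
  by rewrite -(Es k g _ gs) Eg EZ.
exists U, #|{: I * 'I_(size s)}|, (fun i => f (enum_val i)); split=> //.
- by rewrite -x0p; exists x0.
- move=> i y /= Uy; have [g Gg Vg] := (UP y).1 Uy.
  exists [set v : VC | V (v *m ext g)], (fun v => E (enum_val i) (v *m ext g)); split=> //.
  + move=> v Vv; apply: (@differentiable_comp _ _ _ _ (fun u : VC => u *m ext g) (E (enum_val i))).
      exact: mulmx_differentiable.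
    exact: dE.
  + move=> z v Uz Vv vz /=.
    have Dv := coords_Dc vz.
    have Dvg : Dc (v *m ext g) by apply: Dc_mul => //; exact: GO.
    have [z' z'v] := coords_ex Dvg.
    rewrite -(fE _ z' _ Vv z'v); congr (f _ _).
    have [c c0 Ec] := vz; have [d d0 Ed] := z'v.
    apply: (@orb_coords R G z z' g (c^-1 * d) Gg); first by rewrite mulf_neq0 ?invr_eq0.
    by rewrite -scalerA -Ed Ec -scalemxAl scalerA mulVf // scale1r.
- move=> q [y Vy <-]; rewrite (ZY y (hx y) (coords_hx y)) -(E0 _ Vy (Dc_hx y)).
  split=> H k; first by rewrite (fE _ y (hx y)) //; exact: coords_hx.
  by rewrite -(fE k y (hx y) Vy (coords_hx y)) -[k]enum_rankK; exact: H.
Qed.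

End Descent.

(** * The tube domain *)

Section Tube.
Variable R : realType.
Notation C := (CC R).
Notation VC := 'rV[CC R]_17.
Notation VR := 'rV[R]_17.
Implicit Types (w v z : VC) (y : VR).

Lemma co_vIm k w : co k (vIm w) = cIm (co k w). Proof. by rewrite /co mxE. Qed.
Lemma co_vRe k w : co k (vRe w) = cRe (co k w). Proof. by rewrite /co mxE. Qed.

Lemma form_bv0 (K : comNzRingType) (x : 'rV[K]_17) : form x (ext (bv 0)) = co 1 x.
Proof. by rewrite -[bv 0]/(dv 1) form_dv ?mul1r. Qed.
Lemma form_bv1 (K : comNzRingType) (x : 'rV[K]_17) : form x (ext (bv 1)) = co 0 x.
Proof. by rewrite -[bv 1]/(dv 0) form_dv ?mul1r. Qed.

Lemma form_bvv k : (k < 2)%N -> form (bv k) (bv k) = 0.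
Proof. by case: k => [|[|]] // _; rewrite formE !co_bv. Qed.

(** Otherwise w would be orthogonal to the isotropic vector [bv 1], whose majorant would then be
    0. *)
Lemma Dc_co0 w : Dc w -> co 0 w != 0.
Proof.
move=> Dw; apply/eqP => w0.
have h : form w (ext (bv 1)) = 0 by rewrite form_bv1.
have := maj_orth h; rewrite form_bvv // oppr0 => /(maj_eq0 Dw) E.
have := co_ext R 1 (bv 1); rewrite E co_0 co_bv // => /eqP.
by rewrite eq_sym oner_eq0.
Qed.

(** The tube domain realisation attached to the isotropic basis [bv 0], [bv 1] of the first plane;
    the last coefficient makes the vector isotropic when z is orthogonal to that plane. *)
Definition tube z : VC := ext (bv 0) + z - (form z z / 2) *: ext (bv 1).

Section Horizontal.
Variable z : VC.
Hypotheses (z0 : co 0 z = 0) (z1 : co 1 z = 0).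

Lemma tube_isotropic : form (tube z) (tube z) = 0.
Proof.
rewrite /tube !formlinE !(formC _ z) !(formC (ext (bv 1)) (ext (bv 0))).
rewrite !form_ext !form_bvv // form_bv0 form_bv1 z0 z1.
have -> : form (bv 0) (bv 1) = 1 by rewrite formE !co_bv.
by field.
Qed.

Lemma tube_Dc : Dc (tube z) <-> 0 < form (vIm z) (vIm z).
Proof.
have h k : co k (vIm z) = cIm (co k z) by exact: co_vIm.
have E : form (vRe (tube z)) (vRe (tube z)) = form (vIm z) (vIm z).
  have -> : vRe (tube z) = ext (bv 0) + vRe z - (cRe (form z z) / 2) *: ext (bv 1).
    apply: co_inj => k k17; rewrite co_vRe !coD !coN !coZ !co_ext co_vRe.
    have -> : cRe (form z z) / 2 = cRe (form z z / 2).
      have : cRe (form z z / 2 + form z z / 2) = cRe (form z z) by rewrite -splitr.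
      by rewrite cReD; lra.
    by rewrite -!(rmorph_int (@rc R)) !cE mulr0 subr0.
  rewrite !formlinE !(formC _ (vRe z)) !(formC (ext (bv 1)) (ext (bv 0))).
  rewrite !form_ext !form_bvv // form_bv0 form_bv1 !co_vRe z0 z1 cRe0.
  have -> : form (bv 0) (bv 1) = 1 by rewrite formE !co_bv.
  by rewrite form_selfE cRe_cxy; field.
split=> [/DcP[_ _]|H]; first by rewrite E.
move: tube_isotropic E; move: (tube z) => v I0 E; rewrite form_selfE in I0.
have := congr1 (@cRe R) I0; have := congr1 (@cIm R) I0.
rewrite cRe_cxy cIm_cxy cRe0 cIm0 => h1 h2.
by apply/DcP; split; [lra|lra|rewrite E].
Qed.

End Horizontal.

Lemma tube_surj w : form w w = 0 -> co 0 w = 1 ->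
  exists z, [/\ co 0 z = 0, co 1 z = 0 & w = tube z].
Proof.
move=> w0 w1; exists (w - ext (bv 0) - co 1 w *: ext (bv 1)).
have E0 : co 0 (w - ext (bv 0) - co 1 w *: ext (bv 1)) = 0.
  by rewrite !coD !coN !coZ !co_ext !co_bv // w1 /= mulr0 subr0 subrr.
have E1 : co 1 (w - ext (bv 0) - co 1 w *: ext (bv 1)) = 0.
  by rewrite !coD !coN !coZ !co_ext !co_bv //= subr0 mulr1 subrr.
split=> //; rewrite /tube.
have -> : form (w - ext (bv 0) - co 1 w *: ext (bv 1)) (w - ext (bv 0) - co 1 w *: ext (bv 1))
   = - 2 * co 1 w.
  rewrite !formlinE !(formC _ w) !(formC (ext (bv 1)) (ext (bv 0))) w0.
  rewrite !form_ext !form_bvv // form_bv0 form_bv1 w1.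
  have -> : form (bv 0) (bv 1) = 1 by rewrite formE !co_bv.
  by ring.
have -> : - 2 * co 1 w / 2 = - co 1 w :> C by field.
by apply: co_inj => k _; rewrite !(coD, coN, coZ); ring.
Qed.

Lemma positive_co2 y : co 0 y = 0 -> 0 < form y y -> co 2 y != 0.
Proof.
move=> y0 yy; apply/eqP => y2; have := negative_part y.
by rewrite y0 y2 !mul0r mulr0 addr0 leNgt yy.
Qed.

(* reversed Cauchy-Schwarz: y and y' can be rescaled so that their difference
   lies in a negative semidefinite subspace *)
Lemma positive_cone y y' : co 0 y = 0 -> co 0 y' = 0 -> 0 < form y y -> 0 < form y' y' ->
  0 < co 2 y -> 0 < co 2 y' -> 0 < form y y'.
Proof.
move=> y0 y'0 yy yy' p p'.
have := negative_part (co 2 y' *: y - co 2 y *: y').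
have -> : co 0 (co 2 y' *: y - co 2 y *: y') = 0 by rewrite coD coN !coZ y0 y'0; ring.
have -> : co 2 (co 2 y' *: y - co 2 y *: y') = 0 by rewrite coD coN !coZ; ring.
rewrite !mul0r mulr0 addr0 !formlinE (formC y' y) => h.
have h1 : 0 < co 2 y' ^+ 2 * form y y by rewrite mulr_gt0 // exprn_gt0.
have h2 : 0 < co 2 y ^+ 2 * form y' y' by rewrite mulr_gt0 // exprn_gt0.
have : 0 < 2 * (co 2 y * co 2 y') * form y y' by lra.
by rewrite pmulr_rgt0 // mulr_gt0 // mulr_gt0.
Qed.

Definition path z d (t : C) : VC := tube (z + t *: d).

Lemma form_self_differentiable w : differentiable (fun v : VC => form v v) w.
Proof.
under eq_fun do rewrite form_sum.
apply: differentiable_fsum => i; apply: differentiableM; first exact: differentiable_coord.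
apply: differentiable_fsum => j; apply: differentiableM; first exact: differentiable_cst.
exact: differentiable_coord.
Qed.

Lemma path_differentiable z d t : differentiable (path z d) t.
Proof.
have dl : differentiable (fun t : C => z + t *: d) t.
  apply: differentiableD; first exact: differentiable_cst.
  by apply: differentiableZl; exact: ex_diff.
have dq : differentiable (fun t : C => form (z + t *: d) (z + t *: d)) t.
  apply: (@differentiable_comp _ _ _ _ (fun t : C => z + t *: d) (fun v : VC => form v v)) => //.
  exact: form_self_differentiable.
rewrite /path /tube; apply: differentiableB.
  by apply: differentiableD => //; exact: differentiable_cst.
apply: differentiableZl; apply: differentiableM => //; exact: differentiable_cst.
Qed.

Lemma near_path z d t (P : VC -> Prop) : (\forall v \near path z d t, P v) ->
  exists2 e : R, 0 < e & forall u, nrm (u - t) < e -> P (path z d u).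
Proof.
move=> H; have cp : {for t, continuous (path z d)}.
  exact: differentiable_continuous (path_differentiable z d t).
by apply/near_nrmP; exact: cp.
Qed.

(** The radius depends on b alone and serves every centre s near b: this uniformity makes the
    continuation close up. If s and t are within e / 8 of b, they are within e / 4 of each other,
    and the square of half-side e / 4 around s stays within e of b, where the local equations are
    available. *)
Lemma extension_step Y z d (b : C) : locana Y -> Dc (path z d b) ->
  (exists2 e : R, 0 < e & forall u, nrm (u - b) < e -> Dc (path z d u)) ->
  exists2 e : R, 0 < e & forall s : C, nrm (s - b) < e ->
   (exists2 a, 0 < a & forall t, nrm (t - s) < a -> Y (path z d t)) ->
   forall t, nrm (t - b) < e -> Y (path z d t).
Proof.
move=> HY Db [e1 e10 De]; have [I [F HF]] := HY _ Db.
have [e2 e20 He] := near_path HF.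
pose e := Num.min e1 e2; have e0 : 0 < e by rewrite lt_min e10.
have HE t : nrm (t - b) < e -> Dc (path z d t) /\ (forall i, differentiable (F i) (path z d t)) /\
    (Y (path z d t) <-> forall i, F i (path z d t) = 0).
  rewrite lt_min => /andP[h1 h2]; have Dt := De _ h1; have [h3 h4] := He _ h2.
  by split=> //; split=> //; exact: h4.
exists (e / 8); first by rewrite divr_gt0.
move=> s sb [a a0 Ha] t tb.
have e8 : e / 8 < e by lra.
have [_ [_ ->]] := HE t (lt_trans tb e8).
move=> i; pose f (u : C) := F i (path z d (s + u)).
have -> : F i (path z d t) = f (t - s) by rewrite /f addrC subrK.
have tri u : nrm (s + u - b) <= nrm u + nrm (s - b).
  by rewrite addrAC [leRHS]addrC; exact: nrm_triangle.
apply: (@identity_disc R f (e / 4) (Num.min a (e / 4))).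
- by rewrite lt_min a0 divr_gt0.
- move=> u u1 u2; apply/derivable1_diffP.
  have ub : nrm (s + u - b) < e.
    by apply: le_lt_trans (tri u) _; have := nrm_le_ReIm u; lra.
  have [_ [dF _]] := HE _ ub.
  apply: (@differentiable_comp _ _ _ _ (fun u : C => path z d (s + u)) (F i)); last exact: dF.
  apply: (@differentiable_comp _ _ _ _ (fun u : C => s + u) (path z d)); last exact: path_differentiable.
  by apply: differentiableD; [exact: differentiable_cst|exact: ex_diff].
- move=> u; rewrite lt_min => /andP[ua ue].
  have ub : nrm (s + u - b) < e by apply: le_lt_trans (tri u) _; lra.
  have [_ [_ YF]] := HE _ ub.
  by apply: YF.1; apply: Ha; rewrite addrAC subrr add0r.
- by have := nrm_triangle (t - b) (b - s); rewrite addrA subrK (nrmB b); lra.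
Qed.

(** A supremum argument; the closedness hypothesis has the form delivered by [extension_step], a
    radius at s that serves every u close to s on its left. *)
Lemma segment_continuation (N : R -> Prop) : N 0 ->
  (forall s, 0 <= s <= 1 -> N s -> exists2 e, 0 < e & forall u, `|u - s| < e -> N u) ->
  (forall s, 0 <= s <= 1 -> exists2 e, 0 < e & forall u, 0 <= u <= s -> s - e < u -> N u -> N s) ->
  N 1.
Proof.
move=> N0 Nopen Nclosed.
pose S := [set s : R | 0 <= s <= 1 /\ forall u, 0 <= u <= s -> N u].
have S0 : S 0.
  split; first by rewrite lexx ler01.
  by move=> u /andP[a b]; have -> : u = 0 by apply/eqP; rewrite eq_le b a.
have hs : has_sup S by split; [exists 0|exists 1 => s [/andP[]]].
pose s := sup S.
have s01 : 0 <= s <= 1.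
  apply/andP; split; first exact: (ub_le_sup hs.2 S0).
  by apply: ge_sup hs.1 _ => t [/andP[]].
have [e e0 He] := Nclosed s s01.
have [t St ts] := sup_adherent e0 hs.
have tles : t <= s by exact: (ub_le_sup hs.2 St).
have Ns : N s.
  by apply: (He t) => //; [rewrite tles andbT; case: St => /andP[]|apply: St.2; rewrite lexx andbT; case: St => /andP[]].
have Nlt u : 0 <= u < s -> N u.
  move=> /andP[u0 us]; have us0 : 0 < s - u by rewrite subr_gt0.
  have [t' St' ts'] := sup_adherent us0 hs.
  by apply: St'.2; rewrite u0 ltW //; move: ts'; rewrite -/s; lra.
have Nle u : 0 <= u <= s -> N u.
  move=> /andP[u0]; rewrite le_eqVlt => /orP[/eqP -> //|us].
  by apply: Nlt; rewrite u0.
have [d d0 Hd] := Nopen s s01 Ns.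
have [<- //|s1] := eqVneq s 1; exfalso.
have {}s1 : s < 1 by rewrite lt_neqAle s1; case/andP: s01.
pose s' := Num.min (s + d / 2) 1.
have ss' : s < s' by rewrite lt_min s1 andbT ltrDl divr_gt0.
have : S s'.
  have s'd : s' <= s + d / 2 by rewrite ge_min lexx.
  split.
    by rewrite ge_min lexx orbT andbT; apply: le_trans (ltW ss'); case/andP: s01.
  move=> u /andP[u0 us']; have [us|su] := leP u s; first by apply: Nle; rewrite u0.
  by apply: Hd; rewrite ger0_norm ?subr_ge0 1?ltW //; lra.
by move/(ub_le_sup hs.2); rewrite -/s leNgt ss'.
Qed.

Variable r : latT.
Hypotheses (r0 : co 0 r = 0) (r1 : co 1 r = 0).

(** Tube coordinates correspond to [co 0 w = 1]; the sign of the imaginary part of [co 2 w] selects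
    one of the two components of the cone of vectors with positive norm. *)
Definition half_hyperplane := [set w : VC | [/\ Dc w, form (ext r) w = 0, co 0 w = 1 & 0 < cIm (co 2 w)]].

Lemma form_r_tube z : form (ext r) (tube z) = form (ext r) z.
Proof. by rewrite /tube !formlinE form_bv0 form_bv1 !co_ext r0 r1 mulr0 subr0 add0r. Qed.

(** If Y misses w0, it misses a neighbourhood of w0, where Y' must then contain the hyperplane
    section. Since r is orthogonal to the first plane, its hyperplane is linear in z, so the segment
    from w0 to any w1 stays in it, and Y' propagates along the segment. *)
Lemma analytic_alternative Y Y' : locana Y -> locana Y' ->
  (forall w, Dc w -> form (ext r) w = 0 -> Y w \/ Y' w) ->
  half_hyperplane `<=` Y \/ half_hyperplane `<=` Y'.
Proof.
move=> HY HY' cov.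
have [h|/existsNP[w0 /not_implyP[H0 nY]]] := pselect (half_hyperplane `<=` Y); first by left.
right=> w1 H1.
have [D0 e0 i0 p0] := H0; have [D1 e1 i1 p1] := H1.
have [z0 [a0 b0 E0]] := tube_surj D0.1 i0; have [z1 [a1 b1 E1]] := tube_surj D1.1 i1.
pose d := z1 - z0.
have path0 : path z0 d 0 = w0 by rewrite /path scale0r addr0.
have path1 : path z0 d 1 = w1 by rewrite /path scale1r /d addrCA subrr addr0.
have ct t : co 0 (z0 + t *: d) = 0 /\ co 1 (z0 + t *: d) = 0.
  by rewrite /d !coD !coZ !coD !coN a0 b0 a1 b1 !subrr mulr0 addr0.
have rt t : form (ext r) (path z0 d t) = 0.
  have h0 : form (ext r) z0 = 0 by rewrite -form_r_tube -E0.
  have h1 : form (ext r) z1 = 0 by rewrite -form_r_tube -E1.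
  rewrite /path form_r_tube.
  by rewrite /d !formlinE h0 h1 subrr mulr0 addr0.
have y2 z : co 2 (vIm (tube z)) = cIm (co 2 z).
  rewrite co_vIm /tube !coD coN coZ !co_ext !co_bv //=.
  by rewrite mulr0 subr0 add0r.
have Ds s : 0 <= s <= 1 -> Dc (path z0 d (rc s)).
  move=> /andP[s0 s1]; have [h1 h2] := ct (rc s).
  apply/(tube_Dc h1 h2).
  have -> : vIm (z0 + rc s *: d) = (1 - s) *: vIm z0 + s *: vIm z1.
    apply: co_inj => k k17; rewrite !(coD, coZ) !co_vIm /d !(coD, coZ, coN).
    by rewrite raddfD /= cImM cRe_rc cIm_rc mul0r addr0 raddfB /=; ring.
  have q0 : 0 < form (vIm z0) (vIm z0) by apply/(tube_Dc a0 b0); rewrite -E0.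
  have q1 : 0 < form (vIm z1) (vIm z1) by apply/(tube_Dc a1 b1); rewrite -E1.
  have q01 : 0 < form (vIm z0) (vIm z1).
    apply: positive_cone => //; rewrite ?co_vIm ?a0 ?a1 //.
      by rewrite -y2 -E0 co_vIm.
    by rewrite -y2 -E1 co_vIm.
  rewrite !formlinE (formC (vIm z1)).
  have : 0 <= s * (1 - s) * form (vIm z0) (vIm z1).
    by rewrite !mulr_ge0 ?subr_ge0 // ltW.
  have : 0 <= (1 - s) * (1 - s) * form (vIm z0) (vIm z0).
    by rewrite !mulr_ge0 ?subr_ge0 // ltW.
  have : 0 <= s * s * form (vIm z1) (vIm z1) by rewrite !mulr_ge0 // ltW.
  have [s2|s2] := ltP s (1 / 2).
    have : 0 < (1 - s) * (1 - s) * form (vIm z0) (vIm z0).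
      by rewrite !mulr_gt0 // subr_gt0; lra.
    by lra.
  have : 0 < s * s * form (vIm z1) (vIm z1) by rewrite !mulr_gt0 //; lra.
  by lra.
(* The path is isotropic by construction, also at complex parameters, so belonging to the cone is a
   single open inequality. *)
have Dnear t : Dc (path z0 d t) ->
    exists2 e : R, 0 < e & forall u, nrm (u - t) < e -> Dc (path z0 d u).
  move=> /DcP[_ _ aa].
  have nV : \forall v \near path z0 d t, 0 < form (vRe v) (vRe v).
    exact: (@vRe_form_continuous R (path z0 d t) _ (lt_nbhsr aa)).
  have [e ep He] := @near_path z0 d t (fun v => 0 < form (vRe v) (vRe v)) nV.
  exists e; first exact: ep.
  move=> u ue; have h := He u ue.
  have [h1 h2] := ct u.
  have I0 : form (path z0 d u) (path z0 d u) = 0 by exact: tube_isotropic.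
  move: (path z0 d u) I0 h => v I0 h; rewrite form_selfE in I0.
  have := congr1 (@cRe R) I0; have := congr1 (@cIm R) I0.
  rewrite cRe_cxy cIm_cxy cRe0 cIm0 => g1 g2.
  by apply/DcP; split=> //; lra.
pose N (s : R) := exists2 e : R, 0 < e & forall t, nrm (t - rc s) < e -> Y' (path z0 d t).
suff : N 1 by move=> [e ep]; rewrite rmorph1 => /(_ 1); rewrite subrr nrm0 path1; exact.
apply: segment_continuation.
- have [I [F HF]] := HY _ D0.
  have [i Fi] : exists i, F i w0 != 0.
    apply: contrapT => /forallNP h; apply: nY; have [_ ->//] := nbhs_singleton HF.
    by move=> i; apply/eqP/negPn/negP/h.
  have dF : differentiable (F i) w0 by have [] := nbhs_singleton HF.
  have n1 := @cvgr_neq0 C C VC (nbhs w0) (nbhs_filter w0) _ _ (differentiable_continuous dF) Fi.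
  have n2 : \forall v \near path z0 d 0, Dc v -> ~ Y v.
    rewrite path0; apply: filterS2 n1 HF => v Fv [_ h] Dv /(h Dv)/(_ i) /eqP.
    by rewrite (negbTE Fv).
  have [e ep He] := near_path n2.
  have D0' : Dc (path z0 d 0) by rewrite path0.
  have [e' e'p De] := Dnear 0 D0'.
  exists (Num.min e e'); first by rewrite lt_min ep.
  move=> t; rewrite rmorph0 lt_min => /andP[t1 t2].
  have Dt := De t t2.
  by case: (cov _ Dt (rt t)) => // Yt; case: (He t t1 Dt).
- move=> s s01 [e ep He]; exists (e / 2); first by rewrite divr_gt0.
  move=> u us; exists (e / 2); first by rewrite divr_gt0.
  move=> t tu; apply: He.
  have := nrm_triangle (t - rc u) (rc u - rc s); rewrite addrA subrK -raddfB nrm_rc /=.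
  by lra.
move=> s s01; have Dsp := Ds s s01.
have [e ep He] := extension_step HY' Dsp (Dnear _ Dsp).
exists e => // u /andP[u0 us] ue Nu; exists e => // t.
apply: (He (rc u)) => //; rewrite -raddfB nrm_rc ler0_norm ?subr_le0 //; lra.
Qed.

End Tube.

(** * Orbits of roots *)

Section Arithmetic.
Implicit Types (u v x y t : latT) (g h : 'M[int]_17).

Lemma ext_int m n (A : 'M[int]_(m, n)) : ext A = A.
Proof. by apply/matrixP => i j; rewrite mxE intz. Qed.

Lemma gram_det : \det gramT != 0.
Proof.
apply/negP => /eqP d0; have [v v0 Hv] : exists2 v : latT, v != 0 & v *m gramT = 0.
  by apply/det0P; rewrite d0.
suff : v = 0 by move/eqP; rewrite (negbTE v0).
by apply: form_nondeg => t; rewrite /form !ext_int Hv mul0mx mxE.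
Qed.

(** Invertibility is automatic: taking determinants, the square of the determinant of g is 1 because
    the Gram determinant is nonzero. *)
Lemma OT_iso g : (forall x y, form (x *m g) (y *m g) = form x y) -> OT g.
Proof.
move=> H.
have gG : g *m gramT *m g^T = gramT.
  apply/matrixP => i j.
  have E (M : 'M[int]_17) : M i j = ((delta_mx 0 i : latT) *m M *m (delta_mx 0 j : latT)^T) 0 0.
    by rewrite -rowE trmx_delta -colE !mxE.
  rewrite E [RHS]E; have := H (delta_mx 0 i) (delta_mx 0 j).
  by rewrite /form !ext_int trmx_mul !mulmxA.
split=> //.
have := congr1 determinant gG; rewrite !det_mulmx det_tr mulrAC -[RHS]mul1r.
move=> /(mulIf gram_det) d1; rewrite unitmxE; apply/unitrPr; exists (\det g).
exact: d1.
Qed.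

Lemma OT_form g x y : OT g -> form (x *m g) (y *m g) = form x y.
Proof. by move=> Og; rewrite -[g]ext_int; exact: isometry_form. Qed.

Definition gmx (f : latT -> latT) : 'M[int]_17 := \matrix_i f (delta_mx 0 i).

Lemma gmxE f : (forall a x y, f (a *: x + y) = a *: f x + f y) -> forall x, x *m gmx f = f x.
Proof.
move=> H x.
have f0 : f 0 = 0.
  by have := H (-1) 0 0; rewrite scaler0 addr0 scaleN1r addNr.
rewrite mulmx_sum_row [in RHS](row_sum_delta x).
elim/big_rec2: _ => [|i a b _ ->]; first by rewrite f0.
by rewrite H rowK.
Qed.

(* u / 2 lies in the dual lattice *)
Definition even_vec u := forall t, exists k, form u t = 2 * k.
(** Equality of u / 2 and v / 2 modulo T, stated without denominators. *)
Definition cong2 u v := exists t, u - v = 2 *: t.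

Lemma cong2_refl u : cong2 u u. Proof. by exists 0; rewrite subrr scaler0. Qed.
Lemma cong2_sym u v : cong2 u v -> cong2 v u.
Proof. by move=> [t E]; exists (- t); rewrite scalerN -E opprB. Qed.
Lemma cong2_trans u v x : cong2 u v -> cong2 v x -> cong2 u x.
Proof.
move=> [t E] [s F]; exists (t + s); rewrite scalerDr -E -F.
by rewrite addrA subrK.
Qed.
Lemma cong2_mul u v g : cong2 u v -> cong2 (u *m g) (v *m g).
Proof. by move=> [t E]; exists (t *m g); rewrite -mulmxBl E scalemxAl. Qed.
Lemma cong2N u : cong2 (- u) u.
Proof. by exists (- u); rewrite scalerN scaler_nat mulr2n opprD. Qed.

Lemma even_cong u v : even_vec u -> cong2 u v -> even_vec v.
Proof.
move=> Hu [s E] t; have [k Ek] := Hu t; exists (k - form s t).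
have -> : v = u - 2 *: s by rewrite -E opprB addrC subrK.
by rewrite formBl formZl Ek; ring.
Qed.

Lemma even_mul u g : OT g -> even_vec u -> even_vec (u *m g).
Proof.
move=> Og Hu t; have [k Ek] := Hu (t *m invmx g); exists k.
by rewrite -Ek -(OT_form u (t *m invmx g) Og) -mulmxA mulVmx ?mulmx1 //; case: Og.
Qed.

(** The pairing of u / 2 and v / 2 modulo integers, multiplied by 4; congruences modulo 4 thus play
    the part of the discriminant form. *)
Lemma form_cong4 u u' v : even_vec v -> cong2 u u' -> exists k, form u v = form u' v + 4 * k.
Proof.
move=> Hv [s E]; have [k Ek] := Hv s; exists k.
have -> : u = u' + 2 *: s by rewrite -E addrC subrK.
by rewrite formDl formZl formC in Ek *; rewrite formC in Ek; rewrite (formC s) Ek; ring.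
Qed.

(** The stable orthogonal group, acting trivially on the discriminant group; it is contained in both
    groups of the theorem. *)
Definition stable g := OT g /\ forall u, even_vec u -> cong2 (u *m g) u.

Lemma stable_mul g h : stable g -> stable h -> stable (g *m h).
Proof.
move=> [Og Hg] [Oh Hh]; split; first exact: OT_mul.
move=> u Hu; rewrite mulmxA; apply: cong2_trans (Hg u Hu).
by apply: Hh; exact: even_mul.
Qed.

Lemma stable_inv g : stable g -> stable (invmx g).
Proof.
move=> [Og Hg]; split; first exact: OT_inv.
move=> u Hu; have := Hg (u *m invmx g) (even_mul (OT_inv Og) Hu).
by rewrite -mulmxA mulVmx ?mulmx1; [exact: cong2_sym|case: Og].
Qed.

Lemma stable1 : stable 1%:M.
Proof. by split; [exact: OT_1|move=> u _; rewrite mulmx1; exact: cong2_refl]. Qed.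

Lemma stable_gmx f : (forall a x y, f (a *: x + y) = a *: f x + f y) ->
  (forall x y, form (f x) (f y) = form x y) ->
  (forall u, even_vec u -> cong2 (f u) u) ->
  stable (gmx f) /\ forall x, x *m gmx f = f x.
Proof.
move=> lf isof cf; have E := gmxE lf; split=> //; split.
  by apply: OT_iso => x y; rewrite !E.
by move=> u Hu; rewrite E; exact: cf.
Qed.

(** The Eichler transvection of the isotropic vector e and of a orthogonal to e, with k half the
    norm of a. It moves u by multiples of its pairings with a and e, which are even for u in twice
    the dual lattice. *)
Lemma transvection_stable e a k : form e e = 0 -> form a e = 0 -> form a a = 2 * k ->
  exists2 g, stable g &
    forall v, v *m g = v - form v a *: e + form v e *: a - (k * form v e) *: e.
Proof.
move=> ee ae aa.
have [|||g H] := @stable_gmx (fun v => v - form v a *: e + form v e *: a - (k * form v e) *: e).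
- move=> c x y; apply: co_inj => j _; rewrite !formlinE !(coD, coN, coZ).
  by ring.
- move=> x y; have ea : form e a = 0 by rewrite formC.
  rewrite !formlinE !(formC e y) !(formC a y) ee ae ea aa.
  by ring.
- move=> u Hu; have [p Ep] := Hu a; have [q Eq] := Hu e.
  exists (- p *: e + q *: a - (k * q) *: e).
  by apply: co_inj => j _; rewrite Ep Eq !(coD, coN, coZ); ring.
by eexists; [exact: g|exact: H].
Qed.

Lemma even_co u k : even_vec u -> (k < 12)%N -> exists p, co k u = 2 * p.
Proof.
move=> Hu k12; have [p Ep] := Hu (dv k); exists p; rewrite -Ep.
by rewrite -[dv k]ext_int form_dv ?k12 ?mul1r // (ltn_trans k12).
Qed.

Lemma vec_cong u (s : seq int) : (forall k, (k < 17)%N -> exists p, nth 0 s k = co k u + 2 * p) ->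
  cong2 (vec s) u.
Proof.
move=> H; have [p Hp] : exists p : nat -> int, forall k, (k < 17)%N -> nth 0 s k = co k u + 2 * p k.
  suff /choice[p Hp] : forall k, exists p, (k < 17)%N -> nth 0 s k = co k u + 2 * p by exists p.
  by move=> k; case: (boolP (k < 17)%N) => [/H[p Ep]|_]; [exists p|exists 0].
exists (\row_i p i); apply: co_inj => k k17; rewrite coD coN coZ co_vec // Hp //.
by rewrite [co k (\row_i _)]mxE inordK //; ring.
Qed.

Ltac coord17 := let k := fresh "k" in let hk := fresh "hk" in
  apply: co_inj => k hk; rewrite ?(coD, coZ) ?co_vec //;
  do 17 (destruct k as [|k]; [by rewrite /= ?(coD, coZ, coN)|]); by [].

Definition swapUU v : latT := vec [:: co 2 v; co 3 v; co 0 v; co 1 v; co 4 v; co 5 v; co 6 v;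
  co 7 v; co 8 v; co 9 v; co 10 v; co 11 v; co 12 v; co 13 v; co 14 v; co 15 v; co 16 v].
Definition swapU1 v : latT := vec [:: co 0 v; co 1 v; co 3 v; co 2 v; co 4 v; co 5 v; co 6 v;
  co 7 v; co 8 v; co 9 v; co 10 v; co 11 v; co 12 v; co 13 v; co 14 v; co 15 v; co 16 v].
(** Besides normalising signs, this isometry exchanges the two halves of the hyperplane of a root
    orthogonal to the first plane. *)
Definition negU v : latT := vec [:: - co 0 v; - co 1 v; co 2 v; co 3 v; co 4 v; co 5 v; co 6 v;
  co 7 v; co 8 v; co 9 v; co 10 v; co 11 v; co 12 v; co 13 v; co 14 v; co 15 v; co 16 v].

Lemma swapUU_stable : stable (gmx swapUU) /\ forall x, x *m gmx swapUU = swapUU x.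
Proof.
apply: stable_gmx.
- by move=> a x y; rewrite /swapUU; coord17.
- by move=> x y; rewrite !formE /swapUU !co_vec //=; ring.
- move=> u Hu; apply: vec_cong => k k17.
  have [p0 E0] := even_co Hu (isT : 0 < 12)%N; have [p1 E1] := even_co Hu (isT : 1 < 12)%N.
  have [p2 E2] := even_co Hu (isT : 2 < 12)%N; have [p3 E3] := even_co Hu (isT : 3 < 12)%N.
  case: k k17 => [|[|[|[|k]]]] k17 /=.
  + by exists (p2 - p0); rewrite E0 E2; ring.
  + by exists (p3 - p1); rewrite E1 E3; ring.
  + by exists (p0 - p2); rewrite E0 E2; ring.
  + by exists (p1 - p3); rewrite E1 E3; ring.
  + exists 0; rewrite mulr0 addr0.
    by do 13 (destruct k as [|k]; first by []).
Qed.

Lemma swapU1_stable : stable (gmx swapU1) /\ forall x, x *m gmx swapU1 = swapU1 x.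
Proof.
apply: stable_gmx.
- by move=> a x y; rewrite /swapU1; coord17.
- by move=> x y; rewrite !formE /swapU1 !co_vec //=; ring.
- move=> u Hu; apply: vec_cong => k k17.
  have [p2 E2] := even_co Hu (isT : 2 < 12)%N; have [p3 E3] := even_co Hu (isT : 3 < 12)%N.
  case: k k17 => [|[|[|[|k]]]] k17 /=.
  + by exists 0; rewrite mulr0 addr0.
  + by exists 0; rewrite mulr0 addr0.
  + by exists (p3 - p2); rewrite E2 E3; ring.
  + by exists (p2 - p3); rewrite E2 E3; ring.
  + exists 0; rewrite mulr0 addr0.
    by do 13 (destruct k as [|k]; first by []).
Qed.

Lemma negU_linear a x y : negU (a *: x + y) = a *: negU x + negU y.
Proof.
rewrite /negU; apply: co_inj => k hk; rewrite ?(coD, coZ) ?co_vec //.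
do 17 (destruct k as [|k]; [by rewrite /= ?(coD, coZ, coN) ?mulrN ?opprD|]); by [].
Qed.

Lemma negU_cong u : cong2 (negU u) u.
Proof.
apply: vec_cong => k k17; case: k k17 => [|[|k]] k17 /=.
- by exists (- co 0 u); ring.
- by exists (- co 1 u); ring.
exists 0; rewrite mulr0 addr0.
by do 15 (destruct k as [|k]; first by []).
Qed.

Lemma negU_stable : stable (gmx negU) /\ forall x, x *m gmx negU = negU x.
Proof.
apply: stable_gmx.
- exact: negU_linear.
- by move=> x y; rewrite !formE /negU !co_vec //=; ring.
- by move=> u _; exact: negU_cong.
Qed.

End Arithmetic.

(** * Reduction of a vector by transvections *)

Section Eichler.
Implicit Types (u v x y t a : latT) (g h : 'M[int]_17).

Definition orbit_of v v' := exists2 g, stable g & v' = v *m g.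

Lemma orbit_refl v : orbit_of v v.
Proof. by exists 1%:M; [exact: stable1|rewrite mulmx1]. Qed.
Lemma orbit_trans v u x : orbit_of v u -> orbit_of u x -> orbit_of v x.
Proof.
move=> [g Sg ->] [h Sh ->]; exists (g *m h); first exact: stable_mul.
by rewrite mulmxA.
Qed.

Lemma orbit_swapUU v : orbit_of v (swapUU v).
Proof. by have [S E] := swapUU_stable; exists (gmx swapUU); rewrite ?E. Qed.
Lemma orbit_swapU1 v : orbit_of v (swapU1 v).
Proof. by have [S E] := swapU1_stable; exists (gmx swapU1); rewrite ?E. Qed.
Lemma orbit_negU v : orbit_of v (negU v).
Proof. by have [S E] := negU_stable; exists (gmx negU); rewrite ?E. Qed.

Lemma form_bv v k : (k < 4)%N -> form v (bv k) = co (nth 0 [:: 1; 0; 3; 2] k)%N v.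
Proof.
have E j : (j < 4)%N -> form v (dv j) = co j v.
  by move=> j4; rewrite -[dv j]ext_int form_dv; case: j j4 => [|[|[|[|]]]] // _; rewrite mul1r.
case: k => [|[|[|[|]]]] // _.
- exact: (E 1%N).
- exact: (E 0%N).
- exact: (E 3%N).
- exact: (E 2%N).
Qed.

Lemma form_bb k : (k < 4)%N -> form (bv k) (bv k) = 0.
Proof. by move=> k4; rewrite form_bv //; case: k k4 => [|[|[|[|]]]] // _; rewrite co_bv. Qed.

Lemma orbit_transvection k v a : (k < 4)%N -> form a (bv k) = 0 ->
  exists2 c, form a a = 2 * c & orbit_of v (v - form v a *: bv k + form v (bv k) *: a - (c * form v (bv k)) *: bv k).
Proof.
move=> k4 ak; have [c Ec] := form_even a; exists c => //.
have [g Sg Eg] := transvection_stable (form_bb k4) ak Ec.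
by exists g; rewrite ?Eg.
Qed.

(** The transvection along [bv 1] adds [co 0 v] times a to all coordinates outside the first plane;
    only [co 1] changes in a complicated way, and it is later recovered from the norm. *)
Lemma orbit_translate v a : co 0 a = 0 -> co 1 a = 0 -> exists2 v', orbit_of v v' &
  co 0 v' = co 0 v /\ forall k, (1 < k < 17)%N -> co k v' = co k v + co 0 v * co k a.
Proof.
move=> a0 a1; have [|c _ H] := @orbit_transvection 1 v a isT; first by rewrite form_bv.
eexists; first exact: H.
rewrite form_bv //=; split=> [|k /andP[k1 k17]].
  by rewrite !(coD, coN, coZ) !co_bv // a0 /=; ring.
rewrite !(coD, coN, coZ) !co_bv // gtn_eqF //=; ring.
Qed.

(** A Euclidean algorithm in disguise: a remainder smaller than [co 0 v] that can be moved into
    coordinate 0 must vanish. *)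
Definition minimal_co0 v := co 0 v != 0 /\
  forall v', orbit_of v v' -> co 0 v' != 0 -> `|co 0 v| <= `|co 0 v'|.

Lemma minimal_exists v : co 0 v != 0 -> exists2 v', orbit_of v v' & minimal_co0 v'.
Proof.
move: {2}(absz (co 0 v)) (leqnn (absz (co 0 v))) => n.
elim: n v => [|n IH] v.
  by rewrite leqn0 absz_eq0 => /eqP ->; rewrite eqxx.
move=> vn v0; have [[u [vu u0 lu]]|H] :=
    pselect (exists u, [/\ orbit_of v u, co 0 u != 0 & `|co 0 u| < `|co 0 v|]).
  have [|w uw mw] := IH u _ u0; last by exists w => //; exact: orbit_trans uw.
  rewrite -ltnS; apply: leq_trans vn; rewrite -ltz_nat !abszE //.
exists v; first exact: orbit_refl.
split=> // u vu u0; rewrite leNgt; apply/negP => lu; apply: H; exists u; split=> //.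
Qed.

Lemma minimal_orbit v v' : minimal_co0 v -> orbit_of v v' -> co 0 v' = co 0 v -> minimal_co0 v'.
Proof.
move=> [v0 H] vv' E; split; first by rewrite E.
by move=> u vu; rewrite E; apply: H; exact: orbit_trans vu.
Qed.

(** A translation reduces [co 2 v] modulo [co 0 v], and exchanging the planes puts the remainder in
    coordinate 0. *)
Lemma minimal_dvd2 v : minimal_co0 v -> (co 0 v %| co 2 v)%Z.
Proof.
move=> [v0 H]; pose q := (co 2 v %/ co 0 v)%Z.
have [||u vu [u0 uk]] := @orbit_translate v (- q *: bv 2).
- by rewrite coZ co_bv // mulr0.
- by rewrite coZ co_bv // mulr0.
have u2 : co 2 u = (co 2 v %% co 0 v)%Z.
  by rewrite uk // coZ co_bv //= /modz /q; ring.
have := H (swapUU u) (orbit_trans vu (orbit_swapUU u)).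
rewrite /swapUU co_vec //= u2 => h; apply: contraT => nd.
have n0 : (co 2 v %% co 0 v)%Z != 0 by apply: contra nd => /eqP; move/dvdz_mod0P.
by have := h n0; rewrite leNgt [X in X < _]ger0_norm ?modz_ge0 // ltz_mod.
Qed.

Lemma minimal_dvd3 v : minimal_co0 v -> (co 0 v %| co 3 v)%Z.
Proof.
move=> mv; have E0 : co 0 (swapU1 v) = co 0 v by rewrite /swapU1 co_vec.
have := minimal_dvd2 (minimal_orbit mv (orbit_swapU1 v) E0).
by rewrite E0 /swapU1 co_vec.
Qed.

(** After the coordinates in the second plane are cleared, further transvections copy any other
    pairing of u into coordinate 2 without changing [co 0 u], and [minimal_dvd2] applies to the
    result. *)
Lemma minimal_divides v : minimal_co0 v -> exists v', [/\ orbit_of v v', co 0 v' = co 0 v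
  & forall t, (co 0 v' %| form v' t)%Z].
Proof.
move=> mv; have /dvdzP[q2 E2] := minimal_dvd2 mv; have /dvdzP[q3 E3] := minimal_dvd3 mv.
have [||u vu [u0 uk]] := @orbit_translate v (- q2 *: bv 2 - q3 *: bv 3).
- by rewrite coD coN !coZ !co_bv //=; ring.
- by rewrite coD coN !coZ !co_bv //=; ring.
have u2 : co 2 u = 0 by rewrite uk // coD coN !coZ !co_bv //= E2; ring.
have u3 : co 3 u = 0 by rewrite uk // coD coN !coZ !co_bv //= E3; ring.
have mu := minimal_orbit mv vu u0.
have d1 : (co 0 u %| co 1 u)%Z.
  (* This transvection puts [co 1 u] into coordinate 2. *)
  have [|c Ec H] := @orbit_transvection 0 u (bv 2) isT; first by rewrite form_bv // co_bv.
  set w := (X in orbit_of u X) in H.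
  have w0 : co 0 w = co 0 u.
    have c0 : c = 0 by move: Ec; rewrite form_bb // => /esym/eqP; rewrite mulf_eq0 => /eqP.
    by rewrite /w !form_bv //= u3 c0 !(coD, coN, coZ) !co_bv //=; ring.
  have := minimal_dvd2 (minimal_orbit mu H w0).
  rewrite w0 /w !form_bv //= !(coD, coN, coZ) !co_bv //= u2 u3.
  by rewrite !mulr0 !mulr1 oppr0 !addr0 add0r.
have dM a : (forall k, (k < 4)%N -> co k a = 0) -> (co 0 u %| form u a)%Z.
  (* This one puts [- form u a] into coordinate 2. *)
  move=> a0; have [|c _ H] := @orbit_transvection 2 u a isT; first by rewrite form_bv //= a0.
  set w := (X in orbit_of u X) in H.
  have w0 : co 0 w = co 0 u.
    by rewrite /w form_bv //= u3 !(coD, coN, coZ) !co_bv //=; ring.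
  have := minimal_dvd2 (minimal_orbit mu H w0).
  rewrite w0 /w form_bv //= !(coD, coN, coZ) !co_bv //= u2 u3.
  by rewrite mul0r mulr0 mul0r oppr0 !addr0 mulr1 add0r rpredN.
exists u; split=> // t.
pose tM := t - co 0 t *: bv 0 - co 1 t *: bv 1 - co 2 t *: bv 2 - co 3 t *: bv 3.
have -> : form u t = form u tM + co 0 t * co 1 u + co 1 t * co 0 u.
  by rewrite /tM !formlinE !form_bv //= u2 u3; ring.
rewrite rpredD ?dvdz_mull // rpredD ?dvdz_mull // dM // => k k4.
rewrite /tM !(coD, coN, coZ); case: k k4 => [|[|[|[|]]]] // _; rewrite !co_bv //=; ring.
Qed.

End Eichler.

(** * Normal forms of roots *)

Section Roots.
Implicit Types (u v x y t a r : latT) (g h : 'M[int]_17) (i j : 'I_5).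

(** The normal forms lie in the orthogonal of the first plane, as the tube domain argument requires.
    In [rho2] the multiples of 2 keep the class of the sum of the five vectors and raise its norm
    -10 by 8. *)
Definition rho1 : latT := bv 2 - bv 3.
Definition rho2 : latT := 2 *: bv 2 + 2 *: bv 3 + \sum_i rA1 i.
Definition rho3 i : latT := 2 *: bv 2 + rA1 i.

Lemma co_rA1 k i : (k < 17)%N -> co k (rA1 i) = (k == (12 + i)%N)%:R.
Proof.
move=> k17; rewrite /co /rA1 mxE eqxx andTb; congr ((nat_of_bool _)%:R).
have E : nat_of_ord (inord k : 'I_17) = k by rewrite inordK.
apply/eqP/eqP => ki; first by move/(congr1 (@nat_of_ord 17)): ki; rewrite E.
by apply: val_inj; rewrite [LHS]E ki.
Qed.

Lemma rA1E i : rA1 i = bv (12 + i)%N.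
Proof. by apply: co_inj => k k17; rewrite co_rA1 // co_bv. Qed.

Lemma form_rA1 i t : form t (rA1 i) = - 2 * co (12 + i)%N t.
Proof.
have i17 : (12 + i < 17)%N by rewrite (ltn_add2l 12 i 5).
have -> : rA1 i = dv (12 + i)%N.
  by rewrite rA1E; case: i i17 => -[|[|[|[|[|]]]]].
by rewrite -[dv _]ext_int form_dv.
Qed.

Lemma co_sum_rA1 k : (k < 17)%N -> co k (\sum_i rA1 i) = (12 <= k)%:R.
Proof.
move=> k17; rewrite !big_ord_recl big_ord0 !coD !co_rA1 // co_0.
by do 17 (destruct k as [|k]; first by []).
Qed.

Lemma even_rA1 i : even_vec (rA1 i).
Proof. by move=> t; exists (- co (12 + i)%N t); rewrite formC form_rA1; ring. Qed.

Lemma even_sum_rA1 : even_vec (\sum_i rA1 i).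
Proof.
move=> t; exists (\sum_(i < 5) - co (12 + i)%N t); rewrite form_suml mulr_sumr.
by apply: eq_bigr => i _; rewrite formC form_rA1; ring.
Qed.

Lemma orbit_form v v' : orbit_of v v' -> form v' v' = form v v.
Proof. by move=> [g [Og _] ->]; exact: OT_form. Qed.

Lemma orbit_divides (n : int) v v' : orbit_of v v' ->
  (forall t, (n %| form v t)%Z) -> forall t, (n %| form v' t)%Z.
Proof.
move=> [g [Og _] ->] H t.
have -> : form (v *m g) t = form v (t *m invmx g).
  by rewrite -(OT_form v _ Og) -mulmxA mulVmx ?mulmx1 //; case: Og.
exact: H.
Qed.

Lemma root_co0 v : form v v = - 2 -> exists2 v', orbit_of v v' & co 0 v' != 0.
Proof.
move=> vv.
have [v0|] := eqVneq (co 0 v) 0; last by exists v => //; exact: orbit_refl.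
have [v2|n2] := eqVneq (co 2 v) 0; last first.
  by exists (swapUU v); [exact: orbit_swapUU|rewrite /swapUU co_vec].
have [v3|n3] := eqVneq (co 3 v) 0; last first.
  exists (swapUU (swapU1 v)); first exact: orbit_trans (orbit_swapU1 v) (orbit_swapUU _).
  by rewrite /swapUU co_vec //= /swapU1 co_vec.
have [v1|n1] := eqVneq (co 1 v) 0; last first.
  exists (swapUU (swapU1 (swapUU v))).
    exact: orbit_trans (orbit_trans (orbit_swapUU v) (orbit_swapU1 _)) (orbit_swapUU _).
  by rewrite /swapUU co_vec //= /swapU1 co_vec //= co_vec.
(* Here v is orthogonal to both planes; the transvection of v itself adds [- form v v *: bv 2], that
   is 2 in coordinate 2. *)
have [|c _ H] := @orbit_transvection 2 v v isT; first by rewrite form_bv.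
eexists; first exact: orbit_trans H (orbit_swapUU _).
by rewrite /swapUU co_vec //= form_bv //= !(coD, coN, coZ) v2 v3 vv co_bv //= !mul0r mulr0 mul0r.
Qed.

(** The minimal [co 0] divides every pairing, in particular the norm -2, so it is 1 or 2 up to the
    sign, which [negU] adjusts. *)
Lemma root_primitive v : form v v = - 2 -> exists v', orbit_of v v' /\
  ((co 0 v' = 1) \/ (co 0 v' = 2 /\ forall t, (2 %| form v' t)%Z)).
Proof.
move=> vv; have [u vu u0] := root_co0 vv; have [w uw mw] := minimal_exists u0.
have [x [wx x0 Hx]] := minimal_divides mw.
have vx := orbit_trans (orbit_trans vu uw) wx.
have xx : form x x = - 2 by rewrite (orbit_form vx).
have := Hx x; rewrite xx => d2.
have xneg : co 0 (negU x) = - co 0 x by rewrite /negU co_vec.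
have Hn := orbit_divides (orbit_negU x) Hx.
have vn := orbit_trans vx (orbit_negU x).
have : (absz (co 0 x) %| 2)%N by move: d2; rewrite dvdzE.
move=> /dvdn_leq => /(_ isT) le2.
have n0 : co 0 x != 0 by rewrite x0; case: mw.
move: xneg Hn; case Ex : (co 0 x) => [[|[|[|n]]]|[|[|n]]] xneg Hn; rewrite Ex /= in le2 n0 Hx => //.
- by exists x; split=> //; left.
- by exists x; split=> //; right.
- by exists (negU x); split=> //; left; rewrite xneg.
- exists (negU x); split=> //; right; split; first by rewrite xneg.
  by move=> t; have := Hn t; rewrite !dvdzE.
Qed.

(** If [co 0] is 1, a translation clears everything outside the first plane and the norm forces
    [co 1] to be -1. If it is 2, coordinates can only be reduced modulo 2: the unimodular ones are
    even and disappear, while those on the A1 summands become 0 or 1. The planes are finally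
    exchanged. *)
Lemma root_normal_form v : form v v = - 2 ->
  [\/ orbit_of v rho1, orbit_of v rho2 | exists i, orbit_of v (rho3 i)].
Proof.
move=> vv; have [w [vw H]] := root_primitive vv.
have ww : form w w = - 2 by rewrite (orbit_form vw).
case: H => [w0|[w0 Hw]].
  pose a := - (w - co 0 w *: bv 0 - co 1 w *: bv 1).
  have [||x wx [x0 xk]] := @orbit_translate w a.
  - by rewrite /a !(coD, coN, coZ) !co_bv //=; ring.
  - by rewrite /a !(coD, coN, coZ) !co_bv //=; ring.
  have xx : form x x = - 2 by rewrite (orbit_form wx).
  have {}xk k : (1 < k < 17)%N -> co k x = 0.
    move=> hk; have /andP[k1 k17] := hk.
    rewrite xk // /a !(coD, coN, coZ) !co_bv // w0.
    have /negbTE -> : (k != 0)%N by case: (k) k1.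
    have /negbTE -> : (k != 1)%N by case: (k) k1 => [|[]].
    by rewrite /=; ring.
  have x1 : co 1 x = - 1.
    by move: xx; rewrite formE x0 w0 (xk 2%N isT) (xk 3%N isT) (xk 4%N isT) (xk 5%N isT) (xk 6%N isT) (xk 7%N isT) (xk 8%N isT) (xk 9%N isT) (xk 10%N isT) (xk 11%N isT) (xk 12%N isT) (xk 13%N isT) (xk 14%N isT) (xk 15%N isT) (xk 16%N isT); lra.
  apply: Or31; apply: orbit_trans (orbit_trans vw wx) _.
  suff -> : rho1 = swapUU x by exact: orbit_swapUU.
  rewrite /swapUU x0 w0 x1 (xk 2%N isT) (xk 3%N isT) (xk 4%N isT) (xk 5%N isT) (xk 6%N isT) (xk 7%N isT) (xk 8%N isT) (xk 9%N isT) (xk 10%N isT) (xk 11%N isT) (xk 12%N isT) (xk 13%N isT) (xk 14%N isT) (xk 15%N isT) (xk 16%N isT).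
  apply: co_inj => k k17; rewrite /rho1 coD coN !co_bv // co_vec //.
  by do 17 (destruct k as [|k]; first by []).
pose a : latT := \row_i (if (1 < i)%N then - divz (w 0 i) 2 else 0).
have ca k : (k < 17)%N -> co k a = if (1 < k)%N then - (co k w %/ 2)%Z else 0.
  by move=> k17; rewrite /co mxE inordK.
have [||x wx [x0 xk]] := @orbit_translate w a; try by rewrite ca.
have xx : form x x = - 2 by rewrite (orbit_form wx).
have Hx := orbit_divides wx Hw.
have {}xk k : (1 < k < 17)%N -> co k x = (co k w %% 2)%Z.
  by move=> hk; have /andP[k1 k17] := hk; rewrite xk // ca // k1 w0 /modz; ring.
have x12 k : (1 < k < 12)%N -> co k x = 0.
  move=> /andP[k1 k12]; rewrite xk ?k1 ?(ltn_trans k12) //.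
  apply/dvdz_mod0P.
  have := Hw (dv k); rewrite -[dv k]ext_int form_dv ?k12 ?mul1r //.
  exact: ltn_trans k12 _.
have [p Ep] : exists p, co 1 x = 2 * p.
  by have /dvdzP[p] := Hx (bv 0); rewrite form_bv //= => ->; exists p; rewrite mulrC.
have eps k : (1 < k < 17)%N -> co k x = 0 \/ co k x = 1.
  move=> hk; rewrite xk //.
  have := @modz_ge0 (co k w) 2 isT; have := @ltz_pmod (co k w) 2 isT.
  by case: (_ %% _)%Z => [[|[|n]]|n] //; [left|right].
move: xx; rewrite formE x0 w0 Ep (x12 2%N isT) (x12 3%N isT) (x12 4%N isT) (x12 5%N isT) (x12 6%N isT) (x12 7%N isT) (x12 8%N isT) (x12 9%N isT) (x12 10%N isT) (x12 11%N isT) => {}xx.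
have vx := orbit_trans (orbit_trans vw wx) (orbit_swapUU x).
have fin (k1 e2 e3 e4 e5 e6 : int) : co 1 x = k1 -> co 12 x = e2 -> co 13 x = e3 ->
    co 14 x = e4 -> co 15 x = e5 -> co 16 x = e6 ->
    swapUU x = vec [:: 0; 0; 2; k1; 0; 0; 0; 0; 0; 0; 0; 0; e2; e3; e4; e5; e6].
  by move=> h1 h2 h3 h4 h5 h6; rewrite /swapUU x0 w0 h1 h2 h3 h4 h5 h6 (x12 2%N isT) (x12 3%N isT) (x12 4%N isT) (x12 5%N isT) (x12 6%N isT) (x12 7%N isT) (x12 8%N isT) (x12 9%N isT) (x12 10%N isT) (x12 11%N isT).
have fin3 (i : 'I_5) : swapUU x = vec [:: 0; 0; 2; 0; 0; 0; 0; 0; 0; 0; 0; 0;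
    (i == 0%N :> nat)%:R; (i == 1%N :> nat)%:R; (i == 2%N :> nat)%:R;
    (i == 3%N :> nat)%:R; (i == 4%N :> nat)%:R] -> exists i, orbit_of v (rho3 i).
  move=> E; exists i; suff -> : rho3 i = swapUU x by [].
  rewrite E; apply: co_inj => k k17; rewrite /rho3 coD coZ co_rA1 // co_bv // co_vec //.
  by case: i {E} => -[|[|[|[|[|]]]]] // ilt; do 17 (destruct k as [|k]; first by []).
have fin2 : swapUU x = vec [:: 0; 0; 2; 2; 0; 0; 0; 0; 0; 0; 0; 0; 1; 1; 1; 1; 1] -> orbit_of v rho2.
  move=> E; suff -> : rho2 = swapUU x by [].
  rewrite E; apply: co_inj => k k17; rewrite /rho2 !coD !coZ co_sum_rA1 // !co_bv // co_vec //.
  by do 17 (destruct k as [|k]; first by []).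
(* The norm equation: the number of coordinates equal to 1 is 1 modulo 4, hence one or five of
   them. *)
have hs : 4 * p + 1 = co 12 x + co 13 x + co 14 x + co 15 x + co 16 x.
  have sq k : (1 < k < 17)%N -> co k x * co k x = co k x.
    by move=> /eps[] ->; rewrite ?mulr0 ?mulr1.
  move: xx; rewrite (sq 12%N isT) (sq 13%N isT) (sq 14%N isT) (sq 15%N isT) (sq 16%N isT); lra.
have [e2|e2] := eps 12%N isT; have [e3|e3] := eps 13%N isT; have [e4|e4] := eps 14%N isT;
have [e5|e5] := eps 15%N isT; have [e6|e6] := eps 16%N isT;
rewrite e2 e3 e4 e5 e6 in hs; try (exfalso; lia).
- apply: Or33; apply: (@fin3 (@Ordinal 5 4 isT)); apply: fin => //; rewrite Ep; lia.
- apply: Or33; apply: (@fin3 (@Ordinal 5 3 isT)); apply: fin => //; rewrite Ep; lia.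
- apply: Or33; apply: (@fin3 (@Ordinal 5 2 isT)); apply: fin => //; rewrite Ep; lia.
- apply: Or33; apply: (@fin3 (@Ordinal 5 1 isT)); apply: fin => //; rewrite Ep; lia.
- apply: Or33; apply: (@fin3 (@Ordinal 5 0 isT)); apply: fin => //; rewrite Ep; lia.
- by apply: Or32; apply: fin2; apply: fin => //; rewrite Ep; lia.
Qed.

End Roots.

(** * Roots and isometries modulo 2T *)

Section Classes.
Implicit Types (u v x y t a r s : latT) (g h : 'M[int]_17) (i j k : 'I_5).

Lemma dual_half r : dualT (half r) <-> even_vec r.
Proof.
have E t : form (half r) (ext t) = 2^-1 * (form r t)%:~R :> rat.
  by rewrite /half formZl form_ext.
split=> H t; last first.
  have [k Ek] := H t; rewrite E Ek intrM mulrA mulVf // mul1r.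
  by apply/intrP; exists k.
have /intrP[k Ek] := H t; exists k; apply/eqP; rewrite -(eqr_int rat) intrM -Ek E.
by rewrite mulrA divff // mul1r.
Qed.

Lemma congT_half u v : congT (half u) (half v) <-> cong2 u v.
Proof.
have E t : (half u - half v = ext t) <-> (u - v = 2 *: t).
  split=> [h|h].
    apply/rowP => i; have := congr1 (fun A : 'rV[rat]_17 => A 0 i) h; rewrite !mxE => e.
    apply/eqP; rewrite -(eqr_int rat) intrB intrM -e; apply/eqP; by field.
  apply/rowP => i; have := congr1 (fun A : latT => A 0 i) h; rewrite !mxE => e.
  have {}e : (u 0 i)%:~R - (v 0 i)%:~R = 2 * (t 0 i)%:~R :> rat by rewrite -intrB e intrM.
  by rewrite -mulrBr e mulrA mulVf // mul1r.
by split=> -[t /E]; exists t.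
Qed.

Lemma sum_xi : \sum_i xi i = half (\sum_i rA1 i).
Proof.
rewrite /half /ext raddf_sum scaler_sumr; apply: eq_bigr => i _.
by rewrite /xi /half /ext.
Qed.

Lemma Delta1P r : Delta1 r <-> form r r = - 2 /\ ~ even_vec r.
Proof. by rewrite /Delta1 /= dual_half. Qed.
Lemma Delta2P r : Delta2 r <-> form r r = - 2 /\ cong2 r (\sum_i rA1 i).
Proof. by rewrite /Delta2 /= sum_xi congT_half. Qed.
Lemma Delta3P r : Delta3 r <-> form r r = - 2 /\ exists i, cong2 r (rA1 i).
Proof.
split=> -[h [i hi]]; split=> //; exists i; first exact/congT_half.
by move/congT_half: hi.
Qed.
Lemma Delta3aP r : Delta3a r <-> form r r = - 2 /\ exists i, i != ord0 /\ cong2 r (rA1 i).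
Proof.
split=> -[h [i [i0 hi]]]; split=> //; exists i; split=> //; first exact/congT_half.
by move/congT_half: hi.
Qed.
Lemma Delta3bP r : Delta3b r <-> form r r = - 2 /\ cong2 r (rA1 ord0).
Proof. by rewrite /Delta3b /= congT_half. Qed.

Lemma OTstarP g : OTstar g <-> OT g /\ cong2 (rA1 ord0 *m g) (rA1 ord0).
Proof.
rewrite /OTstar /=; have -> : xi ord0 *m ext g = half (rA1 ord0 *m g).
  by rewrite /half extM scalemxAl.
by rewrite congT_half.
Qed.

Lemma cong_rA1 i j : cong2 (rA1 i) (rA1 j) -> i = j.
Proof.
have i17 : (12 + i < 17)%N by rewrite (ltn_add2l 12 i 5).
move=> [t /(congr1 (co (12 + i)%N))]; rewrite coD coN coZ !co_rA1 // eqxx eqn_add2l.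
have [/ord_inj //|_] := eqVneq (i : nat) j.
by lia.
Qed.

Lemma rA1_cong_sum i : ~ cong2 (rA1 i) (\sum_j rA1 j).
Proof.
have [j ji] : exists j, j != i.
  by exists (if i == ord0 then ord_max else ord0); have [->|] := eqVneq i ord0; rewrite // eq_sym.
have j17 : (12 + j < 17)%N by rewrite (ltn_add2l 12 j 5).
move=> [t /(congr1 (co (12 + j)%N))]; rewrite coD coN coZ co_rA1 // co_sum_rA1 //.
rewrite eqn_add2l leq_addr (_ : (j == i :> nat) = false); last exact: negbTE.
by move=> h; lia.
Qed.

Lemma form_rA1_rA1 i j : form (rA1 i) (rA1 j) = - 2 * (i == j)%:R.
Proof.
have j17 : (12 + j < 17)%N by rewrite (ltn_add2l 12 j 5).
by rewrite form_rA1 co_rA1 // eqn_add2l eq_sym.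
Qed.

Lemma orbit_cong v v' : orbit_of v v' -> even_vec v' -> cong2 v v'.
Proof.
move=> [g Sg ->] Hv; have Si := stable_inv Sg.
have := Si.2 _ Hv; rewrite -mulmxA mulmxV ?mulmx1; first exact: id.
by case: Sg => -[].
Qed.

Lemma orbit_even v v' : orbit_of v v' -> even_vec v -> even_vec v'.
Proof. by move=> [g [Og _] ->]; exact: even_mul. Qed.

Lemma rho1_not_even : ~ even_vec rho1.
Proof.
move=> /(_ (bv 2))[k]; rewrite form_bv // /rho1 /= coD coN !co_bv //=; lia.
Qed.

Lemma rho2_cong : cong2 rho2 (\sum_i rA1 i).
Proof. by exists (bv 2 + bv 3); rewrite /rho2 addrK scalerDr. Qed.
Lemma rho3_cong i : cong2 (rho3 i) (rA1 i).
Proof. by exists (bv 2); rewrite /rho3 addrK. Qed.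
Lemma rho2_even : even_vec rho2.
Proof. exact: even_cong even_sum_rA1 (cong2_sym rho2_cong). Qed.
Lemma rho3_even i : even_vec (rho3 i).
Proof. exact: even_cong (even_rA1 i) (cong2_sym (rho3_cong i)). Qed.

Lemma root_class v : form v v = - 2 ->
  [\/ ~ even_vec v /\ orbit_of v rho1,
      cong2 v (\sum_i rA1 i) /\ orbit_of v rho2
    | exists i, cong2 v (rA1 i) /\ orbit_of v (rho3 i)].
Proof.
move=> /root_normal_form[h|h|[i h]].
- by apply: Or31; split=> // /(orbit_even h); exact: rho1_not_even.
- by apply: Or32; split=> //; apply: cong2_trans (orbit_cong h rho2_even) rho2_cong.
- apply: Or33; exists i; split=> //.
  exact: cong2_trans (orbit_cong h (rho3_even i)) (rho3_cong i).
Qed.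

Lemma cong_even_sum v : cong2 v (\sum_i rA1 i) -> even_vec v.
Proof. by move=> /cong2_sym; exact: even_cong even_sum_rA1. Qed.
Lemma cong_even_rA1 v i : cong2 v (rA1 i) -> even_vec v.
Proof. by move=> /cong2_sym; exact: even_cong (even_rA1 i). Qed.

Lemma root_orbit1 v : form v v = - 2 -> ~ even_vec v -> orbit_of v rho1.
Proof.
move=> /root_class[[]//|[/cong_even_sum//]|[i [/cong_even_rA1//]]].
Qed.
Lemma root_orbit2 v : form v v = - 2 -> cong2 v (\sum_i rA1 i) -> orbit_of v rho2.
Proof.
move=> /root_class[[ne _] /cong_even_sum//|[]//|[i [h _]] h'].
by case: (@rA1_cong_sum i); apply: cong2_trans (cong2_sym h) h'.
Qed.
Lemma root_orbit3 v i : form v v = - 2 -> cong2 v (rA1 i) -> orbit_of v (rho3 i).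
Proof.
move=> /root_class[[ne _] /cong_even_rA1//|[h _] h'|[j [h o]] h'].
  by case: (@rA1_cong_sum i); apply: cong2_trans (cong2_sym h') h.
by rewrite (cong_rA1 (cong2_trans (cong2_sym h') h)).
Qed.

(** The images of the [rA1 i] are pairwise orthogonal roots in twice the dual lattice, each in the
    class of some [rA1 j] or of the sum. The class of the sum is excluded modulo 4: its pairing with
    any of these classes is -2 or -10, not 0. Two images in the same class would likewise pair to -2
    modulo 4. *)
Lemma perm_class g : OT g -> exists2 s : 'I_5 -> 'I_5, injective s &
  forall i, cong2 (rA1 i *m g) (rA1 (s i)).
Proof.
move=> Og.
have ev i : even_vec (rA1 i *m g) by apply: even_mul => //; exact: even_rA1.
have rt i : form (rA1 i *m g) (rA1 i *m g) = - 2.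
  by rewrite OT_form // form_rA1_rA1 eqxx mulr1.
have orth i j : i != j -> form (rA1 i *m g) (rA1 j *m g) = 0.
  by move=> ij; rewrite OT_form // form_rA1_rA1 (negbTE ij) mulr0.
have sum5 j : form (\sum_i rA1 i) (rA1 j) = - 2.
  rewrite form_suml (bigD1 j) //= big1 => [|i ij]; rewrite form_rA1_rA1 ?eqxx ?mulr1 ?addr0 //.
  by rewrite (negbTE ij) mulr0.
have sumsum : form (\sum_i rA1 i) (\sum_i rA1 i) = - 10.
  rewrite form_suml (eq_bigr (fun _ => - 2)) => [|k _]; last by rewrite formC sum5.
  by rewrite sumr_const card_ord.
have H i : exists j, cong2 (rA1 i *m g) (rA1 j).
  have [[/(_ (ev i))//]|[h _]|[j [h _]]] := root_class (rt i); last by exists j.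
  exfalso; have [j ji] : exists j, j != i.
    by exists (if i == ord0 then ord_max else ord0); have [->|] := eqVneq i ord0; rewrite // eq_sym.
  have [a Ea] := form_cong4 (ev j) h.
  rewrite orth in Ea; last by rewrite eq_sym.
  have [[/(_ (ev j))//]|[h' _]|[l [h' _]]] := root_class (rt j).
    have [b hb] := form_cong4 even_sum_rA1 h'.
    by move: Ea; rewrite formC hb sumsum; lia.
  have [b hb] := form_cong4 even_sum_rA1 h'.
  by move: Ea; rewrite formC hb (formC (rA1 l)) sum5; lia.
have [s Hs] := choice H; exists s => // i j sij; apply/eqP; apply: contraT => ij.
have := Hs j; rewrite -sij => hj.
have [a Ea] := form_cong4 (ev j) (Hs i).
have [b Eb] := form_cong4 (even_rA1 (s i)) hj.
rewrite orth // formC Eb form_rA1_rA1 eqxx in Ea.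
by exfalso; lia.
Qed.

Lemma sum_stable g : OT g -> cong2 ((\sum_i rA1 i) *m g) (\sum_i rA1 i).
Proof.
move=> /perm_class[s si Hs]; rewrite mulmx_suml.
have -> : \sum_i rA1 i = \sum_i rA1 (s i).
  by rewrite (reindex_inj si).
have /choice[t Ht] : forall i, exists t, rA1 i *m g - rA1 (s i) = 2 *: t by exact: Hs.
exists (\sum_i t i); rewrite -sumrB scaler_sumr; apply: eq_bigr => i _; exact: Ht.
Qed.

(** The reflection x + (x, v) / 2 v, integral because v pairs evenly. Its matrix is given through
    its double, so the formula transfers to any ring without dividing. *)
Lemma reflection v : form v v = - 4 -> even_vec v -> exists2 g, OT g &
  g + g = (2 : int)%:M + gramT *m v^T *m v.
Proof.
move=> vv ev.
pose f x := x + divz (form x v) 2 *: v.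
have fE x : form x v = 2 * divz (form x v) 2.
  by have [k Ek] := ev x; rewrite formC Ek mulKz.
have lf (b : int) x y : f (b *: x + y) = b *: f x + f y.
  have -> : f (b *: x + y) = b *: x + y + (b * divz (form x v) 2 + divz (form y v) 2) *: v.
    rewrite /f; congr (_ + _ *: _); apply: (@mulfI _ (2 : int)) => //.
    by rewrite -fE formDl formZl mulrDr -fE mulrCA -fE.
  by rewrite /f scalerDr scalerDl scalerA addrACA.
have E := gmxE lf; exists (gmx f).
  apply: OT_iso => x y; rewrite !E /f; have := fE x; have := fE y.
  move: (divz (form x v) 2) (divz (form y v) 2) => p q Eq Ep.
  by rewrite !formlinE (formC v y) vv Eq Ep; ring.
apply/row_matrixP => i; rewrite !rowE mulmxDr E /f mulmxDr !mulmxA.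
set x := delta_mx 0 i; rewrite addrACA -mulr2n -scaler_nat mul_mx_scalar; congr (_ + _).
have -> : x *m gramT *m v^T = (form x v)%:M.
  by rewrite [LHS]mx11_scalar /form !ext_int.
have := fE x; move: (divz (form x v) 2) => p ->.
by rewrite mul_scalar_mx -scalerDl; congr (_ *: _); ring.
Qed.

Lemma reflection_act v g (K : comNzRingType) (x : 'rV[K]_17) :
  g + g = (2 : int)%:M + gramT *m v^T *m v ->
  2 *: (x *m ext g) = 2 *: x + form x (ext v) *: ext v.
Proof.
move=> /(congr1 (fun A : 'M[int]_17 => x *m ext A)).
rewrite !extD !extM !mulmxDr !mulmxA => E.
rewrite -[2]/(2%:R) scaler_nat mulr2n E; congr (_ + _).
  have -> : ext (2 : int)%:M = (2 : K)%:M :> 'M[K]_17.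
    by apply/matrixP => i j; rewrite !mxE; case: (i == j).
  by rewrite mul_mx_scalar.
have -> : x *m ext gramT *m ext v^T = (form x (ext v))%:M.
  by rewrite [LHS]mx11_scalar /form /ext map_trmx.
by rewrite mul_scalar_mx.
Qed.

Lemma reflection_int v g x : g + g = (2 : int)%:M + gramT *m v^T *m v ->
  2 *: (x *m g) = 2 *: x + form x v *: v.
Proof. by move=> /(reflection_act (x : 'rV[int]_17)); rewrite !ext_int. Qed.

Lemma scale2_inj u v : 2 *: u = 2 *: v -> u = v.
Proof.
move=> E; apply: co_inj => k _; apply: (@mulfI _ (2 : int)) => //.
by rewrite -!coZ E.
Qed.

(** The reflection in the difference of [rA1 ord0] and [rA1 k], a vector of norm -4 with even
    pairings. *)
Lemma transposition k : exists2 p, OT p &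
  [/\ rA1 k *m p = rA1 ord0, rA1 ord0 *m p = rA1 k &
      forall j, j != k -> j != ord0 -> rA1 j *m p = rA1 j].
Proof.
have [->|k0] := eqVneq k ord0.
  by exists 1%:M; [exact: OT_1|split=> [||j _ _]; rewrite mulmx1].
pose v := rA1 ord0 - rA1 k.
have F i j : form (rA1 i) (rA1 j) = - 2 * (i == j)%:R by exact: form_rA1_rA1.
have k0' : (ord0 == k) = false by rewrite eq_sym (negbTE k0).
have vv : form v v = - 4 by rewrite /v !formlinE !F !eqxx (negbTE k0) k0'; lia.
have ev : even_vec v.
  move=> t; have [a Ea] := @even_rA1 ord0 t; have [b Eb] := @even_rA1 k t.
  by exists (a - b); rewrite /v formBl Ea Eb; ring.
have [g Og Eg] := reflection vv ev; exists g => //.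
have A x := reflection_int x Eg.
split=> [||j jk j0]; apply: scale2_inj; rewrite A /v formBr !F ?eqxx ?(negbTE k0) ?k0'.
- by apply: co_inj => l _; rewrite /= !(coD, coN, coZ); ring.
- by apply: co_inj => l _; rewrite /= !(coD, coN, coZ); ring.
by rewrite (negbTE jk) (negbTE j0) mulr0 subrr scale0r addr0.
Qed.

(** Being orthogonal to the orthogonal of r, the image of r is d r with d = 1 or -1. For u with
    pairing 2 k with r, u + k r is orthogonal to r, so u goes to e u + k (e - d) r; as e is odd and
    e - d even, this is u modulo 2T. *)
Lemma scalar_on_orthogonal_trivial g r (e : int) : OT g -> form r r = - 2 -> e ^+ 2 = 1 ->
  (forall x, form x r = 0 -> x *m g = e *: x) ->
  forall u, even_vec u -> cong2 (u *m g) u.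
Proof.
move=> Og rr ee H u eu.
have par (d : int) : d ^+ 2 = 1 -> exists n : int, d = 1 + 2 * n.
  move=> /eqP; rewrite -subr_eq0 subr_sqr_1 mulf_eq0 => /orP[|] /eqP h.
    by exists 0; lia.
  by exists (- 1); lia.
pose y := r *m g; pose c := form y r.
have perp t : form (2 *: t + form t r *: r) r = 0 by rewrite !formlinE rr; ring.
have yperp x : form x r = 0 -> form y x = 0.
  move=> xr; have : form y (x *m g) = 0 by rewrite /y OT_form // formC.
  rewrite H // formZr => /eqP; rewrite mulf_eq0 => /orP[/eqP e0|/eqP //].
  by move: ee; rewrite e0 expr0n => /eqP; rewrite eq_sym oner_eq0.
have E : 2 *: y + c *: r = 0.
  apply: form_nondeg => t; rewrite ext_int.
  have := yperp _ (perp t); rewrite !formlinE => h.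
  by rewrite -h /c (formC t r); ring.
have yy : form y y = - 2 by rewrite /y OT_form.
have yE : 2 *: y = - c *: r by rewrite scaleNr; apply/eqP; rewrite -addr_eq0 E.
have c4 : c ^+ 2 = 4.
  have : form (2 *: y) (2 *: y) = form (- c *: r) (- c *: r) by rewrite yE.
  rewrite !formZl !formZr yy rr; lia.
have [d dd yd] : exists2 d : int, d ^+ 2 = 1 & y = d *: r.
  move: c4 => /eqP; rewrite -subr_eq0 (_ : 4 = 2 ^+ 2) // subr_sqr mulf_eq0.
  move=> /orP[|] /eqP h.
    exists (- 1) => //; apply: scale2_inj; rewrite yE scalerA; congr (_ *: _); lia.
  exists 1 => //; apply: scale2_inj; rewrite yE scalerA; congr (_ *: _); lia.
have [k Ek] := eu r.
have up : form (u + k *: r) r = 0 by rewrite !formlinE Ek rr; ring.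
have := H _ up; rewrite mulmxDl -scalemxAl -/y yd => h.
have ug : u *m g = e *: u + (k * (e - d)) *: r.
  have -> : u *m g = e *: (u + k *: r) - k *: (d *: r) by rewrite -h addrK.
  by apply: co_inj => j _; rewrite !(coD, coN, coZ); ring.
have [a Ea] := par e ee; have [b Eb] := par d dd.
exists (a *: u + (k * (a - b)) *: r).
by rewrite ug Ea Eb; apply: co_inj => j _; rewrite !(coD, coN, coZ); ring.
Qed.

End Classes.

(** * Very general points *)

Lemma ext_scale (K : comNzRingType) (a : int) (x : latT) :
  ext (a *: x) = a%:~R *: ext x :> 'rV[K]_17.
Proof. by apply: co_inj => k _; rewrite coZ !co_ext coZ intrM. Qed.

Lemma ext_sum (K : comNzRingType) (I : Type) (s : seq I) (F : I -> latT) :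
  ext (\sum_(i <- s) F i) = \sum_(i <- s) ext (F i) :> 'rV[K]_17.
Proof. by rewrite /ext raddf_sum. Qed.

Section VeryGeneral.
Variable R : realType.
Notation C := (CC R).
Notation VC := 'rV[CC R]_17.
Implicit Types (x : latT) (g : 'M[int]_17).

Lemma countable_real_avoid (B : set R) : countable B -> exists t, ~ B t.
Proof.
move=> cB; apply: contrapT => /forallNP H.
have : countable `[0 : R, 1]%classic.
  by apply: sub_countable cB; apply: subset_card_le => t _; apply: contrapT => /H.
move=> /countable_lebesgue_measure0; rewrite lebesgue_measure_itv /= lte_fin ltr01 oppr0 adde0.
by move=> /eqP; rewrite eqe oner_eq0.
Qed.

Lemma poly_zeros_finite (P : {poly C}) : P != 0 -> finite_set [set t : R | P.[rc t] = 0].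
Proof.
move=> P0; have [rs Ers] := closed_field_poly_normal P.
apply: (@sub_finite_set _ _ [set` map (@cRe R) rs]); last by apply/finite_seqP; eexists.
move=> t /= /eqP; rewrite -/(root P (rc t)) Ers rootZ ?lead_coef_eq0 // root_prod_XsubC => ht.
by apply/mapP; exists (rc t).
Qed.

Variable r : latT.
Hypotheses (r0 : co 0 r = 0) (r1 : co 1 r = 0) (rr : form r r = - 2).

(* twice the orthogonal projection to the complement of r *)
Definition proj x : latT := 2 *: x + form x r *: r.

Lemma proj_orth x : form (proj x) r = 0.
Proof. by rewrite /proj !formlinE rr; ring. Qed.

Lemma proj_norm x : form (proj x) (proj x) = 4 * form x x + 2 * form x r ^+ 2.
Proof. by rewrite /proj !formlinE (formC r x) rr; ring. Qed.

Lemma co_proj k x : (k < 2)%N -> co k (proj x) = 2 * co k x.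
Proof. by case: k => [|[|]] // _; rewrite /proj coD !coZ ?r0 ?r1 mulr0 addr0. Qed.

(** A vector of positive norm orthogonal to r: projecting a vector of positive norm along the
    negative vector r increases its norm. *)
Definition ypos : latT := proj (bv 2 + bv 3).

Lemma ypos_pos : 0 < form ypos ypos.
Proof.
have -> : form ypos ypos = 4 * form (bv 2 + bv 3) (bv 2 + bv 3) + 2 * form (bv 2 + bv 3) r ^+ 2.
  exact: proj_norm.
have -> : form (bv 2 + bv 3) (bv 2 + bv 3) = 2.
  by rewrite !formDl !formDr !form_bv // !co_bv.
by rewrite ltr_wpDr // mulr_ge0 // sqr_ge0.
Qed.

(** At a real parameter the curve has imaginary part [ypos], so it stays in the tube domain. Degrees
    1 to 15 carry the projections of [bv 2] to [bv 16]. The top coefficient [ypos] gives the norm of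
    the curve degree 32 with nonzero leading coefficient, which isolates the value of a functional
    at [bv 1]. *)
Definition curve_coef (k : nat) : VC :=
  if k == 0 then ii R *: ext ypos else if (k < 16)%N then ext (proj (bv k.+1)) else ext ypos.

Definition curve (s : C) : VC := \sum_(k < 17) s ^+ k *: curve_coef k.

Lemma co_curve_coef j k : (j < 2)%N -> co j (curve_coef k) = 0.
Proof.
move=> j2; have j17 : (j < 17)%N by exact: ltn_trans j2 _.
have y0 : co j ypos = 0.
  rewrite /ypos co_proj // coD !co_bv //.
  by case: j j2 j17 => [|[|]].
rewrite /curve_coef; case: ifP => [_|k0]; first by rewrite coZ co_ext y0 mulr0.
case: ifP => _; rewrite co_ext ?y0 // co_proj // co_bv //.
by case: j j2 {j17 y0} => [|[|]] // _; case: k k0.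
Qed.

Lemma co_sumv (I : Type) (s : seq I) (F : I -> VC) k :
  co k (\sum_(i <- s) F i) = \sum_(i <- s) co k (F i).
Proof. by elim/big_rec2: _ => [|i a b _ <-]; rewrite ?co_0 ?coD. Qed.

Lemma co_curve j s : (j < 2)%N -> co j (curve s) = 0.
Proof.
by move=> j2; rewrite /curve co_sumv big1 // => k _; rewrite coZ co_curve_coef // mulr0.
Qed.

Lemma curve_coef_orth k : form (ext r) (curve_coef k) = 0.
Proof.
rewrite formC /curve_coef; case: ifP => _; last case: ifP => _; rewrite ?formZl form_ext proj_orth.
all: by rewrite ?mulr0.
Qed.

Lemma form_curve v s : form (curve s) v = \sum_(k < 17) s ^+ k * form (curve_coef k) v.
Proof. by rewrite /curve form_suml; apply: eq_bigr => k _; rewrite formZl. Qed.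

Lemma curve_orth s : form (ext r) (curve s) = 0.
Proof.
by rewrite formC form_curve big1 // => k _; rewrite formC curve_coef_orth mulr0.
Qed.

Lemma curve_Im (s : R) : vIm (curve (rc s)) = ext ypos.
Proof.
have E : curve (rc s) = vrc (\sum_(k < 16) s ^+ k.+1 *: (if (k.+1 < 16)%N then
    ext (proj (bv k.+2)) else ext ypos)) + ii R *: vrc (ext ypos).
  rewrite /curve big_ord_recl expr0 scale1r addrC vrc_ext; congr (_ + _).
  rewrite /vrc raddf_sum; apply: eq_bigr => k _.
  rewrite /curve_coef /= -[map_mx _ _]/(vrc _); apply: co_inj => j _.
  rewrite coZ co_vrc coZ rmorphM rmorphXn /=; congr (_ * _).
  by rewrite fun_if !co_ext (fun_if (co j)) !co_ext; case: ifP; rewrite rmorph_int.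
by rewrite E vIm_vrc.
Qed.

Lemma curve_Dc (s : R) : Dc (tube (curve (rc s))).
Proof.
apply/tube_Dc; rewrite ?co_curve // curve_Im form_ext.
by rewrite ltr0z ypos_pos.
Qed.

Section Functional.
Variable lam : 'cV[C]_17.
Let L (v : VC) : C := (v *m lam) 0 0.

Let LD u v : L (u + v) = L u + L v. Proof. by rewrite /L mulmxDl mxE. Qed.
Let LZ a v : L (a *: v) = a * L v. Proof. by rewrite /L -scalemxAl mxE. Qed.
Let LN v : L (- v) = - L v. Proof. by rewrite /L mulNmx mxE. Qed.
Let L0 : L 0 = 0. Proof. by rewrite /L mul0mx mxE. Qed.
Let Lsum (I : Type) (s : seq I) (F : I -> VC) : L (\sum_(i <- s) F i) = \sum_(i <- s) L (F i).
Proof. by elim/big_rec2: _ => [|i a b _ <-]; rewrite ?L0 ?LD. Qed.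

Definition curve_poly : {poly C} :=
  (L (ext (bv 0)))%:P + \sum_(k < 17) L (curve_coef k) *: 'X^k
  - (L (ext (bv 1)) / 2) *: \sum_(j < 17) \sum_(k < 17) form (curve_coef j) (curve_coef k) *: 'X^(j + k).

Lemma curve_polyE s : curve_poly.[s] = L (tube (curve s)).
Proof.
have h1 : (\sum_(k < 17) L (curve_coef k) *: 'X^k).[s] = L (curve s).
  rewrite horner_sum /curve Lsum; apply: eq_bigr => k _.
  by rewrite LZ hornerZ hornerXn mulrC.
have h2 : (\sum_(j < 17) \sum_(k < 17) form (curve_coef j) (curve_coef k) *: 'X^(j + k)).[s]
    = form (curve s) (curve s).
  rewrite horner_sum form_curve; apply: eq_bigr => j _.
  rewrite horner_sum formC form_curve mulr_sumr; apply: eq_bigr => k _.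
  by rewrite hornerZ hornerXn exprD formC; ring.
rewrite /curve_poly !(hornerD, hornerN, hornerC) hornerZ h1 h2 /tube !(LD, LN, LZ).
by congr (_ - _); rewrite mulrAC -mulrA mulrC.
Qed.

(** The coefficients are read from the top: degree 32 gives the value at [bv 1], the positive
    degrees up to 16 those at the projections and at [ypos], degree 0 then the value at [bv 0].
    Twice any vector orthogonal to r is a combination of projections of basis vectors. *)
Lemma curve_poly_eq0 : curve_poly = 0 -> forall x, form x r = 0 -> L (ext x) = 0.
Proof.
move=> P0.
have cf (n : nat) : L (ext (bv 0)) * (n == 0%N)%:R + (\sum_(k < 17) L (curve_coef k) * (n == k :> nat)%:R)
   - L (ext (bv 1)) / 2 * (\sum_(j < 17) \sum_(k < 17) form (curve_coef j) (curve_coef k) * (n == (j + k)%N)%:R) = 0.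
  have := congr1 (fun P : {poly C} => P`_n) P0; rewrite /curve_poly coef0 coefB coefD coefC coefZ.
  rewrite !coef_sum; apply: etrans; congr (_ + _ - _ * _).
  - by case: (n == 0%N); rewrite ?mulr1 ?mulr0.
  - by apply: eq_bigr => k _; rewrite coefZ coefXn.
  - by apply: eq_bigr => j _; rewrite coef_sum; apply: eq_bigr => k _; rewrite coefZ coefXn.
have e1 : L (ext (bv 1)) = 0.
  have := cf 32%N; rewrite mulr0 add0r big1 ?add0r => [|k _]; last first.
    by rewrite gtn_eqF ?mulr0 // (ltn_trans (ltn_ord k)).
  rewrite (bigD1 ord_max) //= (bigD1 ord_max) //= big1 => [|k kn]; last first.
    rewrite gtn_eqF ?mulr0 // (_ : 32 = 16 + 16)%N // ltn_add2l ltn_neqAle.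
    by rewrite -ltnS ltn_ord andbT; apply: contra kn => /eqP h; apply/eqP/val_inj.
  rewrite big1 => [|j jn]; last first.
    rewrite big1 // => k _; rewrite gtn_eqF ?mulr0 // (_ : 32 = 16 + 16)%N //.
    have j16 : (j < 16)%N.
      rewrite ltn_neqAle -ltnS ltn_ord andbT; apply: contra jn => /eqP h; apply/eqP/val_inj.
      exact: h.
    by rewrite -addSn leq_add // -ltnS.
  rewrite /curve_coef /= !addr0 mulr1 form_ext => /eqP; rewrite oppr_eq0 !mulf_eq0.
  rewrite invr_eq0 pnatr_eq0 orbF intr_eq0 (gt_eqF ypos_pos) orbF => /eqP //.
have ek (k : 'I_17) : (0 < k)%N -> L (curve_coef k) = 0.
  move=> k0; have := cf (k : nat); rewrite e1 !mul0r subr0 gtn_eqF // mulr0 add0r (bigD1 k) //= eqxx mulr1.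
  rewrite big1 ?addr0 // => j jk; rewrite (_ : (k == j :> nat) = false) ?mulr0 //.
  by apply/negbTE; apply: contra jk => /eqP h; apply/eqP/val_inj.
have ey : L (ext ypos) = 0 by have := ek (@Ordinal 17 16 isT) isT.
have e0 : L (ext (bv 0)) = 0.
  have := cf 0%N; rewrite e1 !mul0r subr0 mulr1 big_ord_recl mulr1 big1 ?addr0.
    by rewrite /curve_coef /= LZ ey mulr0 addr0.
  by move=> k _; rewrite mulr0.
have eb k : (k < 17)%N -> L (ext (proj (bv k))) = 0.
  case: k => [|[|k]] k17.
  - have -> : proj (bv 0) = 2 *: bv 0 by rewrite /proj formC form_bv //= r1 scale0r addr0.
    by rewrite ext_scale LZ e0 mulr0.
  - have -> : proj (bv 1) = 2 *: bv 1 by rewrite /proj formC form_bv //= r0 scale0r addr0.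
    by rewrite ext_scale LZ e1 mulr0.
  have k17' : (k.+1 < 17)%N by exact: ltnW.
  have := ek (Ordinal k17') isT; rewrite /curve_coef /=.
  by have -> : (k.+1 < 16)%N by [].
move=> x xr.
have E : 2 *: x = \sum_(k < 17) co k x *: proj (bv k).
  have xE : x = \sum_(k < 17) co k x *: bv k.
    rewrite [LHS]row_sum_delta; apply: eq_bigr => k _; rewrite /co inord_val; congr (_ *: _).
    apply: co_inj => j j17; rewrite co_bv // /co mxE eqxx andTb; congr ((nat_of_bool _)%:R).
    by rewrite -(inj_eq val_inj) /= inordK.
  transitivity (2 *: x + form x r *: r); first by rewrite xr scale0r addr0.
  rewrite {1 2}xE scaler_sumr form_suml scaler_suml -big_split; apply: eq_bigr => k _.
  by rewrite /proj formZl scalerDr !scalerA mulrC.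
have : L (ext (2 *: x)) = 0.
  rewrite E ext_sum Lsum big1 // => k _.
  by rewrite ext_scale LZ eb ?mulr0.
by rewrite ext_scale LZ => /eqP; rewrite mulf_eq0 intr_eq0 => /eqP.
Qed.

End Functional.

(** Along the curve, a functional that does not vanish on the orthogonal of r is a nonzero
    polynomial; countably many of them exclude countably many parameters. *)
Lemma very_general_functional (E : set 'cV[C]_17) : countable E ->
  exists w, [/\ Dc w, form (ext r) w = 0 & forall lam, E lam -> w *m lam = 0 ->
    forall x, form x r = 0 -> (ext x : VC) *m lam = 0].
Proof.
move=> cE.
pose bad (lam : 'cV[C]_17) := [set t : R | tube (curve (rc t)) *m lam = 0 /\
  ~ forall x, form x r = 0 -> (ext x : VC) *m lam = 0].
have [|t nt] := @countable_real_avoid (\bigcup_(lam in E) bad lam).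
  apply: bigcup_countable => // lam _; apply: finite_set_countable.
  have [P0|P0] := eqVneq (curve_poly lam) 0.
    apply: (@sub_finite_set _ _ set0) => // t [_]; apply => x xr.
    by rewrite [LHS]mx11_scalar (curve_poly_eq0 P0 xr) raddf0.
  apply: sub_finite_set (poly_zeros_finite P0) => t [h _] /=.
  by rewrite curve_polyE h mxE.
exists (tube (curve (rc t))); split; first exact: curve_Dc.
  by rewrite form_r_tube // curve_orth.
move=> lam El h; apply: contrapT => nh; apply: nt; exists lam => //.
Qed.

(** Two countable families of functionals: pairings with lattice vectors, and columns of g - c,
    where g is an integral matrix and c one of its finitely many eigenvalues. Hence an eigenvector
    relation at w holds on the whole orthogonal of r. *)
Lemma very_general_point : exists w : VC, [/\ Dc w, form (ext r) w = 0,
  forall s : latT, form (ext s) w = 0 -> forall x, form x r = 0 -> form x s = 0 &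
  forall g c, OT g -> w *m ext g = c *: w -> exists2 e : int, e ^+ 2 = 1 &
    forall x, form x r = 0 -> x *m g = e *: x].
Proof.
pose ev g : seq C := sval (closed_field_poly_normal (char_poly (ext g : 'M[C]_17))).
pose E1 : set 'cV[C]_17 := \bigcup_(s in [set: latT]) [set ext gramT *m (ext s)^T].
pose E2 : set 'cV[C]_17 := \bigcup_(g in [set: 'M[int]_17]) \bigcup_(c in [set` ev g])
  \bigcup_(j in [set: 'I_17]) [set col j ((ext g : 'M[C]_17) - c%:M)].
have cE : countable (\bigcup_(b in [set: bool]) (if b then E1 else E2)).
  apply: bigcup_countable => // -[] _.
    by apply: bigcup_countable => // s _; exact: countable1.
  apply: bigcup_countable => // g _; apply: bigcup_countable => [|c _].
    by apply: finite_set_countable; apply/finite_seqP; eexists.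
  by apply: bigcup_countable => // j _; exact: countable1.
have [w [Dw rw H]] := very_general_functional cE.
exists w; split=> //.
  move=> s sw x xr; have /(_ _ _ x xr) := H (ext gramT *m (ext s)^T).
  have h : w *m (ext gramT *m (ext s)^T) = 0.
    rewrite mulmxA [LHS]mx11_scalar -[_ 0 0]/(form w (ext s)) formC sw.
    by rewrite raddf0.
  move=> /(_ _ h) h'.
  have {}h' : (ext x : VC) *m (ext gramT *m (ext s)^T) = 0 by apply: h'; exists true => //; exists s.
  have : form (ext x : VC) (ext s) = 0 by rewrite /form -mulmxA h' mxE.
  by rewrite form_ext => /eqP; rewrite intr_eq0 => /eqP.
move=> g c Og wg.
have c_ev : c \in ev g.
  have : eigenvalue (ext g : 'M[C]_17) c.
    by apply/eigenvalueP; exists w => //; exact: Dc_neq0.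
  rewrite eigenvalue_root_char /ev; case: closed_field_poly_normal => rs /= ->.
  by rewrite rootZ ?root_prod_XsubC // lead_coef_eq0 monic_neq0 // char_poly_monic.
have Hx x : form x r = 0 -> (ext (x *m g) : VC) = c *: ext x.
  move=> xr; rewrite extM; apply/eqP; rewrite -subr_eq0; apply/eqP.
  have -> : ext x *m ext g - c *: ext x = (ext x : VC) *m ((ext g : 'M[C]_17) - c%:M).
    by rewrite mulmxBr mul_mx_scalar.
  apply/matrixP => i j; rewrite [RHS]mxE.
  have -> : (ext x *m ((ext g : 'M[C]_17) - c%:M)) i j =
     ((ext x : VC) *m col j ((ext g : 'M[C]_17) - c%:M)) 0 0.
    by rewrite ord1 !mxE; apply: eq_bigr => k _; rewrite !mxE.
  rewrite H ?mxE //; first by exists false => //; exists g => //; exists c => //; exists j.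
  by rewrite colE mulmxA mulmxBr mul_mx_scalar wg subrr mul0mx.
have yr : form ypos r = 0 by exact: proj_orth.
(* The isometry g multiplies by c a vector of nonzero norm. *)
have c2 : c ^+ 2 = 1.
  have := OT_form ypos ypos Og => h.
  have : form (ext (ypos *m g) : VC) (ext (ypos *m g)) = form (ext ypos) (ext ypos).
    by rewrite !form_ext h.
  rewrite Hx // formZl formZr mulrA -expr2 form_ext -[RHS]mul1r.
  by apply: mulIf; rewrite intr_eq0 gt_eqF // ypos_pos.
have [e ee ce] : exists2 e : int, e ^+ 2 = 1 & c = e%:~R.
  move: c2 => /eqP; rewrite -subr_eq0 subr_sqr_1 mulf_eq0 => /orP[|].
    by rewrite subr_eq0 => /eqP ->; exists 1.
  by rewrite addr_eq0 => /eqP ->; exists (- 1) => //; rewrite rmorphN.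
exists e => // x xr; apply: co_inj => k k17.
have := congr1 (co k) (Hx x xr); rewrite coZ !co_ext ce -intrM => /eqP.
by rewrite eqr_int coZ => /eqP.
Qed.

End VeryGeneral.

(** * Irreducible components *)

Lemma root_in_line (r y : latT) : form r r = - 2 -> form y y = - 2 ->
  (forall x, form x r = 0 -> form x y = 0) -> y = r \/ y = - r.
Proof.
move=> rr yy H; pose c := form r y.
have E : 2 *: y + c *: r = 0.
  apply: form_nondeg => t; rewrite ext_int.
  have : form (2 *: t + form t r *: r) y = 0 by apply: H; rewrite !formlinE rr; ring.
  by rewrite !formlinE (formC y t) (formC r t) -/c => <-; ring.
have yE : 2 *: y = - c *: r by rewrite scaleNr; apply/eqP; rewrite -addr_eq0 E.
have c4 : c ^+ 2 = 4.
  have : form (2 *: y) (2 *: y) = form (- c *: r) (- c *: r) by rewrite yE.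
  rewrite !formZl !formZr yy rr; lia.
move: c4 => /eqP; rewrite -subr_eq0 (_ : 4 = 2 ^+ 2) // subr_sqr mulf_eq0.
move=> /orP[|] /eqP h; [right|left]; apply: scale2_inj; rewrite yE.
  by rewrite scalerN -scaleNr; congr (_ *: _); lia.
by congr (_ *: _); lia.
Qed.

Section Components.
Variable R : realType.
Notation C := (CC R).
Notation VC := 'rV[CC R]_17.
Implicit Types (w v : VC) (x y : D R) (r : latT).
Variable G : matgroup.
Hypothesis GO : mg_set G `<=` @OT.

Definition stable_set (S : set latT) := forall r g, mg_set G g -> S r -> S (r *m g).

Definition Hcone (S : set latT) : set VC := [set w | exists2 r, S r & form (ext r) w = 0].

Lemma Hdiv_cone S : Hdiv R G S = orb G @` [set x | Hcone S (hx x)].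
Proof. by apply/seteqP; split=> q [x [r Sr h] <-]; exists x => //; exists r. Qed.

Lemma form_mul_ext r w g : mg_set G g -> form (ext (r *m g)) (w *m ext g) = form (ext r) w.
Proof. by move=> Gg; rewrite extM isometry_form //; exact: GO. Qed.

Lemma Hcone_invariant S : stable_set S -> invariant_cone G (Hcone S).
Proof.
move=> St; split=> [c w _ _ [r Sr h]|g w Gg _ [r Sr h]].
  by exists r; rewrite // formZr h mulr0.
by exists (r *m g); [exact: St|rewrite form_mul_ext].
Qed.

(** Only finitely many roots are orthogonal to periods near a given one, so the union of hyperplanes
    is locally finite. *)
Lemma Hcone_locana S : S `<=` Delta -> locana (Hcone S).
Proof.
move=> SD w Dw; have [E Efin HE] := roots_near_finite (- 2) Dw.
have fin : finite_set (E `&` S) by apply: sub_finite_set Efin => r [].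
have := @ana_at_bigcup R _ _ (fun r => [set v | form v (ext r) = 0]) w fin (fun r _ => ana_at_form (ext r) w).
apply: ana_at_near; apply: filterS HE => v HE Dv; split.
  by move=> [r [_ Sr] h]; exists r; rewrite // formC.
move=> [r Sr h]; exists r; last by rewrite /= formC.
by split=> //; apply: HE => //; exact: SD.
Qed.

Lemma Hdiv_analytic S : stable_set S -> S `<=` Delta -> analytic_set (Hdiv R G S).
Proof.
move=> St SD; rewrite Hdiv_cone; apply: (descent GO); first exact: Hcone_invariant.
exact: Hcone_locana.
Qed.

Lemma orb_mul x y w g : mg_set G g -> coords w x -> coords (w *m ext g) y -> orb G x = orb G y.
Proof.
move=> Gg [c c0 Ec] [d d0 Ed]; apply: (@orb_coords R G x y g (c^-1 * d) Gg).
  by rewrite mulf_neq0 ?invr_eq0.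
rewrite -scalerA; have -> : d *: hx y = w *m ext g by rewrite Ed.
by rewrite Ec -scalemxAl scalerA mulVf // scale1r.
Qed.

Lemma lift_invariant (Z : set (DQ R G)) : invariant_cone G (lift Z).
Proof.
split=> [c w c0 _ [x wx Zx]|g w Gg Dw [x wx Zx]].
  by exists x => //; exact: coordsZ.
have Dwg : Dc (w *m ext g) by apply: Dc_mul => //; exact: GO.
have [y wy] := coords_ex Dwg; exists y => //.
by rewrite -(orb_mul Gg wx wy).
Qed.

Lemma lift_hx (Z : set (DQ R G)) x : lift Z (hx x) <-> Z (orb G x).
Proof. exact: lift_coords (coords_hx x). Qed.

(** The intersection is formed on the cone and brought back by [descent]. *)
Lemma analytic_setI (A B : set (DQ R G)) :
  analytic_set A -> analytic_set B -> analytic_set (A `&` B).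
Proof.
move=> HA HB.
have -> : A `&` B = orb G @` [set x | (lift A `&` lift B) (hx x)].
  apply/seteqP; split=> [q [Aq Bq]|_ [x [/lift_hx Ax /lift_hx Bx] <-] //].
  by have [x xq] := orb_surj q; exists x => //; split; apply/lift_hx; rewrite xq.
have [a1 a2] := lift_invariant A; have [b1 b2] := lift_invariant B.
apply: (descent GO).
  split=> [c w c0 Dw [h1 h2]|g w Gg Dw [h1 h2]].
    by split; [exact: a1|exact: b1].
  by split; [exact: a2|exact: b2].
by move=> w Dw; apply: ana_atI; apply: locana_lift.
Qed.

Lemma Hdiv_coords S w x : stable_set S -> coords w x -> Hdiv R G S (orb G x) <-> Hcone S w.
Proof.
move=> St wx; rewrite Hdiv_cone; have [c c0 Ec] := wx; split.
  move=> [y [r Sr h] /orb_coordsP[g Gg [d d0 E]]].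
  exists (r *m g); first exact: St.
  have -> : w = (c * d^-1) *: (hx y *m ext g) by rewrite E scalerA -mulrA mulVf // mulr1.
  by rewrite formZr form_mul_ext // h mulr0.
move=> [r Sr h]; exists x => //; exists r => //; move: h; rewrite Ec formZr => /eqP.
by rewrite mulf_eq0 (negbTE c0) => /eqP.
Qed.

Hypothesis Gneg : mg_set G (gmx negU).

Lemma negU_act k : (k < 17)%N -> bv k *m gmx negU = (if (k < 2)%N then - 1 else 1) *: bv k.
Proof.
move=> k17; have [_ ->] := negU_stable; apply: co_inj => j j17.
rewrite /negU co_vec // coZ co_bv //.
by do 17 (destruct j as [|j]; first by rewrite /= !co_bv //;
  do 17 (destruct k as [|k]; first by [])).
Qed.

Lemma co_negU0 w : co 0 (w *m ext (gmx negU)) = - co 0 w.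
Proof.
rewrite -!form_bv1 -(isometry_form w (ext (bv 1)) (GO Gneg)) -extM negU_act //=.
by rewrite ext_scale formZr mulN1r opprK.
Qed.

Lemma co_negU2 w : co 2 (w *m ext (gmx negU)) = co 2 w.
Proof.
have E (u : VC) : co 2 u = form u (ext (bv 3)) by rewrite -[bv 3]/(dv 2) form_dv ?mul1r.
by rewrite !E -(isometry_form w (ext (bv 3)) (GO Gneg)) -extM negU_act //= ext_scale scale1r.
Qed.

Section Irreducible.
Variables (S : set latT) (rho : latT).
Hypotheses (St : stable_set S) (SD : S `<=` Delta) (Srho : S rho).
Hypotheses (co0_rho : co 0 rho = 0) (co1_rho : co 1 rho = 0).

Lemma rho_norm : form rho rho = - 2. Proof. exact: (SD Srho). Qed.

Lemma Hdiv_generic_point : exists w x, [/\ coords w x, Hdiv R G S (orb G x),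
  forall s : latT, form s s = - 2 -> form (ext s) w = 0 -> s = rho \/ s = - rho &
  forall g c, OT g -> w *m ext g = c *: w -> forall u, even_vec u -> cong2 (u *m g) u].
Proof.
have [w [Dw rw h1 h2]] := very_general_point R co0_rho co1_rho rho_norm.
have [x wx] := coords_ex Dw; exists w, x; split=> //.
- by apply/(Hdiv_coords St wx); exists rho.
- by move=> s ss sw; apply: root_in_line => //; [exact: rho_norm|exact: h1].
- move=> g c Og wg; have [e ee He] := h2 g c Og wg.
  exact: (scalar_on_orthogonal_trivial Og rho_norm ee He).
Qed.

(** A generic point of the hyperplane of [rho] determines the root up to sign, so both signs have to
    be excluded from T. *)
Lemma Hdiv_not_sub (T : set latT) : stable_set T -> T `<=` Delta -> ~ T rho -> ~ T (- rho) ->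
  ~ (Hdiv R G S `<=` Hdiv R G T).
Proof.
move=> Tst TD n1 n2 sub; have [w [x [wx Sx h _]]] := Hdiv_generic_point.
have /(Hdiv_coords Tst wx)[s Ts sw] := sub _ Sx.
by have [e|e] := h s (TD _ Ts) sw; rewrite e in Ts.
Qed.

Hypothesis trans : forall r, S r -> exists2 g, mg_set G g & r *m g = rho.

(** Transitivity brings a given root to [rho] and rescaling makes coordinate 0 equal to 1; it
    remains to reach the right one of the two halves. *)
Lemma half_hyperplane_covers (A : set (DQ R G)) :
  @half_hyperplane R rho `<=` lift A -> Hdiv R G S `<=` A.
Proof.
move=> sub; rewrite Hdiv_cone => _ [x [r Sr rx] <-].
have [g Gg rg] := trans Sr.
have h w y : coords w y -> @half_hyperplane R rho w -> A (orb G y).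
  by move=> wy /sub/(lift_coords A wy).
have Dg : Dc (hx x *m ext g) by apply: Dc_mul (GO Gg) (Dc_hx x).
pose c := (co 0 (hx x *m ext g))^-1.
have c0 : c != 0 by rewrite invr_eq0 Dc_co0.
pose w := c *: (hx x *m ext g).
have Dw : Dc w by exact: DcZ.
have rw : form (ext rho) w = 0.
  by rewrite /w formZr -rg form_mul_ext // rx mulr0.
have w0 : co 0 w = 1 by rewrite /w coZ mulVf // Dc_co0.
have [y wy] := coords_ex Dw.
have -> : orb G x = orb G y.
  apply: (orb_mul Gg (coords_hx x)).
  have -> : hx x *m ext g = c^-1 *: w by rewrite /w scalerA mulVf // scale1r.
  have ci0 : c^-1 != 0 by rewrite invr_eq0.
  exact: coordsZ ci0 wy.
have [pos|neg] := ltP 0 (cIm (co 2 w)); first exact: (h w).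
(* The two sign changes cancel on coordinate 0, while coordinate 2 changes sign; [rho] is fixed by
   [negU]. *)
pose v := -1 *: (w *m ext (gmx negU)).
have n1 : (-1 : C) != 0 by rewrite oppr_eq0 oner_eq0.
have Dwn : Dc (w *m ext (gmx negU)) by apply: Dc_mul (GO Gneg) Dw.
have Dv : Dc v by exact: DcZ.
have [z vz] := coords_ex Dv.
have -> : orb G y = orb G z.
  apply: (orb_mul Gneg wy); have -> : w *m ext (gmx negU) = -1 *: v.
    by rewrite /v scalerA mulrNN mulr1 scale1r.
  exact: coordsZ.
apply: (h v z vz); split; first exact: Dv.
- have -> : ext rho = ext (rho *m gmx negU) :> VC.
    congr ext; have [_ ->] := negU_stable; rewrite /negU co0_rho co1_rho oppr0.
    apply: co_inj => k k17; rewrite co_vec //.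
    by do 17 (destruct k as [|k]; first by []).
  by rewrite /v formZr form_mul_ext // rw mulr0.
- by rewrite /v coZ co_negU0 w0 mulrNN mulr1.
rewrite /v coZ co_negU2 mulN1r cImN oppr_gt0 lt_neqAle neg andbT.
have [t [t0 t1 Et]] := tube_surj Dw.1 w0.
have tp : 0 < form (vIm t) (vIm t) by apply/(tube_Dc t0 t1); rewrite -Et.
have := @positive_co2 R (vIm t); rewrite !co_vIm t0 => /(_ erefl tp).
have -> : co 2 w = co 2 t; last by [].
by rewrite Et /tube coD coN coZ coD !co_ext !co_bv //= mulr0 subr0 add0r.
Qed.

Lemma Hdiv_irreducible : irreducible_analytic (Hdiv R G S).
Proof.
split; first exact: Hdiv_analytic.
  by have [w [x [_ Sx _ _]]] := Hdiv_generic_point; exists (orb G x).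
move=> A B HA HB E.
have cov w : Dc w -> form (ext rho) w = 0 -> lift A w \/ lift B w.
  move=> Dw rw; have [x wx] := coords_ex Dw.
  have : Hdiv R G S (orb G x) by apply/(Hdiv_coords St wx); exists rho.
  by rewrite E => -[h|h]; [left|right]; exists x.
have [h|h] := analytic_alternative co0_rho co1_rho (locana_lift HA) (locana_lift HB) cov.
  left; apply/seteqP; split; first exact: half_hyperplane_covers.
  by rewrite E; exact: subsetUl.
right; apply/seteqP; split; first exact: half_hyperplane_covers.
by rewrite E; exact: subsetUr.
Qed.

End Irreducible.

Variables (I : finType) (S : I -> set latT) (rho : I -> latT).
Hypotheses (St : forall i, stable_set (S i)) (SD : forall i, S i `<=` Delta).
Hypotheses (Srho : forall i, S i (rho i)) (co0_rho : forall i, co 0 (rho i) = 0).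
Hypothesis co1_rho : forall i, co 1 (rho i) = 0.
Hypothesis trans : forall i r, S i r -> exists2 g, mg_set G g & r *m g = rho i.
Hypothesis cover : forall r, Delta r -> exists i, S i r.
Hypothesis disjoint : forall i j, S j (rho i) \/ S j (- rho i) -> i = j.

Lemma Hdiv_sub_eq i j : Hdiv R G (S i) `<=` Hdiv R G (S j) -> i = j.
Proof.
move=> sub; apply: contrapT => ij.
have n1 : ~ S j (rho i) by move=> h; apply: ij; apply: disjoint; left.
have n2 : ~ S j (- rho i) by move=> h; apply: ij; apply: disjoint; right.
exact: (Hdiv_not_sub (@St i) (@SD i) (Srho i) (co0_rho i) (co1_rho i) (@St j) (@SD j) n1 n2 sub).
Qed.

(** One class is split off at a time: both parts of Z are analytic, and irreducibility discards one
    of them. *)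
Lemma irreducible_in_one (Z : set (DQ R G)) : irreducible_analytic Z ->
  Z `<=` Hdiv R G Delta -> exists i, Z `<=` Hdiv R G (S i).
Proof.
move=> [Zan [q0 Zq0] Zirr] sub.
pose U (s : seq I) := [set r | exists2 i, i \in s & S i r].
have Ust s : stable_set (U s).
  by move=> r g Gg [i si Sr]; exists i => //; exact: St.
have UD s : U s `<=` Delta by move=> r [i _]; exact: SD.
have : Z `<=` Hdiv R G (U (enum I)).
  move=> q /sub [x [r Dr rx] <-]; exists x => //; exists r => //.
  by have [i Sr] := cover Dr; exists i => //; rewrite mem_enum.
elim: (enum I) => [|i s IH] Us; first by have [x [r [i si _] _] _] := Us _ Zq0.
have an1 : analytic_set (Z `&` Hdiv R G (S i)).
  by apply: analytic_setI => //; exact: Hdiv_analytic.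
have an2 : analytic_set (Z `&` Hdiv R G (U s)).
  by apply: analytic_setI => //; exact: Hdiv_analytic.
have E : Z = (Z `&` Hdiv R G (S i)) `|` (Z `&` Hdiv R G (U s)).
  apply/seteqP; split=> [q Zq|q [[Zq _]|[Zq _]]] //.
  have [x [r [j]]] := Us _ Zq; rewrite inE => /orP[/eqP ->|js] Sr rx xq.
    by left; split=> //; exists x => //; exists r.
  by right; split=> //; exists x => //; exists r => //; exists j.
have [e|e] := Zirr _ _ an1 an2 E.
  by exists i; rewrite e; exact: subIsetr.
by apply: IH; rewrite e; exact: subIsetr.
Qed.

Theorem components :
  (forall Z, irreducible_component (Hdiv R G Delta) Z <-> exists i, Z = Hdiv R G (S i)) /\
  (forall i j, Hdiv R G (S i) = Hdiv R G (S j) -> i = j).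
Proof.
have irr i : irreducible_analytic (Hdiv R G (S i)).
  exact: (Hdiv_irreducible (@St i) (@SD i) (Srho i) (co0_rho i) (co1_rho i) (@trans i)).
have subD i : Hdiv R G (S i) `<=` Hdiv R G Delta.
  by move=> q [x [r Sr rx] <-]; exists x => //; exists r => //; exact: (@SD i).
split=> [Z|i j E]; last by apply: Hdiv_sub_eq; rewrite E.
split=> [[Zirr Zsub Zmax]|[i ->]].
  have [i Zi] := irreducible_in_one Zirr Zsub; exists i.
  by rewrite (Zmax _ (irr i) Zi (subD i)).
split=> // W Wirr iW Wsub.
have [j Wj] := irreducible_in_one Wirr Wsub.
have ij : i = j by apply: Hdiv_sub_eq; exact: subset_trans iW Wj.
by apply/seteqP; split=> //; rewrite ij.
Qed.

End Components.

Lemma OTstar_sub : @OTstar `<=` @OT. Proof. by move=> g []. Qed.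

(** * Action of the two groups on the sets of roots *)

Section ClassAction.
Implicit Types (r s : latT) (g : 'M[int]_17) (i j k : 'I_5).

Lemma even_mulE g r : OT g -> even_vec (r *m g) <-> even_vec r.
Proof.
move=> Og; split=> [h|]; last exact: even_mul.
have := even_mul (OT_inv Og) h; rewrite -mulmxA mulmxV ?mulmx1 //; by case: Og.
Qed.

Lemma class_mul g r s i : OT g -> cong2 r (rA1 i) -> cong2 (rA1 i *m g) s -> cong2 (r *m g) s.
Proof. by move=> Og h; apply: cong2_trans; exact: cong2_mul. Qed.

Lemma root_mul g r : OT g -> form r r = - 2 -> form (r *m g) (r *m g) = - 2.
Proof. by move=> Og; rewrite OT_form. Qed.

Lemma Delta1_stable G : mg_set G `<=` @OT -> stable_set G Delta1.
Proof.
move=> GO r g /GO Og /Delta1P[rr nr]; apply/Delta1P; split; first exact: root_mul.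
by rewrite even_mulE.
Qed.

Lemma Delta2_stable G : mg_set G `<=` @OT -> stable_set G Delta2.
Proof.
move=> GO r g /GO Og /Delta2P[rr h]; apply/Delta2P; split; first exact: root_mul.
exact: cong2_trans (cong2_mul g h) (sum_stable Og).
Qed.

Lemma Delta3_stable : stable_set Gamma Delta3.
Proof.
move=> r g Og /Delta3P[rr [i h]]; apply/Delta3P; split; first exact: root_mul.
by have [s _ Hs] := perm_class Og; exists (s i); exact: class_mul h (Hs i).
Qed.

Lemma Delta3a_stable : stable_set Gammastar Delta3a.
Proof.
move=> r g /OTstarP[Og g0] /Delta3aP[rr [i [i0 h]]]; apply/Delta3aP; split; first exact: root_mul.
have [s si Hs] := perm_class Og; exists (s i); split; last exact: class_mul h (Hs i).
rewrite -(inj_eq si) in i0; apply: contra i0 => /eqP ->; apply/eqP.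
exact: cong_rA1 (cong2_trans (cong2_sym g0) (Hs ord0)).
Qed.

Lemma Delta3b_stable : stable_set Gammastar Delta3b.
Proof.
move=> r g /OTstarP[Og g0] /Delta3bP[rr h]; apply/Delta3bP; split; first exact: root_mul.
exact: class_mul h g0.
Qed.

Lemma stable_OTstar g : stable g -> OTstar g.
Proof. by move=> [Og h]; apply/OTstarP; split=> //; apply: h; exact: even_rA1. Qed.

Lemma negU_OTstar : OTstar (gmx negU).
Proof. by apply: stable_OTstar; have [] := negU_stable. Qed.

Lemma Delta1_trans r : Delta1 r -> exists2 g, OTstar g & r *m g = rho1.
Proof.
move=> /Delta1P[rr nr]; have [g /stable_OTstar Sg E] := root_orbit1 rr nr.
by exists g.
Qed.

Lemma Delta2_trans r : Delta2 r -> exists2 g, OTstar g & r *m g = rho2.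
Proof.
move=> /Delta2P[rr nr]; have [g /stable_OTstar Sg E] := root_orbit2 rr nr.
by exists g.
Qed.

Lemma Delta3b_trans r : Delta3b r -> exists2 g, OTstar g & r *m g = rho3 ord0.
Proof.
move=> /Delta3bP[rr nr]; have [g /stable_OTstar Sg E] := root_orbit3 rr nr.
by exists g.
Qed.

Lemma Delta3_trans r : Delta3 r -> exists2 g, OT g & r *m g = rho3 ord0.
Proof.
move=> /Delta3P[rr [i h]]; have [p Op [p1 _ _]] := transposition i.
have D : Delta3b (r *m p).
  by apply/Delta3bP; split; [exact: root_mul|rewrite -p1; exact: cong2_mul].
have [g [Og _] E] := Delta3b_trans D.
by exists (p *m g); [exact: OT_mul|rewrite mulmxA].
Qed.

Lemma Delta3a_trans r : Delta3a r -> exists2 g, OTstar g & r *m g = rho3 ord_max.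
Proof.
move=> /Delta3aP[rr [i [i0 h]]].
have [p /OTstarP Op pi] : exists2 p, OTstar p & rA1 i *m p = rA1 ord_max.
  have [->|im] := eqVneq i ord_max; first by exists 1%:M; [exact: OTstar_1|rewrite mulmx1].
  have [p Op [p1 p2 p3]] := transposition i; have [q Oq [q1 q2 q3]] := transposition ord_max.
  (* Conjugating one transposition through index 0 by another gives the transposition of i and the
     last index, which fixes index 0 and thus lies in the smaller group. *)
  exists (p *m q *m p).
    apply/OTstarP; split; first by do 2 apply: OT_mul => //.
    by rewrite !mulmxA p2 q3 // p1; exact: cong2_refl.
  by rewrite !mulmxA p1 q2 p3 // eq_sym.
have rp : cong2 (r *m p) (rA1 ord_max) by rewrite -pi; exact: cong2_mul.
have [g /stable_OTstar Sg E] := root_orbit3 (root_mul Op.1 rr) rp.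
exists (p *m g); last by rewrite mulmxA.
by apply: OTstar_mul => //; apply/OTstarP.
Qed.

Lemma Delta_cover r : Delta r -> [\/ Delta1 r, Delta2 r, Delta3a r | Delta3b r].
Proof.
move=> rr; have [[h _]|[h _]|[i [h _]]] := root_class rr.
- by apply: Or41; apply/Delta1P.
- by apply: Or42; apply/Delta2P.
have [i0|i0] := eqVneq i ord0; [apply: Or44; apply/Delta3bP|apply: Or43; apply/Delta3aP].
  by rewrite -i0.
by split=> //; exists i.
Qed.

Lemma Delta3ab r : Delta3 r <-> Delta3a r \/ Delta3b r.
Proof.
split=> [/Delta3P[rr [i h]]|].
  have [i0|i0] := eqVneq i ord0; [right; apply/Delta3bP|left; apply/Delta3aP].
    by rewrite -i0.
  by split=> //; exists i.
by move=> [/Delta3aP[rr [i [_ h]]]|/Delta3bP[rr h]]; apply/Delta3P; split=> //; eexists; exact: h.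
Qed.

Lemma rho1_norm : form rho1 rho1 = - 2.
Proof. by rewrite /rho1 !formlinE !form_bv // !co_bv. Qed.

End ClassAction.

Lemma rho2_norm : form rho2 rho2 = - 2.
Proof.
have -> : form rho2 rho2 = 4 * form (bv 2 + bv 3) (bv 2 + bv 3)
    + 4 * form (\sum_i rA1 i) (bv 2 + bv 3) + form (\sum_i rA1 i) (\sum_i rA1 i).
  by rewrite /rho2 !formlinE !(formC (bv _) (\sum_i _)); ring.
have -> : form (\sum_i rA1 i) (\sum_i rA1 i) = - 10.
  rewrite form_suml (eq_bigr (fun _ => - 2)) => [|k _]; last by rewrite formC form_rA1 co_sum_rA1 // ?leq_addr // (ltn_add2l 12 k 5).
  by rewrite sumr_const card_ord.
by rewrite !formDl !formDr !form_bv // !co_bv // !co_sum_rA1.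
Qed.

Lemma rho3_norm i : form (rho3 i) (rho3 i) = - 2.
Proof.
have i17 : (12 + i < 17)%N by rewrite (ltn_add2l 12 i 5).
have -> : form (rho3 i) (rho3 i) = 4 * form (bv 2) (bv 2)
    + 4 * form (rA1 i) (bv 2) + form (rA1 i) (rA1 i).
  by rewrite /rho3 !formlinE !(formC (bv _) (rA1 _)); ring.
by rewrite form_rA1_rA1 eqxx !form_bv // co_bv // co_rA1.
Qed.

Lemma co_rho1 k : (k < 2)%N -> co k rho1 = 0.
Proof. by case: k => [|[|]] // _; rewrite /rho1 coD coN !co_bv. Qed.
Lemma co_rho2 k : (k < 2)%N -> co k rho2 = 0.
Proof. by case: k => [|[|]] // _; rewrite /rho2 !coD !coZ !co_bv // co_sum_rA1. Qed.
Lemma co_rho3 k i : (k < 2)%N -> co k (rho3 i) = 0.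
Proof. by case: k => [|[|]] // _; rewrite /rho3 !coD !coZ !co_bv // co_rA1. Qed.

Lemma rho1_Delta1 : Delta1 rho1.
Proof. by apply/Delta1P; split; [exact: rho1_norm|exact: rho1_not_even]. Qed.
Lemma rho2_Delta2 : Delta2 rho2.
Proof. by apply/Delta2P; split; [exact: rho2_norm|exact: rho2_cong]. Qed.
Lemma rho3_Delta3 i : Delta3 (rho3 i).
Proof. by apply/Delta3P; split; [exact: rho3_norm|exists i; exact: rho3_cong]. Qed.
Lemma rho3_Delta3a i : i != ord0 -> Delta3a (rho3 i).
Proof. by move=> i0; apply/Delta3aP; split; [exact: rho3_norm|exists i; split=> //; exact: rho3_cong]. Qed.
Lemma rho3_Delta3b : Delta3b (rho3 ord0).
Proof. by apply/Delta3bP; split; [exact: rho3_norm|exact: rho3_cong]. Qed.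

Section Disjoint.
Implicit Types r : latT.

Lemma Delta1N r : Delta1 (- r) -> Delta1 r.
Proof.
move=> /Delta1P[]; rewrite formNl formNr opprK => rr nr; apply/Delta1P; split=> // er.
by apply: nr; apply: even_cong er (cong2_sym (cong2N r)).
Qed.
Lemma Delta2N r : Delta2 (- r) -> Delta2 r.
Proof.
move=> /Delta2P[]; rewrite formNl formNr opprK => rr h; apply/Delta2P; split=> //.
exact: cong2_trans (cong2_sym (cong2N r)) h.
Qed.
Lemma Delta3aN r : Delta3a (- r) -> Delta3a r.
Proof.
move=> /Delta3aP[]; rewrite formNl formNr opprK => rr [i [i0 h]]; apply/Delta3aP; split=> //.
by exists i; split=> //; exact: cong2_trans (cong2_sym (cong2N r)) h.
Qed.
Lemma Delta3bN r : Delta3b (- r) -> Delta3b r.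
Proof.
move=> /Delta3bP[]; rewrite formNl formNr opprK => rr h; apply/Delta3bP; split=> //.
exact: cong2_trans (cong2_sym (cong2N r)) h.
Qed.
Lemma Delta3N r : Delta3 (- r) -> Delta3 r.
Proof. by rewrite !Delta3ab => -[/Delta3aN|/Delta3bN]; [left|right]. Qed.

Lemma Delta1_not2 r : Delta1 r -> ~ Delta2 r.
Proof. by move=> /Delta1P[_ nr] /Delta2P[_ /cong_even_sum]. Qed.
Lemma Delta1_not3 r : Delta1 r -> ~ Delta3 r.
Proof. by move=> /Delta1P[_ nr] /Delta3P[_ [i /cong_even_rA1]]. Qed.
Lemma Delta2_not3 r : Delta2 r -> ~ Delta3 r.
Proof.
move=> /Delta2P[_ h] /Delta3P[_ [i h']].
exact: (@rA1_cong_sum i (cong2_trans (cong2_sym h') h)).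
Qed.
Lemma Delta3a_not3b r : Delta3a r -> ~ Delta3b r.
Proof.
move=> /Delta3aP[_ [i [i0 h]]] /Delta3bP[_ h'].
by move: i0; rewrite (cong_rA1 (cong2_trans (cong2_sym h) h')) eqxx.
Qed.
Lemma Delta3a_sub : Delta3a `<=` Delta3. Proof. by move=> r h; apply/Delta3ab; left. Qed.
Lemma Delta3b_sub : Delta3b `<=` Delta3. Proof. by move=> r h; apply/Delta3ab; right. Qed.
End Disjoint.

(** * The components for the two groups *)

Section Instances.
Variable R : realType.

Definition class3 (i : option bool) : set latT :=
  match i with None => Delta1 | Some true => Delta2 | Some false => Delta3 end.
Definition class4 (i : bool * bool) : set latT :=
  match i with (true, true) => Delta1 | (true, false) => Delta2
    | (false, true) => Delta3a | (false, false) => Delta3b end.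
Definition rep3 (i : option bool) : latT :=
  match i with None => rho1 | Some true => rho2 | Some false => rho3 ord0 end.
Definition rep4 (i : bool * bool) : latT :=
  match i with (true, true) => rho1 | (true, false) => rho2
    | (false, true) => rho3 ord_max | (false, false) => rho3 ord0 end.

Lemma components_Gamma :
  (forall Z, irreducible_component (Hdiv R Gamma Delta) Z <-> exists i, Z = Hdiv R Gamma (class3 i)) /\
  (forall i j, Hdiv R Gamma (class3 i) = Hdiv R Gamma (class3 j) -> i = j).
Proof.
apply: (@components R Gamma (fun g Og => Og) (negU_OTstar.1) (option bool) class3 rep3).
- by case=> [[]|]; [exact: Delta2_stable|exact: Delta3_stable|exact: Delta1_stable].
- by case=> [[]|] r [].
- by case=> [[]|]; [exact: rho2_Delta2|exact: rho3_Delta3|exact: rho1_Delta1].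
- by case=> [[]|]; [exact: co_rho2|exact: co_rho3|exact: co_rho1].
- by case=> [[]|]; [exact: co_rho2|exact: co_rho3|exact: co_rho1].
- case=> [[]|] r; [move=> /Delta2_trans|move=> /Delta3_trans|move=> /Delta1_trans] => -[g Gg E].
  + by exists g => //; case: Gg.
  + by exists g.
  + by exists g => //; case: Gg.
- move=> r /Delta_cover[h|h|h|h]; [exists None|exists (Some true)|exists (Some false)|exists (Some false)] => //.
  + exact: Delta3a_sub.
  + exact: Delta3b_sub.
have h1 := rho1_Delta1; have h2 := rho2_Delta2; have h3 := rho3_Delta3 ord0.
case=> [[]|] [[]|] //= [] h.
- by case: (Delta2_not3 h2 h).
- by case: (Delta2_not3 h2 (Delta3N h)).
- by case: (Delta1_not2 h h2).
- by case: (Delta1_not2 (Delta1N h) h2).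
- by case: (Delta2_not3 h h3).
- by case: (Delta2_not3 (Delta2N h) h3).
- by case: (Delta1_not3 h h3).
- by case: (Delta1_not3 (Delta1N h) h3).
- by case: (Delta1_not2 h1 h).
- by case: (Delta1_not2 h1 (Delta2N h)).
- by case: (Delta1_not3 h1 h).
- by case: (Delta1_not3 h1 (Delta3N h)).
Qed.

Lemma components_Gammastar :
  (forall Z, irreducible_component (Hdiv R Gammastar Delta) Z <-> exists i, Z = Hdiv R Gammastar (class4 i)) /\
  (forall i j, Hdiv R Gammastar (class4 i) = Hdiv R Gammastar (class4 j) -> i = j).
Proof.
apply: (@components R Gammastar OTstar_sub negU_OTstar (bool * bool)%type class4 rep4).
- case=> [[] []]; [apply: Delta1_stable|apply: Delta2_stable|exact: Delta3a_stable|exact: Delta3b_stable].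
  + exact: OTstar_sub.
  + exact: OTstar_sub.
- by case=> [[] []] r [].
- by case=> [[] []]; [exact: rho1_Delta1|exact: rho2_Delta2|exact: rho3_Delta3a|exact: rho3_Delta3b].
- by case=> [[] []]; [exact: co_rho1|exact: co_rho2|exact: co_rho3|exact: co_rho3].
- by case=> [[] []]; [exact: co_rho1|exact: co_rho2|exact: co_rho3|exact: co_rho3].
- by case=> [[] []] r; [exact: Delta1_trans|exact: Delta2_trans|exact: Delta3a_trans|exact: Delta3b_trans].
- move=> r /Delta_cover[h|h|h|h].
  + by exists (true, true).
  + by exists (true, false).
  + by exists (false, true).
  + by exists (false, false).
have h1 := rho1_Delta1; have h2 := rho2_Delta2.
have h3 : Delta3a (rho3 ord_max) by exact: rho3_Delta3a.
have h4 := rho3_Delta3b; have k3 := Delta3a_sub h3; have k4 := Delta3b_sub h4.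
case=> [[] []] [[] []] //= H; exfalso.
- by case: H => [|/Delta2N]; exact: Delta1_not2.
- by case: H => [|/Delta3aN] /Delta3a_sub; exact: Delta1_not3.
- by case: H => [|/Delta3bN] /Delta3b_sub; exact: Delta1_not3.
- by case: H => [|/Delta1N] /Delta1_not2.
- by case: H => [|/Delta3aN] /Delta3a_sub; exact: Delta2_not3.
- by case: H => [|/Delta3bN] /Delta3b_sub; exact: Delta2_not3.
- by case: H => [|/Delta1N] /Delta1_not3.
- by case: H => [|/Delta2N] /Delta2_not3.
- by case: H => [|/Delta3bN]; exact: Delta3a_not3b.
- by case: H => [|/Delta1N] /Delta1_not3.
- by case: H => [|/Delta2N] /Delta2_not3.
- by case: H => [|/Delta3aN] /Delta3a_not3b.
Qed.

End Instances.

(** * Degrees *)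

Definition moves_class (g : 'M[int]_17) := exists i, ~ cong2 (rA1 i *m g) (rA1 i).

Definition swap k : 'M[int]_17 := sval (cid2 (transposition k)).

Section Swap.
Implicit Types (i j k : 'I_5) (r : latT).

Lemma swap_OT k : OT (swap k).
Proof. by rewrite /swap; case: cid2. Qed.

Lemma swap_self k : rA1 k *m swap k = rA1 ord0.
Proof. by rewrite /swap; case: cid2 => p /= _ []. Qed.

Lemma swapV k : rA1 ord0 *m invmx (swap k) = rA1 k.
Proof. by rewrite -(swap_self k) -mulmxA mulmxV ?mulmx1 //; case: (swap_OT k). Qed.

Lemma swap_other j k : j != k -> exists2 i, i != ord0 & cong2 (rA1 j *m swap k) (rA1 i).
Proof.
move=> jk; have [s si Hs] := perm_class (swap_OT k); exists (s j) => //.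
have sk : s k = ord0.
  by apply: cong_rA1; apply: cong2_trans (cong2_sym (Hs k)) _; rewrite swap_self; exact: cong2_refl.
by rewrite -sk (inj_eq si).
Qed.

End Swap.

Section Degree.
Variable R : realType.
Notation C := (CC R).
Notation VC := 'rV[CC R]_17.
Implicit Types (w v : VC) (x y : D R) (r s : latT).

(** Outside this locus the stabiliser of a period acts trivially on the five classes, so the five
    translates by [swap k] stay distinct modulo the smaller group. *)
Definition moved : set VC := [set w | exists2 g, OT g &
  moves_class g /\ exists2 c, c != 0 & w *m ext g = c *: w].

Lemma moves_conj g h : OT g -> OT h -> moves_class g -> moves_class (invmx h *m g *m h).
Proof.
move=> Og Oh [i ni]; have [s si Hs] := perm_class Oh; exists (s i) => H; apply: ni.
have uh : h \in unitmx by case: Oh.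
have h1 : cong2 (rA1 (s i) *m invmx h) (rA1 i).
  have := cong2_mul (invmx h) (Hs i).
  by rewrite -mulmxA mulmxV // mulmx1 => /cong2_sym.
have h2 := cong2_mul (invmx h) H.
have {h2} : cong2 (rA1 (s i) *m invmx h *m g) (rA1 (s i) *m invmx h).
  by move: h2; rewrite !mulmxA -(mulmxA _ h) mulmxV // mulmx1.
move=> h2; apply: cong2_trans (cong2_sym (cong2_mul g h1)) _.
exact: cong2_trans h2 h1.
Qed.

Lemma moved_invariant : invariant_cone Gamma moved.
Proof.
split=> [c w _ _ [g Og [mg [d d0 E]]]|h w Oh _ [g Og [mg [d d0 E]]]].
  by exists g => //; split=> //; exists d => //; rewrite -scalemxAl E scalerA mulrC -scalerA.
exists (invmx h *m g *m h).
  by apply: OT_mul => //; apply: OT_mul => //; exact: OT_inv.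
split; first exact: moves_conj.
exists d => //; have uh : h \in unitmx by case: Oh.
by rewrite !extM !mulmxA -(mulmxA w) ext_unit // mulmx1 E scalemxAl.
Qed.

(** Near w0 only elements stabilising the line of w0 can stabilise a line, and they are finite in
    number; the locus is a finite union of eigenvector conditions. *)
Lemma moved_locana : locana moved.
Proof.
move=> w0 Dw0; have [W [oW Ww0 HW]] := properly_discontinuous Dw0.
have fin : finite_set (stab Gamma w0 `&` moves_class).
  by apply: sub_finite_set (@stab_finite R Gamma (fun g Og => Og) w0 Dw0) => g [].
have := @ana_at_bigcup R _ _ (fun g => [set u : VC | exists2 c, c != 0 & u *m ext g = c *: u]) w0 fin
  (fun g Hg => ana_at_fixed w0 Hg.1.1).
apply: ana_at_near; apply: filterS (open_nbhs_nbhs (conj oW Ww0)) => v inW Dv; split.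
  by move=> [g [[Og _] mg] h]; exists g.
move=> [g Og [mg [c c0 E]]]; exists g; last by exists c.
by split=> //; split=> //; exact: (HW _ _ _ _ inW inW Dv Dv Og c0 E).
Qed.

Section Cover.
Variables (S S' : set latT) (rho : latT) (d : nat).
Hypotheses (St : stable_set Gamma S) (SD : S `<=` Delta) (Srho : S rho).
Hypotheses (co0_rho : co 0 rho = 0) (co1_rho : co 1 rho = 0).
Hypotheses (St' : stable_set Gammastar S') (SS' : S' `<=` S).
Hypothesis fibre : forall x, @Hcone R S (hx x) -> ~ moved (hx x) -> exists2 K : {set 'I_5},
  #|K| = d & forall k, k \in K <-> @Hcone R S' (hx x *m ext (swap k)).

(** The exceptional set is the image of the moved points of the divisor. It is proper because the
    stabiliser of a generic point acts trivially on the discriminant group; elsewhere the fibre is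
    indexed by the set K of the hypothesis [fibre]. *)
Lemma cover_degree :
  induces_map_of_degree (natmap R) (Hdiv R Gammastar S') (Hdiv R Gamma S) d.
Proof.
have GO : mg_set Gamma `<=` @OT by [].
have GsO : mg_set Gammastar `<=` @OT := OTstar_sub.
split.
  move=> _ [_ [x [r Sr rx] <-] <-]; rewrite natmapE; exists x => //.
  by exists r => //; exact: SS'.
have iS := Hcone_invariant R GO St.
have [m1 m2] := moved_invariant; have [s1 s2] := iS.
exists (orb Gamma @` [set x | (@Hcone R S `&` moved) (hx x)]); split.
- apply: descent => //; last first.
    by move=> w Dw; apply: ana_atI; [exact: Hcone_locana|exact: moved_locana].
  split=> [c w c0 Dw [h1 h2]|g w Gg Dw [h1 h2]].
    by split; [exact: s1|exact: m1].
  by split; [exact: s2|exact: m2].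
- by rewrite Hdiv_cone => _ [x [h _] <-]; exists x.
- move=> E; have [w [x [wx Sx _ H]]] := Hdiv_generic_point R GO St SD Srho co0_rho co1_rho.
  move: Sx; rewrite -E => -[y [_ [g Og [[i ni] [c c0 Eg]]]] xy].
  have [h Oh [e e0 Eh]] := orb_coordsP xy.
  have mx : moved (hx x).
    have -> : hx x = e^-1 *: (hx y *m ext h) by rewrite Eh scalerA mulVf // scale1r.
    apply: m1; rewrite ?invr_eq0 //; first by apply: Dc_mul => //; exact: Dc_hx.
    by apply: m2 => //; [exact: Dc_hx|exists g => //; split; [exists i|exists c]].
  have [g' Og' [[j nj] [c' c0' Eg']]] : moved w.
    by have [a a0 ->] := wx; apply: m1 => //; exact: Dc_hx.
  by apply: nj; apply: H Og' Eg' _ _; exact: even_rA1.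
move=> y; rewrite Hdiv_cone => -[x Sx <-] nN.
have nm : ~ moved (hx x) by move=> mx; apply: nN; exists x.
have [K Kd HK] := fibre Sx nm.
have zex k : exists z, coords (hx x *m ext (swap k)) z.
  by apply: coords_ex; apply: Dc_mul (swap_OT k) (Dc_hx x).
have [z Hz] := choice zex.
(* A coincidence yields an element stabilising the line of x and sending class k to class l; as x is
   not moved, k = l. *)
have inj k l : orb Gammastar (z k) = orb Gammastar (z l) -> k = l.
  move=> /orb_coordsP[h /OTstarP[Oh h0] [c c0 E]].
  have [a a0 Ea] := Hz k; have [b b0 Eb] := Hz l.
  have ul : swap l \in unitmx by case: (swap_OT l).
  have : ~ moves_class (swap k *m h *m invmx (swap l)).
    move=> mv; apply: nm; exists (swap k *m h *m invmx (swap l)).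
      by apply: OT_mul; [apply: OT_mul => //; exact: swap_OT|apply: OT_inv; exact: swap_OT].
    split=> //; exists (a * c * b^-1); first by rewrite !mulf_neq0 ?invr_eq0.
    have -> : hx x *m ext (swap k *m h *m invmx (swap l)) = a *: (hx (z k) *m ext h) *m ext (invmx (swap l)).
      by rewrite !extM !mulmxA Ea scalemxAl.
    rewrite E scalerA; have -> : hx (z l) = b^-1 *: (hx x *m ext (swap l)).
      by rewrite Eb scalerA mulVf // scale1r.
    by rewrite scalerA -scalemxAl -mulmxA ext_unit // mulmx1.
  move=> /forallNP/(_ k)/contrapT H; apply: cong_rA1.
  apply: cong2_trans (cong2_sym H) _; rewrite !mulmxA swap_self.
  by have := cong2_mul (invmx (swap l)) h0; rewrite swapV.
have -> : Hdiv R Gammastar S' `&` natmap R @^-1` [set orb Gamma x] =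
    (fun k => orb Gammastar (z k)) @` (@enum_val _ (mem K) @` [set: 'I_#|K|]).
  apply/seteqP; split; last first.
    move=> _ [_ [i _ <-] <-] /=; set k := enum_val i.
  have kK : k \in K by exact: enum_valP.
  have SC := Hdiv_coords GsO St' (Hz k).
  split; first by apply: SC.2; apply/HK.
  rewrite /= natmapE; apply/esym.
  exact: (@orb_mul R Gamma _ _ _ _ (swap_OT _) (coords_hx x) (Hz k)).
  move=> q [Sq]; have [u uq] := orb_surj q; rewrite -{}uq in Sq *.
  rewrite /= natmapE => /esym/orb_coordsP[g Og [c c0 E]].
  (* The coset of g is found from the class k that g sends to class 0: then [invmx (swap k) *m g]
     fixes class 0. *)
  have [s si Hs] := perm_class (OT_inv Og); pose k := s ord0.
  have ug : g \in unitmx by case: Og.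
  have uk : swap k \in unitmx by case: (swap_OT k).
  have Sg : OTstar (invmx (swap k) *m g).
    apply/OTstarP; split; first by apply: OT_mul => //; apply: OT_inv; exact: swap_OT.
    rewrite mulmxA swapV; apply: cong2_trans (cong2_sym (cong2_mul g (Hs ord0))) _.
    by rewrite -mulmxA mulVmx // mulmx1; exact: cong2_refl.
  have zu : orb Gammastar (z k) = orb Gammastar u.
    apply: (@orb_mul R Gammastar _ _ _ _ Sg (Hz k)); rewrite extM mulmxA -(mulmxA (hx x)) ext_unit // mulmx1 E.
    by apply: coordsZ => //; exact: coords_hx.
  have kK : k \in K.
    by apply/HK; apply/(Hdiv_coords GsO St' (Hz k)); rewrite zu.
  exists k; last exact: zu.
  by exists (enum_rank_in kK k) => //; rewrite enum_rankK_in.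
rewrite -Kd; apply: card_eq_trans (card_esym card_II).
apply: card_eq_trans (inj_card_eq _) (inj_card_eq _).
  by move=> k l _ _; exact: inj.
by move=> i j _ _; exact: enum_val_inj.
Qed.

End Cover.

(** The pairing of r and s is 0 modulo 4 since their classes differ, and at most 2 in absolute value
    since r + s and r - s, being orthogonal to a period, have nonpositive norm. So it is 0, and r -
    s has norm -4 and even pairings, as [reflection] requires. *)
Lemma root_through_class x r s i j : ~ moved (hx x) ->
  form r r = - 2 -> cong2 r (rA1 i) -> form (ext r) (hx x) = 0 ->
  form s s = - 2 -> cong2 s (rA1 j) -> form (ext s) (hx x) = 0 -> i = j.
Proof.
move=> nm rr ri rx ss sj sx; apply: contrapT => /eqP ij; apply: nm.
have [a Ea] := form_cong4 (cong_even_rA1 sj) ri.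
have [b Eb] := form_cong4 (even_rA1 i) sj.
rewrite (formC (rA1 i)) Eb form_rA1_rA1 eq_sym (negbTE ij) mulr0 in Ea.
have neg t : form (ext t) (hx x) = 0 -> form t t <= 0.
  rewrite formC => h; have := maj_ge0 (ext t) (Dc_hx x).
  by rewrite (maj_orth h) oppr_ge0 lerz0.
have n1 : form (r + s) (r + s) <= 0.
  by apply: neg; rewrite extD formDl rx sx addr0.
have n2 : form (r - s) (r - s) <= 0.
  by apply: neg; rewrite extD extN formDl formNl rx sx subr0.
have E1 : form (r + s) (r + s) = - 4 + 2 * form r s by rewrite !formlinE (formC s r) rr ss; ring.
have E2 : form (r - s) (r - s) = - 4 - 2 * form r s by rewrite !formlinE (formC s r) rr ss; ring.
have rs : form r s = 0 by rewrite E1 in n1; rewrite E2 in n2; rewrite Ea in n1 n2 *; lia.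
have vv : form (r - s) (r - s) = - 4 by rewrite E2 rs mulr0 subr0.
have ev : even_vec (r - s).
  move=> t; have [p Ep] := cong_even_rA1 ri t; have [q Eq] := cong_even_rA1 sj t.
  by exists (p - q); rewrite formBl Ep Eq; ring.
have [g Og Eg] := reflection vv ev; exists g => //; split; last first.
  exists 1; rewrite ?oner_neq0 // scale1r.
  have := reflection_act (hx x) Eg.
  have -> : form (hx x) (ext (r - s)) = 0 by rewrite formC extD extN formDl formNl rx sx subr0.
  rewrite scale0r addr0 => /(congr1 (fun v => 2^-1 *: v)).
  by rewrite !scalerA mulVf ?pnatr_eq0 // !scale1r.
have rg : r *m g = s.
  apply: scale2_inj; rewrite (reflection_int r Eg) formBr rr rs.
  by apply: co_inj => l _; rewrite !(coD, coN, coZ); ring.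
exists i => h; move: ij => /eqP; apply; apply: cong_rA1.
apply: cong2_trans (cong2_sym h) _; apply: cong2_trans _ sj.
by rewrite -rg; apply: cong2_mul; exact: cong2_sym.
Qed.

End Degree.

(** * Fibres over the divisors *)

Section Fibres.
Variable R : realType.
Implicit Types (x : D R) (r s : latT).

(** The set S is stable under the whole group, so no translate leaves the divisor and the degree is
    the number of cosets. *)
Lemma fibre_all (S : set latT) x : stable_set Gamma S -> Hcone S (hx x) ->
  exists2 K : {set 'I_5}, #|K| = 5 & forall k, k \in K <-> Hcone S (hx x *m ext (swap k)).
Proof.
move=> St Sx; exists [set: 'I_5]%SET; first by rewrite finset.cardsT card_ord.
move=> k; rewrite finset.in_setT; split=> // _.
have GO : mg_set Gamma `<=` @OT by [].
have [_ h] := Hcone_invariant R GO St; apply: h => //; [exact: swap_OT|exact: Dc_hx].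
Qed.

Lemma root_swap r x k : form (ext r) (hx x *m ext (swap k)) = 0 ->
  form (ext (r *m invmx (swap k))) (hx x) = 0.
Proof.
have uk : swap k \in unitmx by case: (swap_OT k).
move=> <-; rewrite -(isometry_form (ext (r *m invmx (swap k))) (hx x) (swap_OT k)) -extM.
by have -> : r *m invmx (swap k) *m swap k = r by rewrite -mulmxA mulVmx // mulmx1.
Qed.

(** All roots of [Delta3] through x have one class j, and [swap k] carries class k to class 0; only
    k = j puts the translate on this divisor. *)
Lemma fibre_3b x : Hcone Delta3 (hx x) -> ~ moved (hx x) ->
  exists2 K : {set 'I_5}, #|K| = 1 & forall k, k \in K <-> Hcone Delta3b (hx x *m ext (swap k)).
Proof.
move=> [r /Delta3P[rr [j rj]] rx] nm; exists [set j]%SET; first by rewrite cards1.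
move=> k; rewrite finset.in_set1; split.
  move=> /eqP ->; exists (r *m swap j); last by rewrite extM isometry_form //; exact: swap_OT.
  apply/Delta3bP; split; first by apply: root_mul => //; exact: swap_OT.
  by rewrite -(swap_self j); exact: cong2_mul.
move=> [s /Delta3bP[ss s0] /root_swap sx]; apply/eqP.
have Oi := OT_inv (swap_OT k).
apply: (root_through_class nm (root_mul Oi ss) _ sx rr rj rx).
by rewrite -(swapV k); exact: cong2_mul.
Qed.

(** The complementary case: for k other than j, [swap k] sends the common class j of the roots
    through x to a class other than 0. *)
Lemma fibre_3a x : Hcone Delta3 (hx x) -> ~ moved (hx x) ->
  exists2 K : {set 'I_5}, #|K| = 4 & forall k, k \in K <-> Hcone Delta3a (hx x *m ext (swap k)).
Proof.
move=> [r /Delta3P[rr [j rj]] rx] nm; exists [set~ j]%SET; first by rewrite cardsC1 card_ord.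
move=> k; rewrite finset.in_setC1; split.
  rewrite eq_sym => /swap_other[i i0 h].
  exists (r *m swap k); last by rewrite extM isometry_form //; exact: swap_OT.
  apply/Delta3aP; split; first by apply: root_mul => //; exact: swap_OT.
  by exists i; split=> //; exact: class_mul (swap_OT k) rj h.
move=> [s /Delta3aP[ss [i [i0 si]]] /root_swap sx]; apply/eqP => kj.
have Oi := OT_inv (swap_OT k).
have [t ti Ht] := perm_class Oi.
have e1 := root_through_class nm (root_mul Oi ss) (class_mul Oi si (Ht i)) sx rr rj rx.
have e2 : t ord0 = k.
  by apply: cong_rA1; apply: cong2_trans (cong2_sym (Ht ord0)) _; rewrite swapV; exact: cong2_refl.
by move: i0; rewrite -(inj_eq ti) e1 e2 kj eqxx.
Qed.

End Fibres.

Theorem corollary1 (R : realType) :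
  let H1 := Hdiv R Gamma Delta1 in
  let H2 := Hdiv R Gamma Delta2 in
  let H3 := Hdiv R Gamma Delta3 in
  let H1s := Hdiv R Gammastar Delta1 in
  let H2s := Hdiv R Gammastar Delta2 in
  let H3as := Hdiv R Gammastar Delta3a in
  let H3bs := Hdiv R Gammastar Delta3b in
  [/\ (forall Z, irreducible_component (Hdiv R Gamma Delta) Z <->
         [\/ Z = H1, Z = H2 | Z = H3]),
      [/\ H1 <> H2, H1 <> H3 & H2 <> H3],
      (forall Z, irreducible_component (Hdiv R Gammastar Delta) Z <->
         [\/ Z = H1s, Z = H2s, Z = H3as | Z = H3bs]),
      [/\ H1s <> H2s, H1s <> H3as & H1s <> H3bs] /\
      [/\ H2s <> H3as, H2s <> H3bs & H3as <> H3bs]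
    & [/\ induces_map_of_degree (natmap R) H1s H1 5,
          induces_map_of_degree (natmap R) H2s H2 5,
          induces_map_of_degree (natmap R) H3as H3 4
        & induces_map_of_degree (natmap R) H3bs H3 1]].
Proof.
move=> H1 H2 H3 H1s H2s H3as H3bs.
have [C3 I3] := components_Gamma R; have [C4 I4] := components_Gammastar R.
have GO : mg_set Gamma `<=` @OT by [].
have St1 : stable_set Gammastar Delta1 by apply: Delta1_stable; exact: OTstar_sub.
have St2 : stable_set Gammastar Delta2 by apply: Delta2_stable; exact: OTstar_sub.
split.
- move=> Z; rewrite C3; split.
    by move=> [[[]|] ->]; [apply: Or32|apply: Or33|apply: Or31].
  by move=> [->|->|->]; [exists None|exists (Some true)|exists (Some false)].
- split=> E.
  + by have := I3 None (Some true) E.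
  + by have := I3 None (Some false) E.
  + by have := I3 (Some true) (Some false) E.
- move=> Z; rewrite C4; split.
    by move=> [[[] []] ->]; [apply: Or41|apply: Or42|apply: Or43|apply: Or44].
  by move=> [->|->|->|->]; [exists (true, true)|exists (true, false)|exists (false, true)|exists (false, false)].
- split; split=> E.
  + by have := I4 (true, true) (true, false) E.
  + by have := I4 (true, true) (false, true) E.
  + by have := I4 (true, true) (false, false) E.
  + by have := I4 (true, false) (false, true) E.
  + by have := I4 (true, false) (false, false) E.
  + by have := I4 (false, true) (false, false) E.
split.
- apply: (cover_degree (Delta1_stable GO) _ rho1_Delta1 (co_rho1 _) (co_rho1 _) St1) => //.
    by move=> r [].
  by move=> x Sx _; exact: fibre_all (Delta1_stable GO) Sx.
- apply: (cover_degree (Delta2_stable GO) _ rho2_Delta2 (co_rho2 _) (co_rho2 _) St2) => //.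
    by move=> r [].
  by move=> x Sx _; exact: fibre_all (Delta2_stable GO) Sx.
- apply: (cover_degree Delta3_stable _ (rho3_Delta3 ord0) (co_rho3 _ _) (co_rho3 _ _) Delta3a_stable Delta3a_sub) => //.
    by move=> r [].
  by move=> x; exact: fibre_3a.
- apply: (cover_degree Delta3_stable _ (rho3_Delta3 ord0) (co_rho3 _ _) (co_rho3 _ _) Delta3b_stable Delta3b_sub) => //.
    by move=> r [].
  by move=> x; exact: fibre_3b.
Qed.
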